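(* Let $j\ge0$ be an integer and let $\mathbf n=(n_1,n_2,\dots)$ be a sequence of non-negative integers, with finitely many but at least one non-zero entries, satisfying \[-2j+\sum_{k\ge1}(k-2)n_k=-2 .\] Define $n:=j-1+\sum_k n_k$. The cyclic group of order $2n$ acts on $\mathrm{TM}(j,\mathbf n)$ by the rotation $R$, and the triple \[\left(\mathrm{TM}(j,\mathbf n),\ \langle R\rangle,\ \frac{[2n]_q}{[j+1]_q\,[n+j+1]_q\,[n+j]_q}\begin{bmatrix}n+j+1\\ j,j,n_1,n_2,\dots\end{bmatrix}_q\right)\] exhibits the cyclic sieving phenomenon.
   Context: A planar map is a proper embedding of a connected planar graph (loops and multiple edges allowed) in the oriented sphere, up to orientation-preserving homeomorphism; its faces are the connected components of the complement. The degree of a vertex is the number of half-edges incident to it (a loop contributes $2$). A corner is a sector delimited by two consecutive half-edges around a vertex (a vertex of degree $k$ has $k$ corners). A rooted map is a map with a distinguished corner. A tree-rooted map is a rooted planar map with a distinguished spanning tree. $\mathrm{TM}(j,\mathbf n)$ is the set of tree-rooted maps with $j+1$ faces and exactly $n_k$ vertices of degree $k$ (in the map) for each $k\ge1$; such maps have $n$ edges and $2n$ corners. Rotation $R$ on tree-rooted maps: it moves the root corner to the next corner of the map around the spanning tree, in counterclockwise order (keeping the map and the spanning tree). Precisely, identify a corner with the half-edge $h$ that follows it counterclockwise around its vertex; let $\alpha(h)$ be the other half of the same edge and $\sigma(h')$ the half-edge following $h'$ counterclockwise around its vertex; the next corner is $\sigma(\alpha(h))$ if $h$ belongs to an edge of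 the spanning tree, and $\sigma(h)$ otherwise. All $2n$ corners of the map are visited cyclically, so $R^{2n}=\mathrm{id}$, and the cyclic group of order $2n$ acts with its generator acting as $R$ (the action need not be faithful). $q$-notation: $[M]_q=\frac{1-q^M}{1-q}$, $[M]_q!=[1]_q\cdots[M]_q$, $[0]_q!=1$; for non-negative integers $N_1,N_2,\dots$ with $\sum_iN_i=M$, $\begin{bmatrix}M\\ N_1,N_2,\dots\end{bmatrix}_q=\frac{[M]_q!}{\prod_{i\ge1}[N_i]_q!}$. Cyclic sieving phenomenon: given a finite set $S$, an action on $S$ of a cyclic group $G$ of order $m$ with generator $g$, and a polynomial $P(q)$ with non-negative integer coefficients, the triple $(S,G,P)$ exhibits the cyclic sieving phenomenon if the number of elements of $S$ fixed by $g^e$ equals $P(\omega^e)$ for all primitive $m$-th roots of unity $\omega$ and all integers $e$. (Part of the assertion is that the given $P$ is a polynomial with non-negative integer coefficients.) *)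

(* Defs.v *)
From HB Require Import structures.
From mathcomp Require Import all_boot all_order all_fingroup all_algebra all_field.
From mathcomp Require Import boolp.

Set Implicit Arguments.
Unset Strict Implicit.
Unset Printing Implicit Defensive.

Import Order.TTheory GRing.Theory Num.Theory.

(* A map is encoded by its rotation system on a finite type D of half-edges.   *)
(* A corner is identified with the half-edge that follows it counterclockwise  *)
(* around its vertex; in particular the root corner is a half-edge. The        *)
(* spanning tree is the set of half-edges of its edges.                        *)
Record trmap (D : finType) := TRMap {
  vperm : {perm D}; (* next half-edge counterclockwise around the vertex *)
  eperm : {perm D}; (* other half of the edge *)
  tree : {set D};
  root_corner : D
}.

Section TRMapFinite.
Variable D : finType.

Definition trmap_tuple (m : trmap D) := (vperm m, eperm m, tree m, root_corner m).
Definition tuple_trmap (t : {perm D} * {perm D} * {set D} * D) :=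
  let: (s, a, T, r) := t in TRMap s a T r.

Lemma trmap_tupleK : cancel trmap_tuple tuple_trmap.
Proof. by case. Qed.

HB.instance Definition _ := Finite.copy (trmap D) (can_type trmap_tupleK).

End TRMapFinite.

Section Maps.
Variable D : finType.
Implicit Types (m : trmap D) (T : {set D}) (h : D) (c : seq D).

Definition vertices m : {set {set D}} := porbits (vperm m).
Definition edges m : {set {set D}} := porbits (eperm m).
Definition faces m : {set {set D}} := porbits (eperm m * vperm m)%g.

(* One step in the spanning subgraph whose edges are those in T: turn around   *)
(* a vertex or traverse an edge of T.                                          *)
Definition step m T : rel D :=
  [rel x y | (y == vperm m x) || (x \in T) && (y == eperm m x)].

Definition connected m T : Prop := forall x y, connect (step m T) x y.

(* A simple cycle, given by the half-edges at the start of its edges: distinct *)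
(* vertices and distinct edges. Loops (size 1) and pairs of parallel edges     *)
(* (size 2) are simple cycles; an edge followed back and forth is not.         *)
Definition simple_cycle m c : Prop :=
  [/\ c <> [::],
      path.cycle [rel x y | y \in porbit (vperm m) (eperm m x)] c,
      uniq [seq porbit (vperm m) x | x <- c]
    & uniq [seq porbit (eperm m) x | x <- c]].

Definition is_spanning_tree m T : Prop :=
  [/\ forall h, h \in T -> eperm m h \in T,
      connected m T
    & forall c, {subset c <= T} -> ~ simple_cycle m c].

(* Sphere embeddings are the rotation systems of Euler characteristic 2. *)
Definition is_planar_map m : Prop :=
  [/\ forall h, eperm m h != h,
      forall h, eperm m (eperm m h) = h,
      connected m [set: D]
    & (#|vertices m| + #|faces m| = #|edges m| + 2)%N].

Definition is_tree_rooted m : Prop :=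
  is_planar_map m /\ is_spanning_tree m (tree m).

Definition relabel (p : {perm D}) m : trmap D :=
  TRMap (vperm m ^ p)%g (eperm m ^ p)%g (p @: tree m) (p (root_corner m)).

Definition iso_class m : {set trmap D} := [set relabel p m | p : {perm D}].

Definition next_corner m h : D :=
  if h \in tree m then vperm m (eperm m h) else vperm m h.

Definition rotate_root m : trmap D :=
  TRMap (vperm m) (eperm m) (tree m) (next_corner m (root_corner m)).

(* R, acting on isomorphism classes. *)
Definition rotation (C : {set trmap D}) : {set trmap D} := rotate_root @: C.

Definition has_type (j : nat) (nn : nat -> nat) m : Prop :=
  #|faces m| = j.+1 /\
  forall k, (1 <= k)%N -> #|[set v in vertices m | #|v| == k]| = nn k.

End Maps.

(* Unlabelled maps with n edges are the isomorphism classes of maps whose      *)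
(* half-edges are labelled by 'I_(2 * n).                                      *)
Definition TM (n j : nat) (nn : nat -> nat) : {set {set trmap 'I_(2 * n)}} :=
  [set iso_class m | m : trmap 'I_(2 * n) &
                     `[< is_tree_rooted m /\ has_type j nn m >]].

Section QAnalogues.
Local Open Scope ring_scope.

Definition qvar : {fraction {poly int}} := tofrac 'X.

Definition qnum (M : nat) : {fraction {poly int}} :=
  (1 - qvar ^+ M) / (1 - qvar).

Definition qfact (M : nat) : {fraction {poly int}} :=
  \prod_(1 <= i < M.+1) qnum i.

(* Meant for lists s of sum M. *)
Definition qmultinomial (M : nat) (s : seq nat) : {fraction {poly int}} :=
  qfact M / \prod_(N <- s) qfact N.

End QAnalogues.

Definition expgz (gT : finGroupType) (g : gT) (e : int) : gT :=
  match e with Posz k => (g ^+ k)%g | Negz k => (g ^- k.+1)%g end.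

Definition cyclic_sieving (gT : finGroupType) (g : gT) (T : finType)
    (to : action <[g]>%g T) (S : {set T}) (P : {poly int}) : Prop :=
  [/\ [acts <[g]>%g, on S | to]%g,
      forall i, (0 <= P`_i)%R
    & forall (w : algC) (e : int), ((#[g]%g).-primitive_root w)%R ->
        (#|'Fix_(S | to)[expgz g e]%g|%:R = (map_poly intr P).[w ^ e] :> algC)%R].

(* Main.v *)
(* Walking around the spanning tree visits all L = 2n corners cyclically, so
   every unlabelled map has exactly one labelling by Z/L in which the walk is
   c : x |-> x + 1 and the root is 0. The edge permutation then splits as t * b,
   where t pairs the half-edges of the tree edges and b those of the other
   edges; the vertices are the cycles of t * c and the faces those of b * c. By
   Euler's formula the map is planar and t a spanning tree iff t and b are
   noncrossing involutions with complementary supports, and R is conjugation by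
   c^-1. Hence R^e fixes the pairs (t, b) invariant under rotation by gcd(e, L).

   Invariant pairs are counted with d = L / p, p > 1. A noncrossing involution
   invariant under rotation by d either has a diameter (then p = 2) or has
   uncovered points, where it can be cut into p equal plane forests; forests are
   counted by the cycle lemma. Given t, the b with the complementary support are
   the rotation-invariant noncrossing matchings of 2j points.

   On the other side P = [2n] [n+j-1]! / ([j+1]! [j]! prod_k [n_k]!) is the
   product of the q-Catalan number of j and of a polynomial counting the trees.
   Nonnegativity follows from the unimodality of q-binomials, proved with an
   sl2-action. At a primitive p-th root of unity each [m]! contributes
   [p]^(m/p) times a nonzero factor; the powers of [p] cancel exactly when
   invariant pairs exist, and P vanishes otherwise. *)

Require Import Defs.
From HB Require Import structures.
From mathcomp Require Import all_boot all_order all_fingroup all_solvable all_algebra all_field.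
From mathcomp Require Import boolp zify ring.

Set Implicit Arguments.
Unset Strict Implicit.
Unset Printing Implicit Defensive.

(** * Spanning trees and contour walks *)

(** Invariant involutions are counted through marked corners. Rotation makes all places of the mark
    equivalent, so the mark is put at 0, where the cutting is canonical. For trees the marks are the
    corners of the vertex at the centre; its degree is forced by the residues of [nn] modulo p, and
    cancels against the number of trees in the cycle lemma, so that only the quotients of the [nn k]
    by p remain. For matchings the number of marks varies; summing over it brings in ballot numbers
    and a hockey-stick sum.

    The obstacle to positivity is a division by a quantum integer. The tree factor is a sum over the
    degree k of the root vertex, and each term is a q-multinomial times a geometric sum, divided by
    the quantum integer of the multinomial's size. That this is a polynomial follows from an ideal
    and gcd argument using Euler's relation; that it is nonnegative holds because the multinomial is
    symmetric unimodal and the geometric sum is short.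

    At a root of unity, a nonzero value bounds by 2 the sum of the residues modulo p of j, j+1 and
    the [nn k]. The few cases left are those of a central vertex or, for p = 2, of a central
    edge. *)

Lemma porbit_step (D : finType) (s : {perm D}) x : porbit s (s x) = porbit s x.
Proof. by rewrite -[s x]/((s ^+ 1) x)%g porbit_perm. Qed.

Lemma mem_porbit_step (D : finType) (s : {perm D}) x y :
  (s x \in porbit s y) = (x \in porbit s y).
Proof. by rewrite -!eq_porbit_mem porbit_step. Qed.

Lemma porbit_closed_sub (D : finType) (s : {perm D}) (A : {set D}) x y :
  (forall z, z \in A -> s z \in A) -> x \in A -> y \in porbit s x -> y \in A.
Proof.
move=> sA xA /porbitP[i ->].
elim: i => [|i IHi]; first by rewrite expg0 perm1.
by rewrite expgSr permM sA.
Qed.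

Lemma mem_porbit_invol (D : finType) (a : {perm D}) x y : (forall z, a (a z) = z) ->
  (y \in porbit a x) = (y == x) || (y == a x).
Proof.
move=> aK; apply/idP/idP => [/porbitP[i ->]|].
  elim: i => [|i IHi]; first by rewrite expg0 perm1 eqxx.
  rewrite expgSr permM; case/orP: IHi => /eqP ->; rewrite ?aK eqxx ?orbT //.
by case/orP=> /eqP ->; rewrite ?porbit_id // mem_porbit_step porbit_id.
Qed.

Section SpanningTrees.
Variables (D : finType) (m : trmap D).
Notation s := (vperm m).
Notation a := (eperm m).
Hypothesis a_neq : forall h, a h != h.
Hypothesis aK : forall h, a (a h) = h.
Implicit Types F T A : {set D}.

Definition edge_closed F := forall h, h \in F -> a h \in F.

Lemma mem_edge_closed F h : edge_closed F -> (a h \in F) = (h \in F).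
Proof. by move=> cF; apply/idP/idP => /cF //; rewrite aK. Qed.

(** Testing both ends makes this an involution for every [F], so that [eperm_on F] is a permutation
    without any closure hypothesis. *)
Definition restr_fun F x := if (x \in F) && (a x \in F) then a x else x.

Lemma restr_funK F : involutive (restr_fun F).
Proof.
move=> x; rewrite /restr_fun; case: (boolP ((x \in F) && (a x \in F))) => [|/negbTE -> //].
by case/andP=> xF aF; rewrite aK aF xF.
Qed.

Definition eperm_on F : {perm D} := perm (inv_inj (restr_funK F)).

Lemma eperm_onE F h : edge_closed F -> eperm_on F h = if h \in F then a h else h.
Proof.
by move=> cF; rewrite permE /restr_fun mem_edge_closed //; case: (h \in F).
Qed.

Lemma connect_porbit F x y : y \in porbit s x -> connect (step m F) x y.
Proof.
case/porbitP=> i ->.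
elim: i => [|i IHi]; first by rewrite expg0 perm1.
by apply: connect_trans IHi (connect1 _); rewrite /step /= expgSr permM eqxx.
Qed.

Lemma connect_step_sym F : edge_closed F -> connect_sym (step m F).
Proof.
move=> cF; suff sym x y : connect (step m F) x y -> connect (step m F) y x.
  by move=> x y; apply/idP/idP => /sym.
case/connectP=> q; elim: q x => [|z q IHq] x /=.
  by move=> _ ->; apply: connect0.
case/andP=> xz pq yE; apply: connect_trans (IHq _ pq yE) _.
case/orP: xz => [/eqP ->|/andP[xF /eqP ->]].
  by apply: connect_porbit; rewrite porbit_step porbit_id.
by apply: connect1; rewrite /step /= aK eqxx (mem_edge_closed _ cF) xF orbT.
Qed.

(* A vertex-closed set is grown one vertex at a time along edges of F. *)
Lemma connected_card_vertices F :
  edge_closed F -> connected m F -> (#|vertices m|.*2 <= #|F| + 2)%N.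
Proof.
move=> cF conn.
pose eA A := [set x in F | (x \in A) && (a x \in A)].
(* [eA A] holds the half-edges of [F] with both ends in [A]. A new vertex comes with an edge, hence
   with two half-edges, which keeps the inequality; [k] bounds what lies outside [A]. *)
have grow k A x0 : (forall x, x \in A -> s x \in A) -> x0 \in A ->
    (#|porbit s @: A|.*2 <= #|eA A| + 2)%N -> (#|~: A| <= k)%N ->
    (#|vertices m|.*2 <= #|F| + 2)%N.
  elim: k A => [|k IHk] A sA x0A le_vA leAk.
    have AT : A = setT.
      by apply/eqP; rewrite -[A]setCK -subTset -setCS setCT setCK subset0 -cards_eq0 -leqn0.
    move: le_vA; rewrite AT => le_vA; apply: leq_trans (leq_trans le_vA _).
      by rewrite leq_double /vertices subset_leq_card //;
         apply/subsetP=> _ /imsetP[x _ ->]; apply: imset_f; rewrite inE.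
    by rewrite leq_add2r subset_leq_card //; apply/subsetP=> x; rewrite inE => /andP[].
  case: (boolP [exists x in F, (x \in A) && (a x \notin A)]); last first.
    move=> /exists_inPn H; apply: (IHk A) => //.
    have AT : A = setT.
      apply/eqP; rewrite -subTset; apply/subsetP=> y _.
      have clA : closed (step m F) (mem A).
        apply: intro_closed; first exact: connect_step_sym.
        move=> u v /orP[/eqP -> /sA //|/andP[uF /eqP ->] uA].
        by have := H u uF; rewrite uA /= negbK.
      by rewrite -(closed_connect clA (conn x0 y)).
    by rewrite AT setCT cards0.
  case/exists_inP=> x xF /andP[xA axA].
  pose A' := A :|: porbit s (a x).
  have A'A : A \subset A' by apply: subsetUl.
  have axA' : a x \in A' by rewrite inE porbit_id orbT.
  apply: (IHk A').
  - move=> y; rewrite !inE => /orP[/sA -> //|]; rewrite mem_porbit_step => ->.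
    by rewrite orbT.
  - exact: (subsetP A'A).
  - have : (#|porbit s @: A'| <= #|porbit s @: A|.+1)%N.
      apply: (@leq_trans #|porbit s (a x) |: porbit s @: A|).
        apply: subset_leq_card; apply/subsetP=> _ /imsetP[y + ->].
        rewrite !inE => /orP[yA|]; first by rewrite (imset_f (porbit s)) ?orbT.
        by rewrite -eq_porbit_mem => ->.
      by rewrite cardsU1; case: (_ \notin _); rewrite ?add1n ?add0n ?leqnSn.
    have : (#|eA A|.+2 <= #|eA A'|)%N.
      have -> : #|eA A|.+2 = #|x |: (a x |: eA A)|.
        rewrite !cardsU1 !inE (negbTE axA) /= !andbF orbF addnC.
        by rewrite eq_sym a_neq /= addn1 add1n.
      apply: subset_leq_card; apply/subsetP=> y; rewrite !inE.
      case/or3P=> [/eqP ->|/eqP ->|/and3P[-> yA ayA]].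
      + by rewrite xF xA porbit_id orbT.
      + by rewrite aK xA porbit_id orbT (mem_edge_closed _ cF) xF.
      + by rewrite yA ayA.
    move: le_vA; clear; lia.
  - apply: leq_trans (_ : (#|~: A|.-1 <= k)%N); last by move: leAk; clear; lia.
    have : ~: A' \proper ~: A.
      by rewrite properC; apply/properP; split=> //; exists (a x).
    by move/proper_card; lia.
case: (pickP D) => [x0 _|D0]; last first.
  have -> : vertices m = set0; last by rewrite cards0.
  by apply/setP=> v; rewrite inE; apply/imsetP=> [[x]]; have := D0 x.
apply: (grow #|D| (porbit s x0) x0); rewrite ?porbit_id ?max_card //.
  by move=> x; rewrite mem_porbit_step.
apply: (@leq_trans 2); last by rewrite addnC leq_addr.
rewrite -[2]/(1.*2) leq_double -(cards1 (porbit s x0)) subset_leq_card //.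
apply/subsetP=> _ /imsetP[x + ->]; rewrite inE -eq_porbit_mem => /eqP ->.
by rewrite eqxx.
Qed.

Definition dart_rel : rel D := [rel x y | y \in porbit s (a x)].

(* A shortest path of vertices from one end of h to the other, closed by h. *)
Lemma connected_ends_cycle F h :
  edge_closed F -> h \notin F -> connect (step m F) (a h) h ->
  exists2 c, {subset c <= h |: F} & simple_cycle m c.
Proof.
move=> cF hF conn.
(* The path is taken between vertices, not half-edges, so that [shortenP] makes its vertices
   distinct. *)
pose VR := [rel v w : {set D} | [exists x in F, (porbit s x == v) && (porbit s (a x) == w)]].
have connV : connect VR (porbit s (a h)) (porbit s h).
  case/connectP: conn => q; elim: q (a h) => [|y q IHq] x /=.
    by move=> _ ->; apply: connect0.
  case/andP=> /orP[/eqP ->|/andP[xF /eqP ->]] pq hE.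
    by rewrite -(porbit_step s x) -/(porbit _ _); apply: IHq pq hE.
  apply: connect_trans (IHq _ pq hE); apply: connect1 => /=.
  by apply/exists_inP; exists x; rewrite ?eqxx.
case/connectP: connV => q0 pq0 lq0.
case/shortenP: pq0 lq0 => q pq uq _ lq {q0}.
pose dart i := odflt h [pick x in F | (porbit s x == nth set0 (porbit s (a h) :: q) i)
                                      && (porbit s (a x) == nth set0 q i)].
have dartP i : (i < size q)%N -> [/\ dart i \in F,
    porbit s (dart i) = nth set0 (porbit s (a h) :: q) i
    & porbit s (a (dart i)) = nth set0 q i].
  move=> ltiq; have /exists_inP[x xF xP] := (pathP set0 pq) i ltiq.
  rewrite /dart; case: pickP => [y /and3P[? /eqP ? /eqP ?] //|/(_ x)].
  by rewrite xF xP.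
pose ds := mkseq dart (size q).
have dsF x : x \in ds -> exists2 i, (i < size q)%N & x = dart i.
  by case/mapP=> i; rewrite mem_iota => /andP[_ ?] ->; exists i.
have mapds : [seq porbit s x | x <- ds] = take (size q) (porbit s (a h) :: q).
  apply: (@eq_from_nth _ set0); rewrite size_map size_mkseq ?size_take /= ?ltnSn //.
  move=> i ltiq; rewrite (nth_map h) ?size_mkseq // nth_mkseq // nth_take //.
  by have [] := dartP i ltiq.
have uv : uniq [seq porbit s x | x <- h :: ds].
  rewrite map_cons mapds; move: uq.
  rewrite -{1}[_ :: q](cat_take_drop (size q)) lq.
  have -> : drop (size q) (porbit s (a h) :: q) = [:: last (porbit s (a h)) q].
    rewrite (drop_nth set0) /= ?ltnSn // (last_nth set0) drop_oversize //.
  by rewrite cats1 rcons_uniq.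
exists (h :: ds).
  move=> x; rewrite !inE => /orP[->//|/dsF[i ltiq ->]].
  by have [-> _ _] := dartP i ltiq; rewrite orbT.
split=> //.
- have pE : forall i j, (i + j <= size q)%N -> forall x,
    porbit s (a x) = nth set0 (porbit s (a h) :: q) i ->
    path dart_rel x [seq dart k | k <- iota i j] /\
    porbit s (a (last x [seq dart k | k <- iota i j])) = nth set0 (porbit s (a h) :: q) (i + j).
    move=> i j; elim: j i => [|j IHj] i leij x xi /=; first by rewrite addn0.
    have ltiq : (i < size q)%N by lia.
    have [_ d1 d2] := dartP i ltiq.
    have -> : dart_rel x (dart i) by rewrite /dart_rel /= -eq_porbit_mem d1 xi.
    rewrite addnS /=.
    by have := IHj i.+1; rewrite addSn; apply=> //; lia.
  have [] := pE 0 (size q) (leqnn _) h erefl.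
  rewrite add0n /= rcons_path => -> /= lE.
  by rewrite /dart_rel /= -eq_porbit_mem lE lq -last_nth eqxx.
(* As the vertices are distinct, an edge used twice would be followed in both directions, at
   positions [i] and [k] with [i.+1 = k] and [k.+1 = i]. *)
- rewrite map_inj_in_uniq; first exact: (map_uniq uv).
  move=> x y xc yc /eqP; rewrite eq_porbit_mem (mem_porbit_invol _ _ aK) => /orP[/eqP //|/eqP xE].
  have ahF : a h \notin F by rewrite mem_edge_closed.
  have nah z : z \in h :: ds -> z != a h.
    rewrite !inE => /orP[/eqP ->|/dsF[i ltiq ->]]; first by rewrite eq_sym a_neq.
    by have [dF _ _] := dartP i ltiq; apply: contraNneq ahF => <-.
  have yE : y = a x by rewrite xE aK.
  move: (xc) (yc); rewrite !inE.
  case/orP=> [/eqP xh|/dsF[i ltiq xi]].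
    by move=> _; have := nah y yc; rewrite yE xh eqxx.
  case/orP=> [/eqP yh|/dsF[k ltkq yk]].
    by have := nah x xc; rewrite xE yh eqxx.
  have [_ i1 i2] := dartP i ltiq; have [_ k1 k2] := dartP k ltkq.
  move: i2 k2; rewrite -xi -yk -xE -yE xi yk i1 k1.
  rewrite -[nth set0 q i]/(nth set0 (porbit s (a h) :: q) i.+1).
  rewrite -[nth set0 q k]/(nth set0 (porbit s (a h) :: q) k.+1).
  have inj u v : (u <= size q)%N -> (v <= size q)%N ->
      nth set0 (porbit s (a h) :: q) u = nth set0 (porbit s (a h) :: q) v -> u = v.
    by move=> lu lv /eqP; rewrite nth_uniq // => /eqP.
  by move=> /inj e1 /inj e2; move: (e1 (ltnW ltkq) ltiq) (e2 (ltnW ltiq) ltkq); lia.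
Qed.

Lemma eperm_on_step F x y :
  edge_closed F -> y \in porbit (eperm_on F * s)%g x -> connect (step m F) x y.
Proof.
move=> cF /porbitP[i ->].
elim: i => [|i IHi]; first by rewrite expg0 perm1.
apply: connect_trans IHi _; rewrite expgSr permM permM eperm_onE //.
set z := (_ x); case: ifP => zF; last by apply: connect1; rewrite /step /= eqxx.
apply: (@connect_trans _ _ (a z)); apply: connect1; rewrite /step /= ?eqxx // zF.
by rewrite orbT.
Qed.

Lemma eperm_on_setU F h : edge_closed F -> h \notin F ->
  eperm_on ([set h; a h] :|: F) = (tperm h (a h) * eperm_on F)%g.
Proof.
move=> cF hF.
have cF' : edge_closed ([set h; a h] :|: F).
  move=> x; rewrite !inE => /orP[/orP[]/eqP ->|/cF ->]; rewrite ?aK ?eqxx ?orbT //.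
have ahF : a h \notin F by rewrite mem_edge_closed.
apply/permP=> x; rewrite permM !eperm_onE // !inE.
case: tpermP => [->|->|/eqP/negbTE -> /eqP/negbTE -> //].
  by rewrite eqxx (negbTE ahF).
by rewrite aK eqxx orbT (negbTE hF).
Qed.

(** With no edge the cycles are the vertices, and each further edge multiplies by the transposition
    of its ends. It merges two cycles: it could split one only if its ends were already connected,
    and then it would close a simple cycle. *)
Lemma card_porbits_eperm_on T F : edge_closed F ->
    (forall c, {subset c <= T} -> ~ simple_cycle m c) -> F \subset T ->
  (#|porbits (eperm_on F * s)%g|.*2 + #|F| = #|vertices m|.*2)%N.
Proof.
move=> + acyc; elim: {F}_.+1 {-2}F (ltnSn #|F|) => // k IHk F ltFk cF FT.
have [->|[h hF]] := set_0Vmem F.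
  rewrite cards0 addn0; congr (#|porbits _|.*2).
  by apply/permP=> x; rewrite permM eperm_onE ?inE // => ?; rewrite inE.
pose F' := F :\: [set h; a h].
have cF' : edge_closed F'.
  move=> x; rewrite !inE negb_or => /andP[/andP[xh xah] xF].
  rewrite (cF _ xF) andbT negb_or; apply/andP; split.
    by apply: contraNneq xah => <-; rewrite aK.
  by apply: contraNneq xh => /(congr1 a); rewrite !aK => ->.
have hF' : h \notin F' by rewrite !inE eqxx.
have FE : F = [set h; a h] :|: F'.
  apply/setP=> x; rewrite !inE; case: eqP => [->|_]; first by rewrite hF.
  by case: eqP => [->|_] //=; rewrite cF.
have cardF : #|F| = #|F'|.+2.
  rewrite {1}FE cardsU disjoint_setI0; last first.
    by rewrite -setI_eq0; apply/eqP/setP=> x; rewrite !inE; case: (_ || _).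
  by rewrite cards0 subn0 cards2 eq_sym a_neq.
have F'T : F' \subset T by apply: subset_trans FT; apply: subsetDl.
rewrite {1}FE eperm_on_setU // -mulgA.
have := porbits_mul_tperm (eperm_on F' * s)%g h (a h).
rewrite eq_sym a_neq /= => cnt.
have /negbTE hn : h \notin porbit (eperm_on F' * s)%g (a h).
  apply/negP=> /(eperm_on_step cF') /(connected_ends_cycle cF' hF')[c sc].
  apply: acyc => x /sc; rewrite !inE => /orP[/eqP ->|/andP[_ xF]]; exact: (subsetP FT).
have := IHk F' _ cF' F'T; rewrite cardF in ltFk *; move=> /(_ (ltnW ltFk)).
have -> : #|porbits (eperm_on F' * s)%g| = #|porbits (tperm h (a h) * (eperm_on F' * s))%g|.+1.
  by apply/eqP; rewrite -(eqn_add2r 1) -cnt hn addn2 addn1.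
by move=> <-; rewrite doubleS !addSn !addnS.
Qed.

Lemma next_cornerE F : edge_closed F -> tree m = F ->
  forall h, next_corner m h = (eperm_on F * s)%g h.
Proof.
by move=> cF TF h; rewrite /next_corner TF permM eperm_onE //; case: ifP.
Qed.

(** Acyclicity gives twice the number of contour cycles plus [#|T|] as twice the number of vertices,
    and connectedness bounds the latter by [#|T| + 2]; hence there is a single contour cycle. *)
Lemma spanning_tree_contour T x0 : is_spanning_tree m T ->
  (#|vertices m|.*2 = #|T| + 2)%N /\ forall x, x \in porbit (eperm_on T * s)%g x0.
Proof.
case=> cT conn acyc.
have le := connected_card_vertices cT conn.
have eq := card_porbits_eperm_on cT acyc (subxx T).
have gt0 : (0 < #|porbits (eperm_on T * s)%g|)%N.
  by apply/card_gt0P; exists (porbit (eperm_on T * s)%g x0); apply: imset_f.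
have one : #|porbits (eperm_on T * s)%g| = 1 by lia.
split; first by lia.
move=> x; rewrite -eq_porbit_mem.
have /cards1P[v vE] := introT eqP one.
have inv y : porbit (eperm_on T * s)%g y = v.
  by apply/set1P; rewrite -vE; apply: imset_f.
by rewrite !inv.
Qed.

(** Removing one edge of a cycle keeps the graph connected, but leaves two half-edges fewer than
    [connected_card_vertices] allows. *)
Lemma connected_acyclic T c : edge_closed T -> connected m T ->
  (#|vertices m|.*2 = #|T| + 2)%N -> {subset c <= T} -> ~ simple_cycle m c.
Proof.
move=> cT conn cardV cT' [c0 pc uv ue].
case: c c0 cT' pc uv ue => // x0 c _ cT' pc uv ue.
pose F := T :\: [set x0; a x0].
have x0T : x0 \in T by apply: cT'; rewrite mem_head.
have cF : edge_closed F.
  move=> x; rewrite !inE negb_or => /andP[/andP[xh xah] xF].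
  rewrite (cT _ xF) andbT negb_or; apply/andP; split.
    by apply: contraNneq xah => <-; rewrite aK.
  by apply: contraNneq xh => /(congr1 a); rewrite !aK => ->.
have cF' x : x \in c -> x \in F.
  move=> xc; rewrite !inE cT' ?inE ?xc ?orbT // andbT.
  move: ue; rewrite /= => /andP[+ _]; apply: contra => /orP[] /eqP xE.
    by apply/mapP; exists x => //; rewrite xE.
  apply/mapP; exists x => //; apply/eqP.
  by rewrite eq_porbit_mem (mem_porbit_invol _ _ aK) xE aK eqxx orbT.
have ends : connect (step m F) (a x0) x0.
  move: pc; rewrite /= rcons_path => /andP[pc lc].
  apply: (@connect_trans _ _ (a (last x0 c))); last exact: connect_porbit.
  move: (x0) cF' pc => y; elim: c {cT' uv ue lc} y => [|z c IHc] y cF' /=.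
    by move=> _; apply: connect0.
  case/andP=> yz pc; apply: (@connect_trans _ _ z); first exact: connect_porbit.
  apply: (@connect_trans _ _ (a z)).
    by apply: connect1; rewrite /step /= cF' ?mem_head ?eqxx ?orbT.
  by apply: IHc => // x xc; apply: cF'; rewrite inE xc orbT.
have connF : connected m F.
  move=> x y; apply: (connect_sub _ (conn x y)) => {x y} x y /=.
  case/orP=> [xy|/andP[xT /eqP ->]]; first by apply: connect1; rewrite /step /= xy.
  case: (boolP (x \in F)) => [xF|]; first by apply: connect1; rewrite /step /= xF eqxx orbT.
  rewrite !inE xT andbT negbK => /orP[] /eqP ->; last by rewrite aK.
  by rewrite connect_step_sym.
have := connected_card_vertices cF connF.
have : #|T| = #|F|.+2.
  rewrite -(cardsID [set x0; a x0] T) (setIidPr _); last first.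
    by apply/subsetP=> x; rewrite !inE => /orP[]/eqP ->; rewrite ?cT.
  by rewrite cards2 eq_sym a_neq.
by lia.
Qed.

End SpanningTrees.

(** * Plane forests and noncrossing involutions *)

(* [Arc f r] is a tree whose root has the children f, followed by the trees r. *)
Inductive forest := Empty | Bud of forest | Arc of forest & forest.

Fixpoint len f := match f with
  | Empty => 0 | Bud r => (len r).+1 | Arc g r => len g + (len r).+2 end.
Fixpoint fsize f := match f with
  | Empty => 0 | Bud r => (fsize r).+1 | Arc g r => (fsize r).+1 end.
Fixpoint buds f := match f with
  | Empty => 0 | Bud r => (buds r).+1 | Arc g r => buds g + buds r end.
Fixpoint degs f := match f with
  | Empty => [::] | Bud r => degs r | Arc g r => (fsize g).+1 :: degs g ++ degs r end.
(** The depth-first word. An arc is written as the degree of its lower vertex, parent edge and buds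
    included, and a bud as 0; since [0.-1 = 0], a letter [x] always has [x.-1] children. *)
Fixpoint letters f := match f with
  | Empty => [::] | Bud r => 0 :: letters r
  | Arc g r => (fsize g).+1 :: letters g ++ letters r end.
Fixpoint fcat f h := match f with
  | Empty => h | Bud r => Bud (fcat r h) | Arc g r => Arc g (fcat r h) end.

(* The word of f has one position per bud and two per arc; [mate f] exchanges
   the two ends of each arc and fixes the buds (and every x >= len f). *)
Fixpoint mate f x := match f with
  | Empty => x
  | Bud r => if x is y.+1 then (mate r y).+1 else 0
  | Arc g r => if x is y.+1 then
                 if y < len g then (mate g y).+1
                 else if y == len g then 0
                 else len g + (mate r (y - (len g).+1)).+2
               else (len g).+1
  end.

Lemma len_fcat f h : len (fcat f h) = len f + len h.
Proof. by elim: f => //= [r ->|g _ r ->]; lia. Qed.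

Lemma fsize_fcat f h : fsize (fcat f h) = fsize f + fsize h.
Proof. by elim: f => //= [r ->|g _ r ->]; lia. Qed.

Lemma buds_fcat f h : buds (fcat f h) = buds f + buds h.
Proof. by elim: f => //= [r ->|g _ r ->]; lia. Qed.

Lemma degs_fcat f h : degs (fcat f h) = degs f ++ degs h.
Proof. by elim: f => //= g _ r ->; rewrite catA. Qed.

Lemma letters_fcat f h : letters (fcat f h) = letters f ++ letters h.
Proof. by elim: f => //= [r ->|g _ r ->]; rewrite ?catA. Qed.

Lemma fcatf0 f : fcat f Empty = f.
Proof. by elim: f => //= [r ->|g _ r ->]. Qed.

Lemma len_letters f : len f = buds f + (size (degs f)).*2.
Proof. by elim: f => //= [r ->|g -> r ->]; rewrite ?size_cat; lia. Qed.

Lemma count_letters0 f : count_mem 0 (letters f) = buds f.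
Proof. by elim: f => //= [r ->|g IHg r IHr]; rewrite ?count_cat ?IHg ?IHr. Qed.

Lemma count_letters k f : 0 < k -> count_mem k (letters f) = count_mem k (degs f).
Proof.
move=> k0; elim: f => //= [r ->|g IHg r IHr]; last by rewrite !count_cat IHg IHr.
by case: k k0.
Qed.

Lemma size_letters f : size (letters f) = buds f + size (degs f).
Proof. by elim: f => //= [r ->|g IHg r IHr]; rewrite ?size_cat ?IHg ?IHr //; lia. Qed.

Lemma mate_lt f x : (mate f x < len f) = (x < len f).
Proof.
elim: f x => [|r IHr|g IHg r IHr] x //=; case: x => [|x] //.
- by rewrite !ltnS IHr.
- by lia.
- case: (ltnP x (len g)) => [ltx|lex].
    by have := IHg x; rewrite ltx => ltm; lia.
  case: eqP => [->|nx]; first by lia.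
  by have := IHr (x - (len g).+1); lia.
Qed.

Lemma mateK f : involutive (mate f).
Proof.
elim: f => [|r IHr|g IHg r IHr] [|x] //=.
- by rewrite IHr.
- by rewrite ltnn eqxx.
- case: (ltnP x (len g)) => [ltx|lex]; first by rewrite /= mate_lt ltx IHg.
  case: eqP => [->//|nx].
  rewrite addnS /=; case: (ltnP _ (len g)) => [|_]; first by lia.
  case: eqP => [|_]; first by lia.
  by rewrite (_ : _ - _ = mate r (x - (len g).+1)) ?IHr; lia.
Qed.

Lemma mate_fcat f h x :
  mate (fcat f h) x = if x < len f then mate f x else len f + mate h (x - len f).
Proof.
elim: f x => [|r IHr|g IHg r IHr] x /=.
- by rewrite subn0.
- by case: x => [|x] //; rewrite IHr ltnS; case: ifP => _ //; rewrite subSS.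
- case: x => [|x] /=; first by case: ifP => //; lia.
  case: (ltnP x (len g)) => [ltx|lex]; first by case: ifP => //; lia.
  case: eqP => [->|nx]; first by case: ifP => //; lia.
  rewrite IHr; case: ltnP => h1; case: ltnP => h2; try lia.
  by rewrite (_ : x - (len g).+1 - len r = x.+1 - (len g + (len r).+2)); lia.
Qed.

(* Words: [luk a w] says that w is the depth-first word of a forest with a trees. *)
Fixpoint luk a (w : seq nat) :=
  if w is x :: w' then (0 < a) && luk (a.-1 + x.-1) w' else a == 0.

Fixpoint ftake k f := match k, f with
  | k'.+1, Bud r => Bud (ftake k' r)
  | k'.+1, Arc g r => Arc g (ftake k' r)
  | _, _ => Empty end.
Fixpoint fdrop k f := match k, f with
  | k'.+1, Bud r => fdrop k' r
  | k'.+1, Arc g r => fdrop k' r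
  | _, _ => f end.

Lemma ftake_fcat f h : ftake (fsize f) (fcat f h) = f.
Proof. by elim: f => [|r IHr|g _ r IHr] /=; rewrite ?IHr //; case: h. Qed.

Lemma fdrop_fcat f h : fdrop (fsize f) (fcat f h) = h.
Proof. by elim: f => [|r IHr|g _ r IHr] //=; case: h. Qed.

Lemma fcat_take_drop k f : fcat (ftake k f) (fdrop k f) = f.
Proof. by elim: k f => [|k IHk] [] //= *; rewrite IHk. Qed.

Lemma fsize_take k f : k <= fsize f -> fsize (ftake k f) = k.
Proof. by elim: k f => [|k IHk] [] //= *; rewrite IHk. Qed.

(** Reading from the right, a letter [k.+1] adopts the first [k] trees built so far. *)
Definition unlet (w : seq nat) : forest :=
  foldr (fun x f => if x is k.+1 then Arc (ftake k f) (fdrop k f) else Bud f) Empty w.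

Lemma unlet_letters_cat f w : unlet (letters f ++ w) = fcat f (unlet w).
Proof.
elim: f w => [|r IHr|g IHg r IHr] w //=; first by rewrite IHr.
by rewrite -catA IHg IHr ftake_fcat fdrop_fcat.
Qed.

Lemma lettersK : cancel letters unlet.
Proof. by move=> f; rewrite -[letters f]cats0 unlet_letters_cat fcatf0. Qed.

Lemma luk_letters_cat f b w : luk (fsize f + b) (letters f ++ w) = luk b w.
Proof.
elim: f b w => [|r IHr|g IHg r IHr] b w //=; first by rewrite addn0 IHr.
rewrite -catA (_ : _ + _ = fsize g + (fsize r + b)); last by lia.
by rewrite IHg IHr.
Qed.

Lemma unletK w a : luk a w -> fsize (unlet w) = a /\ letters (unlet w) = w.
Proof.
elim: w a => [|x w IHw] a /=; first by move/eqP.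
case/andP=> a0 /IHw[sz lw]; case: x sz => [|k] /= sz; first by rewrite sz lw; split=> //; lia.
split; last first.
  by rewrite -letters_fcat fcat_take_drop lw fsize_take // sz leq_addl.
have := congr1 fsize (fcat_take_drop k (unlet w)).
by rewrite fsize_fcat fsize_take sz ?leq_addl //; lia.
Qed.

Lemma luk_letters f : luk (fsize f) (letters f).
Proof. by have := luk_letters_cat f 0 [::]; rewrite addn0 cats0. Qed.

Lemma mate_inj f g : len f = len g -> (forall x, x < len f -> mate f x = mate g x) -> f = g.
Proof.
elim: f g => [|r IHr|f IHf r IHr] [|q|h q] //=; try lia.
- move=> [lE] mE; congr Bud; apply: IHr => // x xr.
  by have := mE x.+1; rewrite ltnS => /(_ xr)[].
- by move=> _ /(_ 0) => /(_ isT).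
- by move=> lE /(_ 0); rewrite addnS => /(_ isT).
- move=> lE mE; have [lfE] := mE 0 ltac:(lia).
  have ff : f = h.
    apply: IHf => // x xf.
    by have := mE x.+1 ltac:(lia); rewrite /= -lfE xf => [[]].
  move: lE mE; rewrite -ff => lE mE.
  congr Arc; apply: IHr; first by lia.
  move=> x xr; have := mE (len f + x).+2 ltac:(lia).
  rewrite ltnNge (leqW (leq_addr _ _)) /=; case: eqP => [|_]; first by lia.
  by rewrite (_ : _ - _ = x); lia.
Qed.

(** The first point is a bud or opens an arc. In the second case noncrossing makes the points under
    the arc and those beyond it stable, and both intervals are forests again; the offset [lo] lets
    the same [t] serve in the recursion. *)
Lemma noncross_forest (t : nat -> nat) lo l :
  (forall x, lo <= x < lo + l -> lo <= t x < lo + l /\ t (t x) = x) ->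
  (forall x y, lo <= x < y -> y < t x -> t x < t y -> t y < lo + l -> False) ->
  exists2 f, len f = l & forall x, x < l -> t (lo + x) = lo + mate f x.
Proof.
elim: {l}_.+1 {-2}l (ltnSn l) lo => // k IHk l ltlk lo tin tnc.
case: l ltlk tin tnc => [|l] ltlk tin tnc; first by exists Empty.
have [tlo ttlo] := tin lo ltac:(lia).
have inj u v : lo <= u < lo + l.+1 -> lo <= v < lo + l.+1 -> t u = t v -> u = v.
  by move=> /tin[_ e1] /tin[_ e2] e; rewrite -e1 -e2 e.
have [tE|tN] := eqVneq (t lo) lo.
  have [||r lr mr] := IHk l ltac:(lia) lo.+1.
  - move=> x xin; have [tx ttx] := tin x ltac:(lia); split=> //.
    suff : t x != lo by move: tx; lia.
    by apply/eqP=> e; move: ttx xin; rewrite e tE; lia.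
  - by move=> x y xy h1 h2 h3; apply: (tnc x y); lia.
  exists (Bud r) => /=; first by rewrite lr.
  case=> [|x] xl; first by rewrite !addn0.
  by have := mr x ltac:(lia); rewrite addSnnS => ->; lia.
pose b := t lo.
have lob : lo < b by move: tlo tN; rewrite -/b; lia.
have tb : t b = lo by [].
have inside x : lo < x < b -> lo < t x < b.
  move=> xin; have [tx ttx] := tin x ltac:(lia).
  have ne1 : t x != lo by apply/eqP=> e; move: ttx xin; rewrite e; lia.
  have ne2 : t x != b by apply/eqP=> e; move: ttx xin; rewrite e tb; lia.
  by case: (ltnP (t x) b) => h; [lia | case: (tnc lo x); lia].
have outside x : b < x < lo + l.+1 -> b < t x < lo + l.+1.
  move=> xin; have [tx ttx] := tin x ltac:(lia).
  have ne1 : t x != lo by apply/eqP=> e; move: ttx xin; rewrite e; lia.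
  have ne2 : t x != b by apply/eqP=> e; move: ttx xin; rewrite e tb; lia.
  case: (ltnP b (t x)) => h; first by lia.
  by have := inside (t x); rewrite ttx; lia.
have [||g lg mg] := IHk (b - lo.+1) ltac:(lia) lo.+1.
- by move=> x xin; have [tx ttx] := tin x ltac:(lia); have := inside x; split=> //; lia.
- by move=> x y xy h1 h2 h3; apply: (tnc x y); lia.
have [||r lr mr] := IHk (lo + l.+1 - b.+1) ltac:(lia) b.+1.
- by move=> x xin; have [tx ttx] := tin x ltac:(lia); have := outside x; split=> //; lia.
- by move=> x y xy h1 h2 h3; apply: (tnc x y); lia.
exists (Arc g r) => /=; first by rewrite lg lr; lia.
case=> [|x] xl; first by rewrite addn0 lg -/b; lia.
case: (ltnP x (len g)) => [xg|gx].
  by have := mg x ltac:(lia); rewrite addSnnS => ->; lia.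
case: eqP => [xE|xN]; first by rewrite xE lg addn0 -tb; congr (t _); lia.
have := mr (x - (len g).+1) ltac:(lia).
by rewrite (_ : b.+1 + _ = lo + x.+1) => [->|]; lia.
Qed.

Lemma count_mate_id f : count (fun x => mate f x == x) (iota 0 (len f)) = buds f.
Proof.
elim: f => //= [r <-|g IHg r IHr].
  by rewrite (iotaDl 1 0) count_map add1n; congr _.+1; apply: eq_count => x /=; rewrite eqSS.
rewrite addnS /= add0n (_ : len g + (len r).+1 = len g + (1 + len r)); last by lia.
rewrite !iotaD !count_cat /= (iotaDl 1 0) count_map.
rewrite (_ : 1 + len g + 1 = (len g).+2 + 0); last by lia.
rewrite iotaDl count_map -IHg -IHr; congr (_ + _).
  apply: eq_in_count => x; rewrite mem_iota /= => xg.
  by rewrite add1n xg eqSS.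
rewrite add1n ltnn eqxx /= add0n; apply: eq_count => x /=.
rewrite ltnNge leqW ?leq_addr //=; case: (_ =P len g) => [|_]; first by lia.
by rewrite (_ : _ - _ = x); lia.
Qed.

(** * Vertices of a forest as the cycles of x |-> mate x + 1 *)

Section CycleBlocks.
Variables (D : finType) (s : {perm D}) (bs : seq (seq D)).
Hypotheses (bs0 : [::] \notin bs) (bsC : all (fcycle s) bs)
           (bsU : uniq (flatten bs)) (bsT : forall x, x \in flatten bs).

Lemma porbit_fcycle b x : fcycle s b -> x \in b -> porbit s x = [set y in b].
Proof.
move=> cb xb; apply/setP=> y; rewrite inE -(fconnect_cycle cb xb).
apply/idP/idP => [/porbitP[i ->]|/iter_findex <-].
  by rewrite permX fconnect_iter.
by rewrite -permX mem_porbit.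
Qed.

Lemma porbits_blocks : porbits s =i [seq [set y in b] | b <- bs].
Proof.
move=> v; apply/imsetP/mapP => [[x _ ->]|[b bbs ->]].
  have /flattenP[b bbs xb] := bsT x.
  by exists b => //; apply: porbit_fcycle => //; apply: (allP bsC).
case: b bbs => [|x b] bbs; first by have := bs0; rewrite bbs.
exists x => //; rewrite (porbit_fcycle _ (mem_head x b)) //.
exact: (allP bsC _ bbs).
Qed.

Lemma uniq_blocks : uniq [seq [set y in b] | b <- bs].
Proof.
move: bs0 bsU; elim: bs => //= b r IHr.
rewrite inE negb_or cat_uniq => /andP[b0 r0] /and3P[ub disj ur].
rewrite IHr // andbT; apply/mapP=> [[b' b'r bE]].
case: b b0 ub disj bE => // x b _ ub /hasPn disj bE.
have /disj : x \in flatten r.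
  apply/flattenP; exists b' => //.
  by have := congr1 (fun A : {set D} => x \in A) bE; rewrite !inE eqxx.
by rewrite /= mem_head.
Qed.

Lemma card_porbits_blocks (P : pred nat) :
  #|[set v in porbits s | P #|v|]| = count (fun b => P (size b)) bs.
Proof.
have -> : #|[set v in porbits s | P #|v|]| =
    #|[seq v : {set D} <- [seq [set y in b] | b <- bs] | P #|v|]|.
  by apply: eq_card => v; rewrite inE mem_filter porbits_blocks andbC.
rewrite (card_uniqP _) ?filter_uniq ?uniq_blocks // size_filter count_map.
apply: eq_in_count => b bbs /=; congr P; rewrite cardsE; apply/card_uniqP.
by move: bsU; elim: bs bbs => //= b' r IHr;
   rewrite inE cat_uniq => /orP[/eqP ->|/IHr H] /and3P[? _ ?] //; apply: H.
Qed.

End CycleBlocks.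

(** Corners by vertex, for a word placed at [o]: [starts] is the root vertex, and a member of
    [blocks] lists the starts of the children of another vertex, then the closing end of its parent
    arc. *)
Fixpoint starts o f : seq nat := match f with
  | Empty => [::] | Bud r => o :: starts o.+1 r
  | Arc g r => o :: starts (o + (len g).+2) r end.
Fixpoint blocks o f : seq (seq nat) := match f with
  | Empty => [::] | Bud r => blocks o.+1 r
  | Arc g r => rcons (starts o.+1 g) (o + (len g).+1) ::
               blocks o.+1 g ++ blocks (o + (len g).+2) r end.

Lemma size_starts o f : size (starts o f) = fsize f.
Proof. by elim: f o => //= [r IHr|g _ r IHr] o; rewrite IHr. Qed.

Lemma starts_cons o f : 0 < len f -> starts o f = o :: behead (starts o f).
Proof. by case: f => //= *; lia. Qed.

Lemma size_blocks o f : [seq size b | b <- blocks o f] = degs f.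
Proof.
elim: f o => //= g IHg r IHr o.
by rewrite size_rcons size_starts map_cat IHg IHr.
Qed.

Lemma blocks_neq0 o f : [::] \notin blocks o f.
Proof.
elim: f o => //= g IHg r IHr o; rewrite inE mem_cat !negb_or IHg IHr !andbT.
by case: (starts _ _).
Qed.

Lemma perm_starts_blocks o f :
  perm_eq (starts o f ++ flatten (blocks o f)) (iota o (len f)).
Proof.
elim: f o => //= [r IHr|g IHg r IHr] o; first by rewrite perm_cons.
rewrite flatten_cat (addnS (len g)) /= perm_cons cat_rcons.
apply: (@perm_trans _ ((starts o.+1 g ++ flatten (blocks o.+1 g)) ++
   (o + (len g).+1) :: (starts (o + (len g).+2) r ++ flatten (blocks (o + (len g).+2) r)))).
  apply/seq.permP=> p; rewrite !count_cat /= !count_cat; lia.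
rewrite (_ : len g + (len r).+1 = len g + (1 + len r)); last by rewrite add1n.
rewrite iotaD; apply: perm_cat; first exact: IHg.
by rewrite addSnnS add1n /= perm_cons -addnS IHr.
Qed.

Section Paths.
Variable e : rel nat.

(** The successor relation stays abstract so that it may be taken modulo the length, where the last
    corner of the root is followed by the first. *)
Definition follows o f := forall x, x < len f -> e (o + x) (o + mate f x).+1.

Lemma follows_Bud o r : follows o (Bud r) -> follows o.+1 r.
Proof. by move=> H x xr; have := H x.+1; rewrite /= !addnS !addSn; apply. Qed.

Lemma follows_Arcl o g r : follows o (Arc g r) -> follows o.+1 g.
Proof.
by move=> H x xg; have := H x.+1; rewrite /= xg !addnS !addSn; apply; lia.
Qed.

Lemma follows_Arcr o g r : follows o (Arc g r) -> follows (o + (len g).+2) r.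
Proof.
move=> H x xr; have := H (len g + x).+2; rewrite /=.
case: (ltnP _.+1 (len g)) => [|_]; first by lia.
case: eqP => [|_]; first by lia.
rewrite (_ : (len g + x).+1 - (len g).+1 = x); last by lia.
rewrite (_ : o + (len g).+2 + x = o + (len g + x).+2); last by lia.
rewrite (_ : o + (len g).+2 + _ = o + (len g + (mate r x).+2)); last by lia.
by apply; lia.
Qed.

Lemma path_starts x0 o f : follows o f -> e x0 o ->
  path e x0 (rcons (starts o f) (o + len f)).
Proof.
elim: f o x0 => [|r IHr|g _ r IHr] o x0 Ef x0E /=; rewrite ?addn0 x0E //=.
- by rewrite addnS -addSn; apply: IHr (follows_Bud Ef) _; have := Ef 0 isT; rewrite addn0.
- rewrite (_ : o + (len g + (len r).+2) = o + (len g).+2 + len r); last by lia.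
  by apply: IHr (follows_Arcr Ef) _; have := Ef 0; rewrite addn0 /= !addnS; apply.
Qed.

Lemma cycle_blocks o f b : follows o f -> b \in blocks o f -> path.cycle e b.
Proof.
elim: f o => //= [r IHr|g IHg r IHr] o Ef; first exact: IHr (follows_Bud Ef).
rewrite inE mem_cat => /or3P[/eqP ->|/IHg|/IHr]; last 2 first.
- by apply; apply: follows_Arcl Ef.
- by apply; apply: follows_Arcr Ef.
have hE : e (o + (len g).+1) o.+1.
  have := Ef (len g).+1; rewrite /= ltnn eqxx addn0; apply; lia.
have := path_starts (follows_Arcl Ef) hE.
by rewrite addSnnS -[path _ _ _]/(path.cycle e (_ :: _)) -rot1_cons rot_cycle.
Qed.

End Paths.

(** * Noncrossing involutions of the corners *)

Section Ordinals.
Variable L : nat.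
Hypothesis L0 : 0 < L.

Definition cyc : {perm 'I_L} := perm (@ordS_inj L).

Lemma val_cyc (x : 'I_L) : cyc x = x.+1 %% L :> nat.
Proof. by rewrite permE. Qed.

(** The default [x] keeps this an involution for a forest of any length, so that [tau] is defined
    without a proof of [len f = L]. *)
Definition mate_ord f (x : 'I_L) : 'I_L := insubd x (mate f x).

Lemma mate_ordK f : involutive (mate_ord f).
Proof.
move=> x; rewrite /mate_ord; case: (ltnP (mate f x) L) => lt; last first.
  by rewrite /insubd [insub (mate f x)]insubF /= ?insubF // ltnNge lt.
have mE : insubd x (mate f x) = mate f x :> nat by rewrite insubdK.
by apply: val_inj; rewrite /= val_insubd mE mateK ltn_ord.
Qed.

Definition tau f : {perm 'I_L} := perm (inv_inj (mate_ordK f)).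

Lemma tauE f x : len f = L -> tau f x = mate f x :> nat.
Proof. by move=> lf; have := mate_lt f x; rewrite lf ltn_ord permE val_insubd => ->. Qed.

Definition ncinv (t : {perm 'I_L}) :=
  [forall x, t (t x) == x] &&
  [forall x : 'I_L, forall y : 'I_L, ~~ [&& x < y, y < t x & t x < t y]].

Lemma ncinvP (t : {perm 'I_L}) : reflect
  ((forall x, t (t x) = x) /\
   (forall x y : 'I_L, x < y -> y < t x -> t x < t y -> False)) (ncinv t).
Proof.
apply: (iffP andP) => [[/forallP tK /forallP nc]|[tK nc]]; split.
- by move=> x; apply/eqP/tK.
- move=> x y h1 h2 h3; have /forallP/(_ y) := nc x.
  by rewrite h1 h2 h3.
- by apply/forallP=> x; rewrite tK.
- by apply/forallP=> x; apply/forallP=> y; apply/and3P=> -[]; apply: nc.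
Qed.

Lemma mate_noncross f x y :
  x < y -> y < mate f x -> mate f x < mate f y -> mate f y < len f -> False.
Proof.
elim: f x y => [|r IHr|g IHg r IHr] [|x] [|y] //=; try lia.
- by rewrite !ltnS; apply: IHr.
- move=> _; case: (ltnP y (len g)) => [yg|yg].
    by have := mate_lt g y; rewrite yg; lia.
  by case: eqP; lia.
- rewrite ltnS; case: (ltnP x (len g)) => xg; case: (ltnP y (len g)) => yg.
  + by rewrite !ltnS => h1 h2 h3 _; apply: (IHg _ _ h1 h2 h3); rewrite mate_lt.
  + by have := mate_lt g x; rewrite xg; lia.
  + by lia.
  + case: eqP => // xn; case: eqP => // yn h1 h2 h3 h4.
    by apply: (IHr (x - (len g).+1) (y - (len g).+1)); lia.
Qed.

Lemma ncinv_tau f : len f = L -> ncinv (tau f).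
Proof.
move=> lf; apply/ncinvP; split=> [x|x y].
  by rewrite !permE mate_ordK.
rewrite !tauE // => h1 h2 h3; apply: (mate_noncross h1 h2 h3).
by rewrite mate_lt lf.
Qed.

Lemma ncinv_forest t : ncinv t -> exists2 f, len f = L & t = tau f.
Proof.
case/ncinvP=> tK nc.
pose T x := if insub x is Some i then val (t i) else x.
have TE (i : 'I_L) : T i = t i by rewrite /T insubT //= => lti; congr (val (t _)); apply: val_inj.
have [||f lf mf] := @noncross_forest T 0 L.
- move=> x xL; pose i := Ordinal xL; rewrite (TE i) (TE (t i)) tK; split=> //; exact: ltn_ord.
- move=> x y /= xy h1 h2 h3.
  have yL : y < L.
    case: (ltnP y L) => // Ly; move: h3; rewrite /T insubF; lia.
  have xL : x < L by lia.
  apply: (nc (Ordinal xL) (Ordinal yL)) => //=.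
    by rewrite -(TE (Ordinal xL)).
  by rewrite -(TE (Ordinal xL)) -(TE (Ordinal yL)).
exists f => //; apply/permP=> i; apply: val_inj.
by rewrite /= tauE //; have := mf i (ltn_ord i); rewrite !add0n TE.
Qed.

Lemma tau_inj f g : len f = L -> len g = L -> tau f = tau g -> f = g.
Proof.
move=> lf lg tE; apply: mate_inj; first by rewrite lf.
move=> x; rewrite lf => xL; rewrite -[x]/(val (Ordinal xL)).
by rewrite -!tauE // tE.
Qed.

Section Blocks.
Variable f : forest.
Hypothesis lf : len f = L.

Let bs := [seq pmap insub b | b <- starts 0 f :: blocks 0 f] : seq (seq 'I_L).

Lemma ord_blocks : [/\ [::] \notin bs, all (fcycle (tau f * cyc)%g) bs,
  uniq (flatten bs), forall x, x \in flatten bs & 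
  [seq size b | b <- bs] = fsize f :: degs f].
Proof.
have perm_all := perm_starts_blocks 0 f; rewrite lf in perm_all.
have inL b x : b \in starts 0 f :: blocks 0 f -> x \in b -> x < L.
  move=> bin xb; have : x \in iota 0 L.
    rewrite -(perm_mem perm_all) -[_ ++ _]/(flatten (_ :: _)).
    by apply/flattenP; exists b.
  by rewrite mem_iota.
have mapb b : b \in starts 0 f :: blocks 0 f -> map val (pmap insub b : seq 'I_L) = b.
  move=> /inL bL; rewrite (pmap_filter (insubK _)).
  by apply/all_filterP/allP => x /bL xL; rewrite isSome_insub.
have valfl : map val (flatten bs) = starts 0 f ++ flatten (blocks 0 f).
  rewrite map_flatten -map_comp -[RHS]/(flatten (_ :: _)); congr flatten.
  rewrite -[RHS]map_id; apply/eq_in_map => b bin; exact: mapb.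
have sizes : [seq size b | b <- bs] = fsize f :: degs f.
  rewrite -map_comp -(size_blocks 0) -(size_starts 0) -[RHS]/(map size (_ :: _)).
  by apply/eq_in_map => b bin /=; rewrite -{2}(mapb b bin) size_map.
split=> //.
- apply/mapP=> [[b bin b0]]; have := mapb b bin; rewrite -b0 /= => bE.
  move: bin; rewrite -bE inE (negbTE (blocks_neq0 0 f)) orbF.
  by have := L0; case: (f) lf => //= <-.
- pose e x y := y %% L == (mate f x).+1 %% L.
  have fo : follows e 0 f by move=> x _; rewrite /e !add0n.
  have cb b : b \in starts 0 f :: blocks 0 f -> path.cycle e b.
    rewrite inE => /orP[/eqP ->|]; last exact: cycle_blocks.
    (* The root cycle closes only modulo [L]: its path enters 0 from the mate of the last point and
       ends in [L], which is 0 again. *)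
    have e0 : e (mate f L.-1) 0 by rewrite /e mateK prednK // mod0n modnn.
    have := path_starts fo e0; rewrite add0n lf.
    rewrite starts_cons ?lf //= !rcons_path => /andP[_] /andP[->] /=.
    by rewrite /e modnn mod0n.
  apply/allP=> _ /mapP[b bin ->].
  have := cb b bin; rewrite -{1}(mapb b bin) cycle_map.
  apply: sub_cycle => x y; rewrite /e /= -tauE // modn_small // => /eqP yE.
  by apply/eqP/val_inj; rewrite /= permM val_cyc -yE.
- by rewrite -(map_inj_uniq val_inj) valfl (perm_uniq perm_all) iota_uniq.
- by move=> x; rewrite -(mem_map val_inj) valfl (perm_mem perm_all) mem_iota /=.
Qed.

Lemma card_cycles_tau k :
  #|[set v in porbits (tau f * cyc)%g | #|v| == k]| = (fsize f == k) + count_mem k (degs f).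
Proof.
have [b0 bC bU bT bS] := ord_blocks.
by rewrite (card_porbits_blocks b0 bC bU bT (pred1 k)) -(count_map size (pred1 k)) bS.
Qed.

Lemma card_porbits_tau : #|porbits (tau f * cyc)%g| = (size (degs f)).+1.
Proof.
have [b0 bC bU bT bS] := ord_blocks.
have := card_porbits_blocks b0 bC bU bT predT.
rewrite -(count_map size predT) bS count_predT /= => <-.
by apply: eq_card => v; rewrite inE andbT.
Qed.

Lemma card_fix_tau : #|[set x | tau f x == x]| = buds f.
Proof.
rewrite -count_mate_id lf -val_enum_ord count_map cardE {1}/enum_mem size_filter -enumT.
by apply: eq_count => x /=; rewrite inE -val_eqE /= tauE.
Qed.
End Blocks.
End Ordinals.

(** * Cycle counts of products with an involution *)

Section InvolutionCycles.
Variable D : finType.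
Implicit Types t c : {perm D}.

Definition moved t := [set x | t x != x].

Lemma moved_tperm t y : (forall x, t (t x) = x) -> t y != y ->
  [/\ (forall x, (t * tperm y (t y))%g ((t * tperm y (t y))%g x) = x),
      moved (t * tperm y (t y))%g = moved t :\: [set y; t y]
    & #|moved t| = #|moved (t * tperm y (t y))%g|.+2].
Proof.
move=> tK ty.
have t'E x : (t * tperm y (t y))%g x = if (x == y) || (x == t y) then x else t x.
  rewrite permM; case: eqP => [->|/eqP xy]; first by rewrite tpermR.
  case: eqP => [->|/eqP xty]; first by rewrite tK tpermL.
  by rewrite tpermD // eq_sym; [apply: contraNneq xty => <-; rewrite tK | rewrite (inj_eq perm_inj)].
have mE : moved (t * tperm y (t y))%g = moved t :\: [set y; t y].
  by apply/setP=> x; rewrite !inE t'E; case: (_ || _); rewrite ?eqxx.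
split=> //.
  move=> x; rewrite !t'E; case: (boolP ((x == y) || (x == t y))) => [->//|H].
  rewrite tK; case: ifP => // /orP[/eqP xy|]; last first.
    by rewrite (inj_eq perm_inj) => xy; rewrite xy in H.
  by rewrite -xy tK eqxx orbT in H.
rewrite mE -(cardsID [set y; t y] (moved t)) (setIidPr _); last first.
  by apply/subsetP=> x; rewrite !inE => /orP[]/eqP ->; rewrite ?tK // eq_sym.
by rewrite cards2 eq_sym ty.
Qed.

(** [t] is a product of half as many transpositions as it moves points, and each of them adds at
    most one cycle. *)
Lemma card_porbits_invol_mul t c : (forall x, t (t x) = x) ->
  (#|porbits (t * c)%g|.*2 <= #|moved t| + #|porbits c|.*2)%N.
Proof.
elim: {t}_.+1 {-2}t c (ltnSn #|moved t|) => // k IHk t c ltk tK.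
have [mt0|[y]] := set_0Vmem (moved t).
  rewrite mt0 cards0 add0n leq_double.
  have -> : t = 1%g; last by rewrite mul1g.
  apply/permP=> x; rewrite perm1; apply/eqP; rewrite -[_ == _]negbK.
  by have := in_set0 x; rewrite -mt0 inE => ->.
rewrite inE => ty; have [t'K _ cardm] := moved_tperm tK ty.
have lt' : (#|moved (t * tperm y (t y))%g| < k)%N by move: cardm ltk; lia.
have := IHk _ (tperm y (t y) * c)%g lt' t'K.
rewrite mulgA -(mulgA t) tperm2 mulg1 cardm.
have := porbits_mul_tperm c y (t y); rewrite /= eq_sym ty.
have arith (p q r u : nat) (b : bool) :
  q + b.*2 = r + true -> p.*2 <= u + q.*2 -> p.*2 <= u.+2 + r.*2 by case: b; lia.
exact: arith.
Qed.
End InvolutionCycles.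

(** * The circle of corners: genus, rotation and centre *)

Section Center.
Variable L : nat.
Hypothesis L0 : 0 < L.
Notation c := (cyc L).
Implicit Types (t : {perm 'I_L}) (x y u v : 'I_L).

Lemma val_cycX k x : (c ^+ k)%g x = (x + k) %% L :> nat.
Proof.
elim: k => [|k IHk]; first by rewrite expg0 perm1 addn0 modn_small.
by rewrite expgSr permM val_cyc IHk -addn1 modnDml addn1 addnS.
Qed.

Lemma cycXL : (c ^+ L = 1)%g.
Proof. by apply/permP=> x; apply: val_inj; rewrite /= val_cycX perm1 modnDr modn_small. Qed.

Lemma porbit_cyc x y : x \in porbit c y.
Proof.
apply/porbitP; exists (x + (L - y)); apply: val_inj.
rewrite /= val_cycX addnCA subnKC; first by rewrite modnDr modn_small.
exact: ltnW.
Qed.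

Lemma card_porbits_cyc : #|porbits c| = 1.
Proof.
apply/eqP/cards1P; exists setT.
apply/setP=> v; rewrite inE; apply/imsetP/eqP => [[x _ ->]|->].
  by apply/setP=> y; rewrite inE porbit_cyc.
by exists (Ordinal L0) => //; apply/setP=> y; rewrite inE porbit_cyc.
Qed.

Lemma val_cycE x : c x = (if x.+1 == L then 0 else x.+1) :> nat.
Proof.
rewrite val_cyc; case: eqP => [->|ne]; first by rewrite modnn.
by rewrite modn_small //; have := ltn_ord x; lia.
Qed.

(** A crossing wastes two transpositions: that of [x] splits [c] into two cycles which separate [y]
    from [t y], and that of [y] merges them again. The remaining transpositions cannot make up for
    it. *)
Lemma genus0_ncinv t : (forall x, t (t x) = x) ->
  (#|porbits (t * c)%g|.*2 = #|moved t| + 2)%N -> ncinv t.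
Proof.
move=> tK gen; apply/ncinvP; split=> // x y xy ytx txty.
have tx : t x != x by rewrite -val_eqE /=; lia.
have ty : t y != y by rewrite -val_eqE /=; lia.
have yx : y != x by rewrite -val_eqE /=; lia.
have ytx' : y != t x by rewrite -val_eqE /=; lia.
have [t1K m1 c1] := moved_tperm tK tx.
set t1 := (t * _)%g in t1K m1 c1.
have t1y : t1 y = t y.
  rewrite permM tpermD // eq_sym; first by apply: contraNneq ytx' => <-; rewrite tK.
  by rewrite (inj_eq perm_inj).
have t1ym : t1 y != y by rewrite t1y.
have [t2K m2 c2] := moved_tperm t1K t1ym.
set t2 := (t1 * _)%g in t2K m2 c2.
have tE : (t * c = t2 * (tperm y (t y) * (tperm x (t x) * c)))%g.
  by rewrite /t2 t1y /t1 !mulgA -(mulgA (t * _)%g) tperm2 mulg1 -(mulgA t) tperm2 mulg1.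
have := card_porbits_invol_mul (tperm y (t y) * (tperm x (t x) * c))%g t2K.
rewrite -tE gen c1 c2.
have := porbits_mul_tperm c x (t x); rewrite porbit_cyc /= addn0 card_porbits_cyc eq_sym tx.
have := porbits_mul_tperm (tperm x (t x) * c)%g y (t y).
suff -> : y \notin porbit (tperm x (t x) * c)%g (t y).
  have arith (p q r : nat) : p + true.*2 = q + true -> q = 1 + true ->
    r.+4 + 2 <= r + p.*2 -> False by lia.
  by rewrite [y == t y]eq_sym ty; apply: arith.
rewrite porbit_sym; apply/negP=> tyin.
have : t y \in [set z : 'I_L | x < z <= t x].
  apply: porbit_closed_sub tyin; last by rewrite inE; lia.
  move=> z; rewrite !inE permM; case: tpermP => [->|->|/eqP zx /eqP ztx].
  - by rewrite ltnn.
  - by move=> _; rewrite val_cycE; have := ltn_ord (t x); case: eqP; lia.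
  - rewrite val_cycE; move: zx ztx; rewrite -!val_eqE /=.
    by have := ltn_ord (t x); case: (_ =P L); lia.
by rewrite inE; lia.
Qed.

(** Only a crossing through the last point, which moves to 0, changes its linear order: a crossing
    of [x] and [y] then comes from one of [y] and [t x]. *)
Lemma ncinv_conj t : ncinv t -> ncinv (t ^ c)%g.
Proof.
case/ncinvP=> tK nc; apply/ncinvP; split=> x.
  by rewrite -[x](permKV c) !permJ tK.
move=> y; rewrite -[x](permKV c) -[y](permKV c) !permJ.
set x' := (_ x); set y' := (_ y); rewrite !val_cycE.
have := nc x' y'; have := nc y' (t x'); rewrite tK.
have := ltn_ord x'; have := ltn_ord y'; have := ltn_ord (t x'); have := ltn_ord (t y').
by repeat case: (_ =P L); lia.
Qed.

Lemma ncinv_conjX t k : ncinv t -> ncinv (t ^ (c ^+ k))%g.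
Proof.
move=> nct; elim: k => [|k IHk]; first by rewrite expg0 conjg1.
by rewrite expgSr conjgM ncinv_conj.
Qed.

Definition dist (u v : nat) := if u <= v then v - u else v + L - u.

Lemma dist_cyc u v : dist (c u) (c v) = dist u v.
Proof.
rewrite /dist !val_cycE; have := ltn_ord u; have := ltn_ord v.
by repeat case: ifP; lia.
Qed.

Definition short t u := (0 < dist u (t u)) && ((dist u (t u)).*2 < L).

(* The corners cut off from the centre by the short side of an arc. *)
Definition cov t x :=
  [exists u, [&& short t u, 0 < dist u x & dist u x <= dist u (t u)]].

Definition diametral t x := (dist x (t x)).*2 == L.
Definition diam t := [exists x, diametral t x].

Lemma cov_conj t x : cov (t ^ c)%g (c x) = cov t x.
Proof.
apply/existsP/existsP => [[u]|[u]].
  rewrite -(permKV c u); set w := (c^-1)%g u; rewrite /short permJ !dist_cyc => H.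
  by exists w.
by move=> H; exists (c u); rewrite /short permJ !dist_cyc.
Qed.

Lemma diametral_conj t x : diametral (t ^ c)%g (c x) = diametral t x.
Proof. by rewrite /diametral permJ dist_cyc. Qed.

Lemma diam_conj t : diam (t ^ c)%g = diam t.
Proof.
apply/existsP/existsP => [[u]|[u] H]; last by exists (c u); rewrite diametral_conj.
by rewrite -(permKV c u) diametral_conj; exists ((c^-1)%g u).
Qed.

Lemma cov_conjX t x k : cov (t ^ (c ^+ k))%g ((c ^+ k)%g x) = cov t x.
Proof.
elim: k => [|k IHk]; first by rewrite expg0 conjg1 perm1.
by rewrite expgSr conjgM permM cov_conj.
Qed.

Lemma diametral_conjX t x k :
  diametral (t ^ (c ^+ k))%g ((c ^+ k)%g x) = diametral t x.
Proof.
elim: k => [|k IHk]; first by rewrite expg0 conjg1 perm1.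
by rewrite expgSr conjgM permM diametral_conj.
Qed.

Lemma dist_cycX u v k : dist ((c ^+ k)%g u) ((c ^+ k)%g v) = dist u v.
Proof.
elim: k => [|k IHk]; first by rewrite expg0 !perm1.
by rewrite expgSr !permM dist_cyc.
Qed.

(** Distances measured from one base point turn cyclic statements into linear arithmetic. *)
Lemma dist_rebase (w u v : 'I_L) : dist u v =
  if dist w u <= dist w v then dist w v - dist w u else dist w v + L - dist w u.
Proof.
rewrite /dist; have := ltn_ord w; have := ltn_ord u; have := ltn_ord v.
case: (leqP w u); case: (leqP w v); case: (leqP u v) => *; case: ifP; lia.
Qed.

Lemma dist_inj (u v w : 'I_L) : dist u v = dist u w -> v = w.
Proof.
move=> e; apply: val_inj; move: e; rewrite /dist /=.
have := ltn_ord w; have := ltn_ord u; have := ltn_ord v.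
by case: (leqP u v); case: (leqP u w) => *; lia.
Qed.

Lemma distxx (u : nat) : dist u u = 0. Proof. by rewrite /dist leqnn subnn. Qed.

Lemma dist_lt u v : dist u v < L.
Proof. by rewrite /dist; have := ltn_ord u; have := ltn_ord v; case: (leqP u v); lia. Qed.

Lemma dist_sym u v : u != v -> dist u v + dist v u = L.
Proof.
rewrite -val_eqE /dist /=; have := ltn_ord u; have := ltn_ord v.
by case: (leqP u v); case: (leqP v u); lia.
Qed.

(** After rotating [u] to 0, distances from [u] are values, and noncrossing is a statement about
    their order. *)
Lemma ncinv_dist t u v : ncinv t ->
  0 < dist u v -> dist u v < dist u (t u) -> 0 < dist u (t v) < dist u (t u).
Proof.
move=> nct; rewrite -(dist_cycX u v (L - u)) -(dist_cycX u (t u) (L - u)).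
rewrite -(dist_cycX u (t v) (L - u)); set k := (c ^+ _)%g.
have /ncinvP[tK nc] := ncinv_conjX (L - u) nct.
rewrite -!(permJ t k).
have -> : nat_of_ord (k u) = 0 by rewrite val_cycX subnKC ?modnn // ltnW.
have k0 : nat_of_ord (k u) = 0 by rewrite val_cycX subnKC ?modnn // ltnW.
have := nc (k u) (k v); rewrite /dist /= !subn0 k0.
move: (t ^ k)%g tK {nc nct} => t' tK.
have ne1 : k v < t' (k u) -> 0 < k v -> t' (k v) <> t' (k u) :> nat.
  by move=> _ + /val_inj/perm_inj e; rewrite e k0.
have ne2 : k v < t' (k u) -> t' (k v) <> 0 :> nat.
  by move=> + e; have /val_inj <- : t' (k v) = k u :> nat; rewrite ?k0 // tK ltnn.
by move=> H v0 vt; have := H v0 vt; move: (ne1 vt v0) (ne2 vt); clear; lia.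
Qed.

(** The corner just after a longest short arc is uncovered: by noncrossing an arc covering it would
    enclose that arc and be longer. *)
Lemma uncovered_exists t : ncinv t -> ~~ diam t -> exists x, ~~ cov t x.
Proof.
move=> nct nd; have /ncinvP[tK _] := nct.
case: (pickP (short t)) => [u0 u0s|none]; last first.
  by exists (Ordinal L0); apply/existsP=> [[u]]; rewrite none.
case: (@arg_maxnP _ u0 (short t) (fun u => dist u (t u)) u0s) => u us umax.
exists (c (t u)); apply/existsP=> [[w /and3P[ws d0 d1]]].
have max := umax w ws.
have dw : dist w (t u) < dist w (t w).
  apply: leq_trans d1; move: d0; rewrite /dist val_cycE.
  have := ltn_ord (t u); have := ltn_ord w; clear.
  case: (_ =P L) => ?; case: (leqP w (t u)) => ?; case: ifP => ?; lia.
have tuu : t u != u by apply: contraTneq us => e; rewrite /short e distxx.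
have := dist_sym tuu; move: us ws max; rewrite /short.
have [z|nz] := posnP (dist w (t u)).
  have -> : w = t u by apply: (@dist_inj w); rewrite z distxx.
  by rewrite tK; clear; lia.
have := ncinv_dist nct nz dw; rewrite tK.
rewrite (dist_rebase w (t u) u) (dist_rebase w u (t u)).
move: dw; clear; move: (dist w u) (dist w (t u)) (dist w (t w)) => p q r.
by case: (leqP p q); case: (leqP q p) => *; lia.
Qed.

(** Two different diameters would cross. *)
Lemma diametral_eq t x y : ncinv t -> diametral t x -> diametral t y ->
  (y == x) || (y == t x).
Proof.
move=> nct /eqP dx /eqP dy; have /ncinvP[tK _] := nct.
have [y0|y1] := posnP (dist x y).
  by rewrite (@dist_inj x y x) ?eqxx // y0 distxx.
have [lt|gt|eq] := ltngtP (dist x y) (dist x (t x)); last first.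
- by rewrite (@dist_inj x y (t x)) ?eqxx ?orbT.
- have dtx : (dist (t x) x).*2 = L.
    have /dist_sym : t x != x by apply/eqP=> e; move: dx L0; rewrite e distxx; clear; lia.
    move: dx; clear; lia.
  have := @ncinv_dist t (t x) y nct; rewrite tK => H; exfalso.
  have := dist_lt x (t y); have := dist_lt x y.
  move: H; rewrite (dist_rebase x (t x) y) (dist_rebase x (t x) (t y)).
  move: dy; rewrite (dist_rebase x y (t y)); move: gt dx dtx L0; clear.
  move: (dist x y) (dist x (t y)) (dist x (t x)) (dist (t x) x) => p q r s.
  by case: (leqP r p); case: (leqP r q); case: (leqP p q) => *; lia.
- have := ncinv_dist nct y1 lt; move: dy; rewrite (dist_rebase x y (t y)).
  move: y1 lt dx (dist_lt x y); clear.
  move: (dist x y) (dist x (t y)) (dist x (t x)) => p q r.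
  by case: (leqP p q) => *; lia.
Qed.

Lemma card_diametral t : ncinv t -> diam t -> #|[set x | diametral t x]| = 2.
Proof.
move=> nct /existsP[x dx]; have /ncinvP[tK _] := nct.
have tx : t x != x.
  by apply: contraTneq dx => tx; rewrite /diametral tx distxx; move: L0; lia.
suff -> : [set y | diametral t y] = [set x; t x] by rewrite cards2 eq_sym tx.
apply/setP=> y; rewrite !inE; apply/idP/idP => [|/orP[]/eqP -> //].
  exact: diametral_eq.
by rewrite /diametral tK; have := dist_sym tx; move: (eqP dx); lia.
Qed.

End Center.

(** * Rotation-invariant noncrossing involutions *)

Definition fpow p f := iter p (fcat f) Empty.

Lemma len_fpow p f : len (fpow p f) = p * len f.
Proof. by elim: p => //= p IHp; rewrite len_fcat IHp mulSn. Qed.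

Lemma fsize_fpow p f : fsize (fpow p f) = p * fsize f.
Proof. by elim: p => //= p IHp; rewrite fsize_fcat IHp mulSn. Qed.

Lemma buds_fpow p f : buds (fpow p f) = p * buds f.
Proof. by elim: p => //= p IHp; rewrite buds_fcat IHp mulSn. Qed.

Lemma count_degs_fpow p f a : count a (degs (fpow p f)) = p * count a (degs f).
Proof. by elim: p => //= p IHp; rewrite degs_fcat count_cat IHp mulSn. Qed.

Lemma mate_fpow p f i x : i < p -> x < len f ->
  mate (fpow p f) (i * len f + x) = i * len f + mate f x.
Proof.
elim: p i => // p IHp [|i] ip xf /=; rewrite mate_fcat.
  by rewrite !mul0n !add0n xf.
rewrite mulSn -!addnA ltnNge leq_addr /= addKn IHp //.
Qed.

Lemma mate_fpowE p f d i x : len f = d -> i < p -> x < d ->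
  mate (fpow p f) (i * d + x) = i * d + mate f x.
Proof. by move=> <-; apply: mate_fpow. Qed.

Lemma fpow_inj p f g : 0 < p -> len f = len g -> fpow p f = fpow p g -> f = g.
Proof.
move=> p0 lfg e; apply: mate_inj => // x xf.
have := @mate_fpow p f 0 x p0 xf; rewrite e.
have := @mate_fpow p g 0 x p0; rewrite -lfg => /(_ xf).
by rewrite mul0n !add0n => ->.
Qed.

(** A prefix stable under [mate] cuts no arc, so it ends between two trees. *)
Lemma forest_split g d : d <= len g -> (forall x, x < d -> mate g x < d) ->
  exists f g', g = fcat f g' /\ len f = d.
Proof.
elim: g d => [|r IHr|h _ r IHr] [|d] //=; try by move=> *; exists Empty; eexists; split.
- rewrite ltnS => dr md; have [||f [g' [-> lf]]] := IHr d => //.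
    by move=> x xd; have := md x.+1; rewrite !ltnS; apply.
  by exists (Bud f), g'; split=> //=; rewrite lf.
- move=> dr md; have := md 0 isT; rewrite ltnS => ld.
  have [||f [g' [-> lf]]] := IHr (d - (len h).+1); first by lia.
    move=> x xd; have := md (len h + x).+2; rewrite /=.
    case: (ltnP _.+1 (len h)) => [|_]; first by lia.
    case: eqP => [|_]; first by lia.
    rewrite (_ : (len h + x).+1 - (len h).+1 = x); last by lia.
    by move=> /(_ ltac:(lia)); lia.
  by exists (Arc h f), g'; split=> //=; rewrite lf; lia.
Qed.

(** The analogue of [cov] on the line. A position stands for the corner before it, whence [u < x]
    strictly but [x <= mate g u]. *)
Definition lcov g x := has (fun u => (u < x) && (x <= mate g u)) (iota 0 (len g)).

Lemma lcovP g x : reflect (exists u, [&& u < x, x <= mate g u & u < len g]) (lcov g x).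
Proof.
apply: (iffP hasP) => [[u]|[u /and3P[h1 h2 h3]]].
  by rewrite mem_iota /= => h3 /andP[h1 h2]; exists u; rewrite h1 h2 h3.
by exists u; rewrite ?mem_iota // h1.
Qed.

(** The uncovered positions are the first positions of the trees, that is, the corners of the root
    vertex. *)
Lemma count_lcov g : count (predC (lcov g)) (iota 0 (len g)) = fsize g.
Proof.
elim: g => [|r IHr|h _ r IHr] //.
  rewrite -[len _]/(len r).+1 /= -[in RHS]IHr (iotaDl 1 0) count_map.
  have -> : lcov (Bud r) 0 = false by apply/lcovP=> -[u]; rewrite ltn0.
  rewrite /= add1n; congr _.+1; apply: eq_count => x /=; congr (~~ _).
  apply/lcovP/lcovP => -[u]; last by exists u.+1; rewrite /= !ltnS.
  by case: u => [|u]; rewrite //= !ltnS; exists u.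
rewrite -[len _]/(len h + (len r).+2) (_ : _ + _ = (len h).+2 + len r); last by lia.
rewrite iotaD count_cat -[fsize _]/(1 + fsize r) -IHr; congr (_ + _).
  rewrite -add1n iotaD count_cat -[RHS]addn0; congr (_ + _).
    by rewrite /= (_ : lcov _ _ = false) //; apply/lcovP=> -[u]; rewrite ltn0.
  transitivity (count pred0 (iota (0 + 1) (len h).+1)); last exact: count_pred0.
  apply: eq_in_count => x.
  by rewrite mem_iota => xin; apply/negbTE; rewrite negbK; apply/lcovP; exists 0; rewrite /=; lia.
rewrite -[0 + (len h).+2]addn0 iotaDl count_map; apply: eq_count => x /=; congr (~~ _).
apply/lcovP/lcovP => -[u].
  case: u => [|u] /=; first by lia.
  case: (ltnP u (len h)) => [uh|hu].
    by have := mate_lt h u; rewrite uh; lia.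
  case: (u =P len h) => [|ne]; first by lia.
  by move=> H; exists (u - (len h).+1); lia.
move=> H; exists (len h + u).+2; rewrite /=.
case: (ltnP _.+1 (len h)) => [|_]; first by lia.
case: (_ =P len h) => [|_]; first by lia.
rewrite (_ : (len h + u).+1 - (len h).+1 = u); lia.
Qed.

Section Invariant.
Variables (L d : nat).
Hypothesis L0 : 0 < L.
Notation c := (cyc L).
Notation x0 := (Ordinal L0).
Implicit Types (t : {perm 'I_L}).

Definition rotinv t := (t ^ (c ^+ d))%g == t.

Lemma rotinvP t : reflect (forall x, t ((c ^+ d)%g x) = (c ^+ d)%g (t x)) (rotinv t).
Proof.
apply: (iffP eqP) => [tE x|H]; first by rewrite -(permJ t) tE.
by apply/permP=> x; rewrite -[x](permKV (c ^+ d)%g) permJ H.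
Qed.

Lemma rotinvX t k : rotinv t -> (t ^ (c ^+ (d * k)))%g = t.
Proof.
move/eqP=> tE; elim: k => [|k IHk]; first by rewrite muln0 expg0 conjg1.
by rewrite mulnS expgD conjgM tE.
Qed.

Lemma ord_cycX (x : 'I_L) : x = (c ^+ x)%g x0.
Proof. by apply: val_inj; rewrite /= val_cycX // add0n modn_small. Qed.

Section Uncovered.
Variable p : nat.
Hypotheses (p1 : 1 < p) (Lpd : L = p * d).

Lemma d_gt0 : 0 < d. Proof. by move: L0; rewrite Lpd; lia. Qed.

(* An arc joining two blocks would cover the beginning of one of them. *)
Lemma uncovered_blocks t x : rotinv t -> ~~ diam t -> ~~ cov t x0 ->
  (forall y, t (t y) = y) -> t x %/ d = x %/ d.
Proof.
move=> tinv nd n0 tK; have d0 := d_gt0.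
have unc k (y : 'I_L) : y = k * d :> nat -> ~~ cov t y.
  move=> yE; rewrite (ord_cycX y) yE -[X in cov X _](rotinvX k tinv).
  by rewrite [d * k]mulnC cov_conjX.
have main (y : 'I_L) : y < t y -> t y %/ d <= y %/ d.
  move=> ylt; rewrite leqNgt; apply/negP=> lt.
  have bL : t y %/ d * d < L.
    by apply: leq_ltn_trans (ltn_ord (t y)); apply: leq_divM.
  pose b := Ordinal bL.
  have yb : y < b.
    by rewrite /= (@leq_trans ((y %/ d).+1 * d)) ?ltn_ceil // leq_mul2r lt orbT.
  have bt : b <= t y by apply: leq_divM.
  have tL := ltn_ord (t y).
  have dyt : dist L y (t y) = t y - y by rewrite /dist ltnW.
  have dty : dist L (t y) y = y + L - t y by rewrite /dist leqNgt ylt.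
  have dyb : dist L y b = b - y by rewrite /dist ltnW.
  have := nd; rewrite negb_exists => /forallP/(_ y); rewrite /diametral dyt => nyd.
  have [ys|ys] := boolP (short t y).
    have := unc (t y %/ d) b erefl; rewrite negb_exists => /forallP/(_ y).
    by rewrite ys dyb dyt; move: yb bt; clear; move: (nat_of_ord b) => b'; lia.
  have tys : short t (t y).
    move: ys nyd; rewrite /short tK dyt dty; move: ylt tL; clear; lia.
  have := n0; rewrite negb_exists => /forallP/(_ (t y)); rewrite tys tK dty /dist /=.
  by rewrite leqn0; move: ylt tL; clear; case: eqP; lia.
have [lt|lt|/val_inj e] := ltngtP x (t x); last by rewrite -e.
  by apply/eqP; rewrite eqn_leq main //= leq_div2r // ltnW.
have := main (t x); rewrite tK => /(_ lt) h.
by apply/eqP; rewrite eqn_leq h andbT leq_div2r // ltnW.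
Qed.

(** The first block is stable under [t], hence a forest; invariance copies it to the other
    blocks. *)
Lemma uncovered_fpow t : ncinv t -> rotinv t -> ~~ diam t -> ~~ cov t x0 ->
  exists2 f, len f = d & t = tau L (fpow p f).
Proof.
move=> nct tinv nd n0; have /ncinvP[tK _] := nct; have d0 := d_gt0.
have blk x := uncovered_blocks x tinv nd n0 tK.
have [g lg tE] := ncinv_forest L0 nct.
have mg (x : 'I_L) : t x = mate g x :> nat by rewrite tE tauE.
have dL : d <= L by rewrite Lpd; move: p1; nia.
have [||f [g' [gE lf]]] := @forest_split g d; rewrite ?lg //.
  move=> x xd; have xL : x < L by apply: leq_trans dL.
  have := blk (Ordinal xL); rewrite mg /= (divn_small xd).
  by move/eqP; rewrite -leqn0 -ltnS ltn_divLR // mul1n.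
exists f => //; rewrite tE; congr (tau _ _).
apply: mate_inj; first by rewrite len_fpow lf lg.
move=> x; rewrite lg => xL.
have xpd : x %/ d < p by rewrite ltn_divLR // -Lpd.
rewrite (divn_eq x d) [RHS](mate_fpowE lf) ?ltn_pmod //.
move: (x %/ d) (x %% d) xpd (ltn_pmod x d0) => i y {x xL} ip yd.
have <- : mate g y = mate f y by rewrite gE mate_fcat lf yd.
elim: i ip => [|i IHi] ip; first by rewrite mul0n.
have e1 : i.+1 * d <= p.-1 * d by rewrite leq_mul2r; lia.
have e2 : p.-1 * d + d = L by rewrite Lpd; move: p1; nia.
have zL : i * d + y < L by move: e1; rewrite mulSn; lia.
pose z := Ordinal zL.
have := rotinvP t tinv z; move/(congr1 val); rewrite /= mg !val_cycX mg /= IHi; last by lia.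
have ztz := blk z; rewrite mg /= IHi in ztz; last by lia.
have my : mate g y < d.
  move: ztz; rewrite !divnMDl // => /addnI; rewrite (divn_small yd).
  by move/eqP; rewrite -leqn0 -ltnS ltn_divLR // mul1n.
rewrite !modn_small; try (move: e1; rewrite mulSn; lia).
by rewrite mulSn; move=> H; rewrite -addnA addnC H; lia.
Qed.

Section Power.
Variable f : forest.
Hypothesis lf : len f = d.
Let g := fpow p f.

Lemma len_g : len g = L. Proof. by rewrite len_fpow lf Lpd. Qed.

Lemma mate_block x : x < L ->
  x %/ d * d <= mate g x < x %/ d * d + d /\ x %/ d * d <= x < x %/ d * d + d.
Proof.
move=> xL; have d0 := d_gt0.
have xpd : x %/ d < p by rewrite ltn_divLR // -Lpd.
have yd := ltn_pmod x d0; have xE := divn_eq x d.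
have -> : mate g x = x %/ d * d + mate f (x %% d) by rewrite {1}xE /g (mate_fpowE lf).
have := mate_lt f (x %% d); rewrite lf yd.
by move: xE yd; clear; move: (x %/ d * d) (x %% d) => i y -> yd yE; lia.
Qed.

Lemma twod : d.*2 <= L. Proof. by rewrite Lpd; move: p1; nia. Qed.

Lemma tau_gE (x : 'I_L) : tau L g x = mate g x :> nat.
Proof. by rewrite tauE // len_g. Qed.

Lemma rotinv_fpow : rotinv (tau L g).
Proof.
apply/rotinvP=> x; apply: val_inj; rewrite /= tau_gE !val_cycX tau_gE.
have d0 := d_gt0; have xpd : x %/ d < p by rewrite ltn_divLR // -Lpd.
have yd := ltn_pmod x d0; rewrite (divn_eq x d).
move: (x %/ d) (x %% d) xpd yd => i y {x} ip yd.
have my : mate f y < d by have := mate_lt f y; rewrite lf yd.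
have e2 : p.-1 * d + d = L by rewrite Lpd; move: p1; nia.
rewrite /g [in RHS](mate_fpowE lf) //.
have [lt|ge] := ltnP i.+1 p.
  have e1 : i.+1 * d <= p.-1 * d by rewrite leq_mul2r; lia.
  have -> : (i * d + y + d) %% L = i.+1 * d + y.
    by rewrite modn_small; move: e1; rewrite mulSn; lia.
  rewrite (mate_fpowE lf) // modn_small; move: e1; rewrite mulSn; lia.
have iE : i * d = p.-1 * d by congr (_ * d); lia.
rewrite iE [p.-1 * d + y + d]addnAC [p.-1 * d + mate f y + d]addnAC e2 !modnDl.
rewrite !modn_small; try (move: twod; lia).
by have := @mate_fpowE p f d 0 y lf; rewrite mul0n !add0n => -> //; lia.
Qed.

(** An arc stays in a block of length [d], at most half of [L], so its short side is the one that it
    spans on the line. *)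
Lemma cov_fpow (x : 'I_L) : cov (tau L g) x = lcov g x.
Proof.
have t2 := twod; have xL := ltn_ord x.
apply/existsP/lcovP => [[u]|[u /and3P[ux xm ul]]].
  have uL := ltn_ord u; have [] := mate_block uL; rewrite /short tau_gE /dist => b1 b2 H.
  have mL : mate g u < L by have := mate_lt g u; rewrite len_g uL.
  exists u; rewrite len_g uL andbT; move: b1 b2 H uL xL t2 mL; clear.
  move: (nat_of_ord x) (nat_of_ord u) (mate g u) (_ %/ d * d) => {}x {}u m b.
  by case: (leqP u m); case: (leqP u x); lia.
rewrite len_g in ul; exists (Ordinal ul); rewrite /short tau_gE /=.
have [b1 b2] := mate_block ul; rewrite /dist; move: b1 b2 ux xm ul xL t2; clear.
move: (_ %/ d * d) (mate g u) (nat_of_ord x) => b m {}x.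
by case: (leqP u m); case: (leqP u x); lia.
Qed.

Lemma card_uncovered_fpow : #|[set x | ~~ cov (tau L g) x]| = p * fsize f.
Proof.
rewrite -fsize_fpow -count_lcov -/g len_g -val_enum_ord count_map.
rewrite cardE {1}/enum_mem size_filter -enumT.
by apply: eq_count => x /=; rewrite inE cov_fpow.
Qed.

Lemma uncovered0_fpow : ~~ cov (tau L g) x0.
Proof. by rewrite cov_fpow; apply/lcovP=> -[u]; rewrite ltn0. Qed.

End Power.
End Uncovered.

Section Diametral.
Hypothesis Ld : L = d.*2.

(** A diameter at 0 makes the forest [Arc f r], and the half-turn exchanges the two sides [f] and
    [r]. *)
Lemma diametral_Arc t : ncinv t -> rotinv t -> diametral t x0 ->
  exists2 f, (len f).+1 = d & t = tau L (Arc f f).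
Proof.
move=> nct tinv dt; have [g lg tE] := ncinv_forest L0 nct.
have mg (x : 'I_L) : t x = mate g x :> nat by rewrite tE tauE.
have g0 : mate g 0 = d.
  by move: dt; rewrite /diametral /dist mg /= subn0 Ld => /eqP/double_inj.
have d0 : 0 < d by move: L0; rewrite Ld; lia.
case: g lg tE mg g0 => [|r|f r] /= lg tE mg g0; [by move: d0; lia | by move: d0; lia |].
exists f => //; rewrite tE; congr (tau _ (Arc _ _)).
have lr : len r = len f by move: lg; rewrite Ld -g0; lia.
apply: mate_inj => // x xr.
have xL : x.+1 < L by lia.
have := rotinvP t tinv (Ordinal xL); move/(congr1 val).
rewrite /= mg !val_cycX mg /=.
have -> : x < len f by rewrite -lr.
have mx : mate f x < len f by rewrite mate_lt -lr.
rewrite -g0 Ld -g0 !modn_small; try lia.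
rewrite (_ : x.+1 + (len f).+1 = (len f + x).+2) /=; last by lia.
case: (ltnP _.+1 (len f)) => [|_]; first by lia.
case: (_ =P len f) => [|_]; first by lia.
by rewrite (_ : (len f + x).+1 - (len f).+1 = x); lia.
Qed.

Lemma len_Arc_diag f : (len f).+1 = d -> len (Arc f f) = L.
Proof. by move=> lf; rewrite /= Ld; lia. Qed.

Lemma rotinv_Arc f : (len f).+1 = d -> rotinv (tau L (Arc f f)).
Proof.
move=> lf; apply/rotinvP=> x; apply: val_inj.
rewrite /= tauE ?len_Arc_diag // !val_cycX tauE ?len_Arc_diag //.
have xL := ltn_ord x; move: (nat_of_ord x) xL => {}x; rewrite Ld -lf => xL.
have mA y : y < (len f).+1 -> mate (Arc f f) y = if y is z.+1 then (mate f z).+1 else (len f).+1.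
  by case: y => //= y; rewrite ltnS => ->.
have mB y : y < (len f).+1 -> mate (Arc f f) (y + (len f).+1) =
    if y is z.+1 then (mate f z).+1 + (len f).+1 else 0.
  case: y => [|y] yl; first by rewrite add0n /= ltnn eqxx.
  rewrite addSn /=; case: (ltnP _ (len f)) => [|_]; first by lia.
  case: (_ =P len f) => [|_]; first by lia.
  by rewrite (_ : y + (len f).+1 - (len f).+1 = y); lia.
have [lt|ge] := ltnP x (len f).+1.
  rewrite (@modn_small (x + _)); last by lia.
  rewrite mB // mA //; case: x lt {xL} => [|x] xl.
    by rewrite addnn modnn.
  have mx : mate f x < len f by rewrite mate_lt.
  by rewrite modn_small //; lia.
have [y yl ->] : exists2 y, y < (len f).+1 & x = y + (len f).+1.
  by exists (x - (len f).+1); lia.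
rewrite -addnA addnn modnDr (@modn_small y); last by lia.
rewrite mB // mA //; case: y yl => [|y] yl.
  by rewrite modn_small //; lia.
have my : mate f y < len f by rewrite mate_lt.
by rewrite -addnA addnn modnDr modn_small //; lia.
Qed.

Lemma diametral0_Arc f : (len f).+1 = d -> diametral (tau L (Arc f f)) x0.
Proof.
by move=> lf; rewrite /diametral /dist tauE ?len_Arc_diag //= subn0 Ld lf.
Qed.

End Diametral.

(** The rotation maps the only diameter to itself; being nontrivial, it exchanges the two ends,
    which are half a turn apart. *)
Lemma diam_half t : ncinv t -> rotinv t -> 0 < d < L -> diam t -> L = d.*2.
Proof.
move=> nct tinv dL /existsP[x dx].
have dy : diametral t ((c ^+ d)%g x).
  by rewrite -{1}(eqP tinv) diametral_conjX.
have := diametral_eq L0 nct dx dy.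
have e : dist L x ((c ^+ d)%g x) = d.
  rewrite /dist val_cycX; have := ltn_ord x => xL.
  have [lt|ge] := ltnP (x + d) L; first by rewrite modn_small //; case: ifP; lia.
  rewrite -(subnK ge) modnDr modn_small; last by lia.
  by case: ifP; lia.
case/orP=> /eqP cx.
  by move: e; rewrite cx /dist leqnn subnn; lia.
by move: dx; rewrite /diametral -cx e => /eqP.
Qed.

End Invariant.

(** * Counting forests with given degrees *)

Definition lukw a (s : seq nat) := [seq w <- permutations s | luk a w].

Lemma mem_lukw a s w : (w \in lukw a s) = luk a w && perm_eq w s.
Proof. by rewrite mem_filter mem_permutations. Qed.

Lemma uniq_lukw a s : uniq (lukw a s).
Proof. by rewrite filter_uniq // permutations_uniq. Qed.

Lemma size_lukw_rec a s : 0 < size s -> 0 < a ->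
  size (lukw a s) = \sum_(x <- undup s) size (lukw (a.-1 + x.-1) (rem x s)).
Proof.
move=> s0 a0.
pose W := flatten [seq [seq x :: w | w <- lukw (a.-1 + x.-1) (rem x s)] | x <- undup s].
have memW w : (w \in W) = (w \in lukw a s).
  apply/flatten_mapP/idP => [[x]|].
    rewrite mem_undup => xs /mapP[v]; rewrite !mem_lukw => /andP[lv pv] ->.
    have p : perm_eq (x :: v) (x :: rem x s) by rewrite perm_cons.
    by rewrite /= a0 lv (perm_trans p) // perm_sym perm_to_rem.
  rewrite mem_lukw; case: w => [|x w] /andP[lw pw].
    by move: s0; rewrite -(perm_size pw).
  have xs : x \in s by rewrite -(perm_mem pw) mem_head.
  exists x; first by rewrite mem_undup.
  rewrite map_f // mem_lukw; move: lw => /= /andP[_ ->] /=.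
  by rewrite -(perm_cons x) (perm_trans pw) // perm_to_rem.
have uW : uniq W.
  apply: allpairs_uniq_dep; first exact: undup_uniq.
    by move=> x _; apply: uniq_lukw.
  by move=> [x v] [y w] _ _ /= [-> ->].
have -> : size (lukw a s) = size W.
  by apply/perm_size/(uniq_perm (uniq_lukw a s) uW) => w; rewrite memW.
by rewrite size_flatten /shape -map_comp sumnE big_map; apply: eq_bigr => x _;
   rewrite /= size_map.
Qed.

Lemma sum_count (r s : seq nat) (F : nat -> nat) : uniq r -> {subset s <= r} ->
  \sum_(x <- r) count_mem x s * F x = \sum_(x <- s) F x.
Proof.
move=> ur; elim: s => [|y s IHs] sr; first by rewrite big_nil big1_seq.
rewrite big_cons -IHs; last by move=> x xs; apply: sr; rewrite inE xs orbT.
have yr : y \in r by apply: sr; rewrite mem_head.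
rewrite (eq_bigr (fun x => (y == x) * F x + count_mem x s * F x)); last first.
  by move=> x _; rewrite /= mulnDl.
rewrite big_split /= (bigD1_seq y) //= eqxx mul1n big1 ?addn0 // => x.
by rewrite eq_sym => /negbTE ->.
Qed.

Lemma prod_count_rem (r s : seq nat) x : uniq r -> x \in s -> {subset s <= r} ->
  \prod_(y <- r) (count_mem y s)`! =
  count_mem x s * \prod_(y <- r) (count_mem y (rem x s))`!.
Proof.
move=> ur xs sr; have xr := sr x xs.
rewrite (bigD1_seq x) //= [in RHS](bigD1_seq x) //= mulnA; congr (_ * _).
  rewrite count_rem xs /= eqxx.
  have : 0 < count_mem x s by rewrite -has_count has_pred1.
  by case: (count_mem x s) => // m _; rewrite subn1 factS.
by apply: eq_bigr => y yx; rewrite count_rem xs /= eq_sym (negbTE yx) subn0.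
Qed.

(* The cycle lemma for words with prescribed letters. *)
Lemma size_lukw (r s : seq nat) a : uniq r -> {subset s <= r} ->
  0 < size s -> a + \sum_(x <- s) x.-1 = size s ->
  size (lukw a s) * \prod_(x <- r) (count_mem x s)`! = a * (size s).-1`!.
Proof.
(* No word is rotated here: the induction removes the first letter. *)
move=> ur; elim: {s}_.+1 {-2}s a (ltnSn (size s)) => // m IHm s a ltsm sr s0 sumE.
case: a sumE => [|a] sumE.
  rewrite mul0n (_ : lukw 0 s = [::]) //; apply/eqP; rewrite -size_eq0 size_filter.
  rewrite -leqn0 leqNgt -has_count; apply/hasPn => w; rewrite mem_permutations => pw.
  by case: w pw => // /perm_size; move: s0 => /[swap] <-.
rewrite size_lukw_rec //=.
have [s1|s1] := leqP (size s) 1.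
  case: s s0 s1 sumE {ltsm} sr => // x [] // _ _; rewrite big_cons big_nil addn0 /=.
  move=> sumE sr; have a0 : a = 0 by lia.
  have x0 : x.-1 = 0 by lia.
  rewrite big_seq1 a0 x0 eqxx /= big1_seq ?muln1 // => y _.
  by rewrite addn0; case: (_ == _).
rewrite big_distrl /=.
rewrite (eq_big_seq (fun x => count_mem x s * ((a + x.-1) * (size s).-2`!))); last first.
  move=> x; rewrite mem_undup => xs.
  rewrite (prod_count_rem ur xs sr) mulnCA; congr (_ * _).
  have szr : size (rem x s) = (size s).-1 by rewrite size_rem.
  rewrite IHm ?szr //; try lia.
  - by move=> y /mem_rem/sr.
  - have e : \sum_(y <- s) y.-1 = x.-1 + \sum_(y <- rem x s) y.-1.
      by rewrite (perm_big _ (perm_to_rem xs)) big_cons.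
    by rewrite -addnA -e -sumE addSn.
rewrite (sum_count _ (undup_uniq s)); last by move=> x; rewrite mem_undup.
rewrite -big_distrl /= big_split /= big_const_seq count_predT iter_addn_0.
have -> : (size s).-1 = (size s).-2.+1 by lia.
rewrite factS mulnA; congr (_ * _).
(* Summed over the [l] letters, the weights give [a * l + (l - a - 1) = (a + 1) * (l - 1)]. *)
move: sumE s1; move: (\sum_(_ <- _) _) (size s) => S l; nia.
Qed.

Lemma luk_size a w : luk a w -> a <= size w.
Proof.
elim: w a => [|x w IHw] a /=; first by move/eqP->.
by case/andP=> a0 /IHw; lia.
Qed.

(** Words of the bud-free forests with [J] arcs and [a] trees. The range of [k] is exhaustive,
    because the remaining letters code at most as many trees as there are letters ([luk_size]). *)
Fixpoint pmw J a : seq (seq nat) := match J, a with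
  | 0, 0 => [:: [::]]
  | J'.+1, a'.+1 =>
      flatten [seq [seq k.+1 :: w | w <- pmw J' (a' + k)] | k <- iota 0 J]
  | _, _ => [::] end.

Lemma mem_pmw J a w :
  (w \in pmw J a) = [&& size w == J, all (leq 1) w & luk a w].
Proof.
elim: J a w => [|J IHJ] [|a] w.
- by case: w => [|x w] //=; rewrite inE.
- by case: w.
- by case: w => [|x w] //=; rewrite !andbF.
apply/flatten_mapP/idP => [[k _ /mapP[v + ->]]|].
  by rewrite IHJ /= eqSS => /and3P[-> -> ->].
case: w => [|[|k] w] /and3P[] //=; rewrite eqSS => /eqP sw aw lw.
exists k; last by rewrite map_f // IHJ sw eqxx aw lw.
by rewrite -[k \in _]/(k \in iota 0 J.+1) mem_iota; have := luk_size lw; rewrite sw; lia.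
Qed.

Lemma uniq_pmw J a : uniq (pmw J a).
Proof.
elim: J a => [|J IHJ] [|a] //.
apply: allpairs_uniq_dep; first exact: iota_uniq.
  by move=> x _; apply: IHJ.
by move=> [x v] [y w] _ _ /= [-> ->].
Qed.

Lemma pmw_nil J a : J < a -> pmw J a = [::].
Proof.
move=> lt; apply/nilP; rewrite /nilp -leqn0 leqNgt -has_predT; apply/hasPn => w.
by rewrite mem_pmw => /and3P[/eqP sw _ /luk_size]; rewrite sw leqNgt lt.
Qed.

(** Both sizes of words with [J.+1] letters are sums over the number of children of the first
    vertex; the one for [a.+2] is the one for [a.+1] without its first term. *)
Lemma size_pmwS J a : size (pmw J.+1 a.+1) = size (pmw J a) + size (pmw J.+1 a.+2).
Proof.
have szE b : size (pmw J.+1 b.+1) = \sum_(0 <= k < J.+1) size (pmw J (b + k)).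
  transitivity (size (flatten [seq [seq k.+1 :: w | w <- pmw J (b + k)] | k <- iota 0 J.+1])) => //.
  rewrite size_flatten /shape -map_comp sumnE big_map /index_iota subn0.
  by apply: eq_bigr => k _; rewrite /= size_map.
rewrite !szE big_nat_recl // addn0; congr (_ + _).
rewrite [RHS]big_nat_recr //= [size (pmw _ (a.+1 + J))](_ : _ = 0); last first.
  by rewrite pmw_nil //; lia.
by rewrite addn0; apply: eq_bigr => k _; rewrite addnS addSn.
Qed.

(** [a] trees with [b] further arcs inside them; [ballot 1 b] is the Catalan number of [b]. *)
Definition ballot a b := size (pmw (a + b) a).

Lemma ballot0 a : ballot a 0 = 1.
Proof.
rewrite /ballot addn0; elim: a => // a IHa.
by rewrite size_pmwS IHa pmw_nil.
Qed.

Lemma ballotS a b : ballot a.+1 b.+1 = ballot a b.+1 + ballot a.+2 b.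
Proof. by rewrite /ballot addSn size_pmwS !addSn addnS. Qed.

(** The difference of two binomials of the reflection principle, written without subtraction. *)
Lemma ballot_bin a b : ballot a b.+1 + 'C(a + b.*2.+1, b) = 'C(a + b.*2.+1, b.+1).
Proof.
elim: b a => [|b IHb] a; elim: a => [|a IHa].
- by [].
- by move: IHa; rewrite ballotS ballot0 !bin0 !bin1 /=; lia.
- rewrite add0n -[RHS]bin_sub; last by lia.
  have -> : ballot 0 b.+2 = 0 by [].
  by rewrite (_ : _ - _ = b.+1); lia.
rewrite ballotS; have := IHb a.+2.
rewrite doubleS !addSn !addnS in IHa *; rewrite !binS.
rewrite !binS in IHa.
lia.
Qed.

Lemma ballot_mul a b : 0 < a + b -> (a + b) * ballot a b = a * 'C((a + b.*2).-1, b).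
Proof.
case: b => [|b] ab0; first by rewrite ballot0 bin0 addn0.
have := ballot_bin a b; rewrite doubleS !addnS /=.
have := mul_bin_left (a + b.*2).+1 b.
rewrite (_ : _ - b = a + b.+1); last by lia.
nia.
Qed.

(** Pairs of an element of [Y] and a marked corner are counted in two ways; conjugation by [cyc L]
    moves the mark, so each corner is marked equally often. *)
Lemma double_count L (L0 : 0 < L) (Y : {set {perm 'I_L}})
    (M : {perm 'I_L} -> 'I_L -> bool) U :
  (forall t, ((t ^ cyc L)%g \in Y) = (t \in Y)) ->
  (forall t x, M (t ^ cyc L)%g (cyc L x) = M t x) ->
  (forall t, t \in Y -> #|[set x | M t x]| = U) ->
  #|Y| * U = L * #|[set t in Y | M t (Ordinal L0)]|.
Proof.
move=> YJ MJ MU.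
have f0 x : #|[set t in Y | M t x]| = #|[set t in Y | M t (Ordinal L0)]|.
  rewrite (ord_cycX L0 x); elim: (nat_of_ord x) => [|k <-]; first by rewrite expg0 perm1.
  rewrite expgSr permM -[RHS](card_imset _ (@conjg_inj _ (cyc L))).
  apply: eq_card => t; rewrite inE -{1 2}[t](conjgKV (cyc L)) YJ MJ.
  apply/idP/imsetP => [H|[u + ->]]; last by rewrite inE conjgK.
  by exists (t ^ (cyc L)^-1)%g; rewrite ?inE // conjgKV.
transitivity (\sum_(t in Y) \sum_(x : 'I_L) (M t x : nat)).
  rewrite -sum_nat_const; apply: eq_bigr => t tY.
  by rewrite -(MU t tY) -sum1dep_card big_mkcond; apply: eq_bigr => x _; case: (M t x).
rewrite exchange_big /= -[X in _ = X * _](card_ord L) -sum_nat_const.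
apply: eq_bigr => x _; rewrite -(f0 x) -sum1dep_card big_mkcondr /=.
by apply: eq_bigr => t _; case: (M t x).
Qed.

(** Forests are enumerated through their words, which can be listed without repetition. *)
Lemma card_forest_set L (S : {set {perm 'I_L}}) (E : forest -> {perm 'I_L}) W :
  uniq W -> (forall w, w \in W -> letters (unlet w) = w) ->
  (forall f, letters f \in W -> E f \in S) ->
  (forall t, t \in S -> exists2 f, letters f \in W & t = E f) ->
  (forall f g, letters f \in W -> letters g \in W -> E f = E g -> f = g) ->
  #|S| = size W.
Proof.
move=> uW lW ES SE inj.
have uM : uniq [seq E (unlet w) | w <- W].
  rewrite map_inj_in_uniq // => v w vW wW e.
  by rewrite -(lW v vW) -(lW w wW); congr letters; apply: inj; rewrite ?lW.
rewrite -(size_map (fun w => E (unlet w)) W) -(card_uniqP uM).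
apply: eq_card => t; apply/idP/mapP => [/SE[f fW ->]|[w wW ->]].
  by exists (letters f); rewrite ?lettersK.
by apply: ES; rewrite lW.
Qed.

Definition content K b (m : nat -> nat) :=
  nseq b 0 ++ flatten [seq nseq (m k) k | k <- iota 1 K].

Section Content.
Variables (K b : nat) (m : nat -> nat).
Hypothesis mK : forall k, K < k -> m k = 0.

Lemma count_content k : count_mem k (content K b m) = if k == 0 then b else m k.
Proof.
rewrite count_cat count_nseq /= eq_sym count_flatten -map_comp sumnE big_map.
case: eqP => [->|k0].
  rewrite mul1n big1_seq ?addn0 // => i /=; rewrite mem_iota => ip.
  by rewrite count_nseq /= (_ : i == 0 = false) //; apply/eqP; lia.
rewrite mul0n add0n; case: (leqP k K) => kK; last first.
  rewrite mK // big1_seq // => i /=; rewrite mem_iota => ip.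
  by rewrite count_nseq /= (_ : i == k = false) //; apply/eqP; lia.
rewrite (bigD1_seq k) ?iota_uniq //=; last by rewrite mem_iota; lia.
rewrite count_nseq /= eqxx mul1n big1 ?addn0 // => i /negbTE ik.
by rewrite count_nseq /= ik.
Qed.

Lemma sum_content (F : nat -> nat) :
  \sum_(x <- content K b m) F x = b * F 0 + \sum_(1 <= k < K.+1) m k * F k.
Proof.
rewrite big_cat big_nseq iter_addn_0 mulnC; congr (_ + _).
rewrite /= big_flatten big_map /index_iota subSS subn0; apply: eq_bigr => k _.
by rewrite big_nseq iter_addn_0 mulnC.
Qed.

Lemma size_content : size (content K b m) = b + \sum_(1 <= k < K.+1) m k.
Proof.
rewrite -sum1_size sum_content muln1; congr (_ + _).
by apply: eq_bigr => k _; rewrite muln1.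
Qed.

Lemma perm_content w : perm_eq w (content K b m) <->
  count_mem 0 w = b /\ forall k, 0 < k -> count_mem k w = m k.
Proof.
split=> [/seq.permP pw|[w0 wk]].
  by split=> [|k k0]; rewrite pw count_content ?eqxx //; case: k k0.
apply/allP => x _ /=; rewrite count_content; apply/eqP.
by case: x => //= x; rewrite wk.
Qed.

Lemma mem_content f a : letters f \in lukw a (content K b m) <->
  [/\ fsize f = a, buds f = b & forall k, 0 < k -> count_mem k (degs f) = m k].
Proof.
rewrite mem_lukw; split=> [/andP[lf /perm_content[c0 ck]]|[sz bf df]].
  have [] := unletK lf; rewrite lettersK => -> _; split=> //.
    by rewrite -count_letters0.
  by move=> k k0; rewrite -count_letters // ck.
rewrite -sz luk_letters; apply/perm_content; rewrite count_letters0; split=> // k k0.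
by rewrite count_letters // df.
Qed.

Lemma lukw_letters a w : w \in lukw a (content K b m) -> letters (unlet w) = w.
Proof. by rewrite mem_lukw => /andP[/unletK[]]. Qed.

Lemma size_lukw_content a :
  0 < b + \sum_(1 <= k < K.+1) m k ->
  a + \sum_(1 <= k < K.+1) m k * k.-1 = b + \sum_(1 <= k < K.+1) m k ->
  size (lukw a (content K b m)) * (b`! * \prod_(1 <= k < K.+1) (m k)`!) =
  a * (b + \sum_(1 <= k < K.+1) m k).-1`!.
Proof.
move=> s0 e; rewrite -size_content.
rewrite -(@size_lukw (0 :: iota 1 K)) ?size_content //.
- congr (_ * _); rewrite big_cons count_content eqxx; congr (_ * _).
  rewrite /index_iota subSS subn0; apply: eq_big_seq => k; rewrite mem_iota => kK.
  by rewrite count_content; case: eqP => // k0; move: kK; rewrite k0.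
- by rewrite /= iota_uniq mem_iota.
- move=> x; rewrite mem_cat mem_nseq inE mem_iota => /orP[/andP[_ ->] //|].
  move=> /flattenP[_ /mapP[k + ->]]; rewrite mem_iota mem_nseq => kK /andP[_ /eqP ->].
  by rewrite kK orbT.
- by rewrite sum_content muln0 add0n.
Qed.

End Content.

Lemma size_degs_sum K (m : nat -> nat) f : (forall k, K < k -> m k = 0) ->
  (forall k, 0 < k -> count_mem k (degs f) = m k) ->
  size (degs f) = \sum_(1 <= k < K.+1) m k.
Proof.
move=> mK df; have : perm_eq (letters f) (content K (buds f) m).
  by apply/perm_content=> //; rewrite count_letters0; split=> // k k0; rewrite count_letters // df.
by move/perm_size; rewrite size_letters size_content => /addnI.
Qed.

(** Here double counting (first equation) meets the cycle lemma (second one): the number [a] of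
    trees in a block cancels. *)
Lemma cancel_orbits p d a X V A B : 0 < p * a ->
  X * (p * a) = p * d * V -> V * A = a * B -> X * A = d * B.
Proof.
move=> pa0 e1 e2; apply/eqP; rewrite -(eqn_pmul2r pa0) mulnAC e1 -!mulnA e2.
by apply/eqP; ring.
Qed.

(** * Invariant noncrossing involutions with prescribed vertex degrees *)

Section Typed.
Variables (L K b : nat) (nn : nat -> nat).
Hypothesis L0 : 0 < L.
Hypothesis nnK : forall k, K < k -> nn k = 0.
Notation c := (cyc L).

Definition has_profile (t : {perm 'I_L}) : bool :=
  `[< #|[set x | t x == x]| = b /\
      forall k, 0 < k -> #|[set v in porbits (t * c)%g | #|v| == k]| = nn k >].

Lemma has_profile_tau g : len g = L -> has_profile (tau L g) <->
  buds g = b /\ forall k, 0 < k -> (fsize g == k) + count_mem k (degs g) = nn k.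
Proof.
move=> lg; split=> [/asboolP[]|[h1 h2]]; last apply/asboolP.
  rewrite card_fix_tau // => h1 h2; split=> // k k0.
  by rewrite -h2 // card_cycles_tau.
rewrite card_fix_tau //; split=> // k k0.
by rewrite card_cycles_tau // h2.
Qed.

Lemma card_fix_conj (t s : {perm 'I_L}) :
  #|[set x | (t ^ s)%g x == x]| = #|[set x | t x == x]|.
Proof.
rewrite -[RHS](card_imset _ (@perm_inj _ s)); apply: eq_card => x; rewrite !inE.
rewrite -[x](permKV s) permJ (inj_eq perm_inj) (mem_imset _ _ (@perm_inj _ s)).
by rewrite inE.
Qed.

Lemma porbit_conj (D : finType) (t s : {perm D}) x :
  porbit (t ^ s)%g (s x) = s @: porbit t x.
Proof.
apply/setP=> y; apply/porbitP/imsetP => [[i ->]|[z /porbitP[i ->] ->]].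
  by exists ((t ^+ i)%g x); rewrite ?mem_porbit // -conjXg permJ.
by exists i; rewrite -conjXg permJ.
Qed.

Lemma card_porbits_conj (D : finType) (t s : {perm D}) (P : pred nat) :
  #|[set v in porbits (t ^ s)%g | P #|v|]| = #|[set v in porbits t | P #|v|]|.
Proof.
have inj : injective (fun v : {set D} => s @: v) by apply/imset_inj/perm_inj.
rewrite -[RHS](card_imset _ inj); apply: eq_card => v; rewrite inE.
apply/andP/imsetP => [[/imsetP[x _ ->]]|[u + ->]].
  rewrite -{1 2}[x](permKV s) porbit_conj card_imset; last exact: perm_inj.
  move=> Pv; exists (porbit t ((s^-1)%g x)); first by rewrite inE Pv imset_f.
  by rewrite -porbit_conj permKV.
rewrite inE card_imset; last exact: perm_inj.
case/andP=> /imsetP[x _ ->] Pu; split=> //.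
by rewrite -porbit_conj imset_f.
Qed.

Lemma has_profile_conj t : has_profile (t ^ c)%g = has_profile t.
Proof.
apply: asbool_equiv_eq; rewrite card_fix_conj.
have e k : #|[set v in porbits ((t ^ c) * c)%g | #|v| == k]| =
           #|[set v in porbits (t * c)%g | #|v| == k]|.
  have -> : ((t ^ c) * c = (t * c) ^ c)%g by rewrite conjMg; congr (_ * _)%g; rewrite /conjg mulKg.
  exact: (card_porbits_conj _ _ (pred1 k)).
by split=> -[h1 h2]; split=> // k k0; [rewrite -e h2 | rewrite e h2].
Qed.

Lemma ncinv_conjE t : ncinv (t ^ c)%g = ncinv t.
Proof.
apply/idP/idP => [H|]; last exact: ncinv_conj.
have := ncinv_conjX L0 L.-1 H.
by rewrite -conjgM -expgS prednK // cycXL conjg1.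
Qed.

Lemma rotinv_conj d t : rotinv d (t ^ c)%g = rotinv d t.
Proof.
rewrite /rotinv -conjgM -expgS expgSr conjgM.
exact: (inj_eq (@conjg_inj _ c)).
Qed.

Definition profile_set d := [set t | [&& ncinv t, rotinv d t & has_profile t]].

Lemma profile_set_conj d t : ((t ^ c)%g \in profile_set d) = (t \in profile_set d).
Proof. by rewrite !inE ncinv_conjE rotinv_conj has_profile_conj. Qed.

Lemma profile_set_conjX d t k :
  ((t ^ (c ^+ k))%g \in profile_set d) = (t \in profile_set d).
Proof.
elim: k => [|k IHk]; first by rewrite expg0 conjg1.
by rewrite expgSr conjgM profile_set_conj.
Qed.

Lemma to0 (x : 'I_L) : (c ^+ (L - x))%g x = Ordinal L0.
Proof. by apply: val_inj; rewrite /= val_cycX subnKC ?modnn // ltnW. Qed.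

Lemma profile_setP d t : reflect (exists f, [/\ len f = L, t = tau L f, rotinv d t &
    buds f = b /\ forall k, 0 < k -> (fsize f == k) + count_mem k (degs f) = nn k])
  (t \in profile_set d).
Proof.
rewrite inE; apply: (iffP and3P) => [[nct tinv pt]|[f [lf tE tinv pf]]].
  have [f lf tE] := ncinv_forest L0 nct; exists f; split=> //.
  by apply/has_profile_tau; rewrite -?tE.
by split=> //; rewrite tE; [apply: ncinv_tau | apply/has_profile_tau].
Qed.

Hypothesis sumL : \sum_(1 <= k < K.+1) nn k * k = L.
(** A tree has one edge less than vertices, and [L - b] of the corners start with a half-edge of the
    tree. *)
Hypothesis sumV : L + 2 = b + (\sum_(1 <= k < K.+1) nn k).*2.

(** The degrees that remain when one vertex of degree [a], the root vertex, is set apart. *)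
Definition minus_one a k := nn k - (k == a).

Lemma sum_minus_one a F : 0 < a -> 0 < nn a ->
  F a + \sum_(1 <= k < K.+1) minus_one a k * F k = \sum_(1 <= k < K.+1) nn k * F k.
Proof.
move=> a0 na; have aK : a <= K by rewrite leqNgt; apply/negP=> /nnK e; rewrite e in na.
have aI : a \in index_iota 1 K.+1 by rewrite mem_index_iota a0 ltnS.
rewrite !(bigD1_seq a) ?iota_uniq //= addnA; congr (_ + _).
  by rewrite /minus_one eqxx -[X in X + _]mul1n -mulnDl; congr (_ * _); lia.
by apply: eq_bigr => k /negbTE ka; rewrite /minus_one ka subn0.
Qed.

Lemma prod_minus_one a : 0 < a -> 0 < nn a ->
  nn a * \prod_(1 <= k < K.+1) (minus_one a k)`! = \prod_(1 <= k < K.+1) (nn k)`!.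
Proof.
move=> a0 na; have aK : a <= K by rewrite leqNgt; apply/negP=> /nnK e; rewrite e in na.
have aI : a \in index_iota 1 K.+1 by rewrite mem_index_iota a0 ltnS.
rewrite !(bigD1_seq a) ?iota_uniq //= mulnA; congr (_ * _).
  by rewrite /minus_one eqxx subn1; case: (nn a) na => // n _; rewrite factS.
by apply: eq_bigr => k /negbTE ka; rewrite /minus_one ka subn0.
Qed.

Lemma minus_oneK a k : K < k -> minus_one a k = 0.
Proof. by rewrite /minus_one => /nnK ->. Qed.

(** Split by the degree [a] of the vertex at corner 0: the cycle lemma contributes [a], restoring
    the factorials contributes [nn a], and the products [nn a * a] sum to [L]. *)
Lemma card_profile_set1 :
  #|profile_set L| * (b`! * \prod_(1 <= k < K.+1) (nn k)`!) =
  L * (b + \sum_(1 <= k < K.+1) nn k - 2)`!.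
Proof.
pose V := \sum_(1 <= k < K.+1) nn k.
pose W := [seq w | a <- [seq a <- iota 1 K | 0 < nn a], w <- lukw a (content K b (minus_one a))].
have sum1 a : 0 < a -> 0 < nn a -> 1 + \sum_(1 <= k < K.+1) minus_one a k = V.
  move=> a0 na; have := @sum_minus_one a (fun=> 1) a0 na.
  rewrite [X in X -> _](_ : _ = (1 + \sum_(1 <= k < K.+1) minus_one a k = V)) //.
  by congr (1 + _ = _); apply: eq_bigr => k _; rewrite muln1.
have memW f : letters f \in W <-> exists a, [/\ 0 < a, 0 < nn a, fsize f = a, buds f = b &
    forall k, 0 < k -> count_mem k (degs f) = minus_one a k].
  split=> [/allpairsPdep[a [w [+ + wE]]]|[a [a0 na sz bf df]]].
    rewrite mem_filter mem_iota -wE => /andP[na /andP[a0 _]].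
    by move=> /(mem_content b (@minus_oneK a))[]; exists a.
  apply/allpairsPdep; exists a, (letters f); split=> //.
    rewrite mem_filter na mem_iota a0 /= add1n ltnS leqNgt.
    by apply/negP=> /nnK e; rewrite e in na.
  exact/(mem_content b (@minus_oneK a)).
have -> : #|profile_set L| = size W.
  have lenW f : letters f \in W -> len f = L.
    case/memW=> a [a0 na sz bf df]; rewrite len_letters bf.
    rewrite (size_degs_sum (@minus_oneK a) df); have := sum1 a a0 na.
    by move: sumV; rewrite -/V; lia.
  apply: (@card_forest_set _ _ (tau L)).
  - apply: allpairs_uniq_dep; first by rewrite filter_uniq // iota_uniq.
      by move=> a _; apply: uniq_lukw.
    move=> [a v] [a' v'] /allpairsPdep[x [w [_ + e]]] /allpairsPdep[x' [w' [_ + e']]] /= vE.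
    move: e e' vE => [-> ->] [-> ->] ->; rewrite !mem_lukw => /andP[lw _] /andP[lw' _].
    by have [<- _] := unletK lw; have [<- _] := unletK lw'.
  - by move=> w /allpairsPdep[a [w' [_ /lukw_letters e ->]]].
  - move=> f fW; apply/profile_setP; exists f; split=> //; first exact: lenW.
      by rewrite /rotinv cycXL conjg1.
    case/memW: fW => a [a0 na -> -> df]; split=> // k k0; rewrite df // /minus_one eq_sym.
    by case: eqP => [->|_]; rewrite ?subn0 // subnKC.
  - move=> t /profile_setP[f [lf -> _ [bf df]]]; exists f => //; apply/memW.
    have f0 : 0 < fsize f by move: L0; rewrite -lf; case: (f).
    exists (fsize f); split=> //; first by rewrite -df // eqxx.
    by move=> k k0; rewrite /minus_one -df // eq_sym addKn.
  - by move=> f g /lenW lf /lenW lg; apply: tau_inj.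
have iI : iota 1 K = index_iota 1 K.+1 by rewrite /index_iota subSS subn0.
rewrite size_allpairs_dep sumnE big_map big_filter iI big_distrl /=.
rewrite -[in RHS]sumL big_distrl /=.
rewrite big_mkcond; apply: eq_big_seq => a; rewrite mem_index_iota => /andP[a0 _].
case: posnP => na; first by rewrite na !mul0n.
rewrite -(prod_minus_one a0 na) (mulnCA b`!) mulnCA -mulnA; congr (_ * _).
have s1 := sum1 a a0 na; have k1 := @sum_minus_one a id a0 na.
have km : \sum_(1 <= k < K.+1) minus_one a k * k =
   \sum_(1 <= k < K.+1) minus_one a k * k.-1 + \sum_(1 <= k < K.+1) minus_one a k.
  rewrite -big_split; apply: eq_big_nat => k /andP[k0 _] /=.
  by rewrite addnC -mulnS prednK.
rewrite sumL in k1; rewrite size_lukw_content //; try exact: minus_oneK.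
- by congr (_ * _`!); move: s1; rewrite -/V; lia.
- by move: sumV L0; rewrite -/V -s1; lia.
- by move: sumV; rewrite -/V; lia.
Qed.

Section Quotient.
Variable d : nat.

Lemma card_uncovered_conjX t k :
  #|[set x | ~~ cov (t ^ (c ^+ k))%g x]| = #|[set x : 'I_L | ~~ cov t x]|.
Proof.
rewrite -[RHS](card_imset _ (@perm_inj _ (c ^+ k)%g)); apply: eq_card => x.
by rewrite !inE -[x](permKV (c ^+ k)%g) cov_conjX // (mem_imset _ _ (@perm_inj _ _)) inE.
Qed.

(** Rotate an uncovered corner to 0: the involution becomes a power of a block [f]. Its vertices
    then come in groups of [p], except the one at the centre, of degree [p * fsize f]. *)
Lemma uncovered_profile p t : 1 < p -> L = p * d -> t \in profile_set d -> ~~ diam t ->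
  exists f, [/\ len f = d, 0 < fsize f, #|[set x | ~~ cov t x]| = p * fsize f,
    b = p * buds f
    & forall k, 0 < k -> nn k = (p * fsize f == k) + p * count_mem k (degs f)].
Proof.
move=> p1 Lpd tP nd.
have /and3P[nct _ _] : [&& ncinv t, rotinv d t & has_profile t] by rewrite inE in tP.
have [x nx] := uncovered_exists L0 nct nd.
pose t' := (t ^ (c ^+ (L - x)))%g.
have t'P : t' \in profile_set d by rewrite profile_set_conjX.
have n0 : ~~ cov t' (Ordinal L0) by rewrite -(to0 x) cov_conjX.
have nd' : ~~ diam t'.
  rewrite /t'; elim: (L - x) => [|k IHk]; first by rewrite expg0 conjg1.
  by rewrite expgSr conjgM diam_conj.
have /and3P[nct' tinv' pt'] : [&& ncinv t', rotinv d t' & has_profile t'] by rewrite inE in t'P.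
have [f lf t'E] := uncovered_fpow p1 Lpd nct' tinv' nd' n0.
have := pt'; rewrite t'E => /has_profile_tau; rewrite len_fpow lf -Lpd => /(_ erefl)[bE nnE].
exists f; split=> //.
- by move: L0; rewrite Lpd -lf; case: (f) => //=; lia.
- by rewrite -(card_uncovered_conjX t (L - x)) -/t' t'E (card_uncovered_fpow L0 p1 Lpd lf).
- by rewrite -bE buds_fpow.
- by move=> k k0; rewrite -nnE // fsize_fpow count_degs_fpow.
Qed.

(** The centre is now the middle of an edge, so all vertices come in pairs; the ends of this edge
    have degree [(fsize f).+1]. *)
Lemma diametral_profile t : 0 < d < L -> t \in profile_set d -> diam t ->
  L = d.*2 /\ exists f, [/\ (len f).+1 = d, b = (buds f).*2
    & forall k, 0 < k -> nn k = (((fsize f).+1 == k) + count_mem k (degs f)).*2].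
Proof.
move=> dL tP dt.
have /and3P[nct tinv _] : [&& ncinv t, rotinv d t & has_profile t] by rewrite inE in tP.
have Ld := diam_half L0 nct tinv dL dt; split=> //.
have /existsP[x dx] := dt.
pose t' := (t ^ (c ^+ (L - x)))%g.
have t'P : t' \in profile_set d by rewrite profile_set_conjX.
have d0 : diametral t' (Ordinal L0) by rewrite -(to0 x) diametral_conjX.
have /and3P[nct' tinv' pt'] : [&& ncinv t', rotinv d t' & has_profile t'] by rewrite inE in t'P.
have [f lf t'E] := diametral_Arc Ld nct' tinv' d0.
have := pt'; rewrite t'E => /has_profile_tau; rewrite (len_Arc_diag L0 Ld) // => /(_ erefl)[bE nnE].
exists f; split=> //; first by rewrite -bE /= addnn.
by move=> k k0; rewrite -nnE //= count_cat; lia.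
Qed.

(** The marks are the uncovered corners, always [p * a] of them; with a mark at 0 the involution is
    the power of a forest with [a] trees and profile [m], [b']. *)
Lemma card_profile_uncovered p a b' (m : nat -> nat) : 1 < p -> L = p * d -> 0 < a ->
  (forall k, K < k -> m k = 0) -> b = p * b' ->
  (forall k, 0 < k -> nn k = (p * a == k) + p * m k) ->
  #|profile_set d| * (b'`! * \prod_(1 <= k < K.+1) (m k)`!) =
  d * (b' + \sum_(1 <= k < K.+1) m k).-1`!.
Proof.
move=> p1 Lpd a0 mK bE nnE.
have pa0 : 0 < p * a by lia.
have dL : 0 < d < L by move: L0 p1; rewrite Lpd; nia.
have nnpa : 0 < nn (p * a) by rewrite nnE // eqxx.
have paK : p * a <= K by rewrite leqNgt; apply/negP=> /nnK e; rewrite e in nnpa.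
have split_sum F : \sum_(1 <= k < K.+1) nn k * F k =
    F (p * a) + p * \sum_(1 <= k < K.+1) m k * F k.
  rewrite big_distrr /= (eq_big_nat _ _ (F2 := fun k => (p * a == k) * F k + p * (m k * F k))).
    rewrite big_split /= (bigD1_seq (p * a)) ?iota_uniq ?mem_index_iota ?pa0 //=.
    rewrite eqxx mul1n big1 ?addn0 // => k /negbTE ka.
    by rewrite eq_sym ka.
  by move=> k /andP[k0 _]; rewrite nnE // mulnDl mulnA.
have sum1 : \sum_(1 <= k < K.+1) nn k = 1 + p * \sum_(1 <= k < K.+1) m k.
  have := split_sum (fun=> 1).
  rewrite (eq_bigr nn) => [->|k _]; last by rewrite muln1.
  by congr (1 + p * _); apply: eq_bigr => k _; rewrite muln1.
have dE : d = b' + (\sum_(1 <= k < K.+1) m k).*2.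
  move: sumV; rewrite sum1 Lpd bE => e.
  by apply/eqP; rewrite -(eqn_pmul2l (ltnW p1)) mulnDr -doubleMr; lia.
have sumE : a + \sum_(1 <= k < K.+1) m k * k.-1 = b' + \sum_(1 <= k < K.+1) m k.
  have := split_sum id; rewrite sumL Lpd -mulnDr => /eqP.
  rewrite eqn_pmul2l 1?ltnW // dE => /eqP.
  have -> : \sum_(1 <= k < K.+1) m k * k =
      \sum_(1 <= k < K.+1) m k * k.-1 + \sum_(1 <= k < K.+1) m k.
    rewrite -big_split; apply: eq_big_nat => k /andP[k0 _] /=.
    by rewrite addnC -mulnS prednK.
  by lia.
(* [p * a] is the only degree whose count is 1 modulo [p], so the profile determines the degree of
   the central vertex. *)
have fa f : (forall k, 0 < k -> nn k = (p * fsize f == k) + p * count_mem k (degs f)) ->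
    fsize f = a /\ forall k, 0 < k -> count_mem k (degs f) = m k.
  move=> fE; have fsE : fsize f = a.
    have := fE _ pa0; rewrite nnE // eqxx.
    case: eqP => [/eqP|_]; first by rewrite eqn_pmul2l 1?ltnW // => /eqP.
    move=> e; have : p %| 1 by rewrite -(@dvdn_addl (p * m (p * a))) ?dvdn_mulr // [_ + _]e dvdn_mulr.
    by rewrite dvdn1; move: p1 => /[swap] /eqP ->.
  split=> // k k0; have := fE k k0; rewrite nnE // fsE => /addnI/eqP.
  by rewrite eqn_pmul2l 1?ltnW // => /eqP.
(* A diameter would make every count even, but the count of degree [p * a] is then odd. *)
have nodiam t : t \in profile_set d -> ~~ diam t.
  move=> tP; apply/negP=> /(diametral_profile dL tP)[Ld [f [_ _ fE]]].
  have p2 : p = 2 by move: Lpd dL; rewrite Ld; nia.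
  by have := fE _ pa0; rewrite nnE // eqxx p2; lia.
have unc t : t \in profile_set d -> #|[set x | ~~ cov t x]| = p * a.
  move=> tP; have [f [_ _ -> _ /fa[-> _]] //] := uncovered_profile p1 Lpd tP (nodiam t tP).
have := @double_count L L0 (profile_set d) (fun t x => ~~ cov t x) (p * a)
  (profile_set_conj d) _ unc.
rewrite (@card_forest_set _ [set t in profile_set d | ~~ cov t (Ordinal L0)]
   (fun f => tau L (fpow p f)) (lukw a (content K b' m))); first last.
- move=> f g /(mem_content b' mK)[sf bf df] /(mem_content b' mK)[sg bg dg].
  have lf : len f = d by rewrite len_letters bf (size_degs_sum mK df) -dE.
  have lg : len g = d by rewrite len_letters bg (size_degs_sum mK dg) -dE.
  move=> /tau_inj e; apply: (@fpow_inj p); first exact: ltnW.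
    by rewrite lf lg.
  by apply: e; rewrite len_fpow ?lf ?lg.
- move=> t /setIdP[tP n0].
  have /and3P[nct tinv pt] : [&& ncinv t, rotinv d t & has_profile t] by rewrite inE in tP.
  have [f lf tE] := uncovered_fpow p1 Lpd nct tinv (nodiam t tP) n0.
  exists f => //; apply/(mem_content b' mK).
  have := pt; rewrite tE => /has_profile_tau; rewrite len_fpow lf -Lpd => /(_ erefl)[bE' nnE'].
  have [|fs df] := fa f.
    by move=> k k0; rewrite -nnE' // fsize_fpow count_degs_fpow.
  by split=> //; move: bE'; rewrite buds_fpow bE => /eqP; rewrite eqn_pmul2l 1?ltnW // => /eqP.
- move=> f /(mem_content b' mK)[sf bf df].
  have lf : len f = d by rewrite len_letters bf (size_degs_sum mK df) -dE.
  rewrite inE (uncovered0_fpow L0 p1 Lpd lf) andbT; apply/profile_setP; exists (fpow p f).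
  rewrite len_fpow lf -Lpd; split=> //; first exact: (rotinv_fpow L0 p1 Lpd lf).
  rewrite buds_fpow bf -bE fsize_fpow sf; split=> // k k0.
  by rewrite count_degs_fpow df // nnE.
- exact: lukw_letters.
- exact: uniq_lukw.
move=> /(_ (fun t x => congr1 negb (cov_conj L0 t x))) cnt.
have := size_lukw_content mK _ sumE; rewrite -sumE addn_gt0 a0 => /(_ isT).
by move=> e2; apply: (cancel_orbits pa0 _ e2); rewrite -Lpd.
Qed.

(** The marks are the two ends of the diameter. With a mark at 0 the involution is [Arc f f], and
    one half of it, closed up as the single tree [Arc f Empty], has the halved profile. *)
Lemma card_profile_diametral b' (m : nat -> nat) : L = d.*2 ->
  (forall k, K < k -> m k = 0) -> b = b'.*2 ->
  (forall k, 0 < k -> nn k = (m k).*2) ->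
  #|profile_set d| * (b'`! * \prod_(1 <= k < K.+1) (m k)`!) =
  d * (b' + \sum_(1 <= k < K.+1) m k).-1`!.
Proof.
move=> Ld mK bE nnE.
have dL : 0 < d < L by move: L0; rewrite Ld; lia.
have double_sum F : \sum_(1 <= k < K.+1) nn k * F k = (\sum_(1 <= k < K.+1) m k * F k).*2.
  rewrite -mul2n big_distrr /=; apply: eq_big_nat => k /andP[k0 _].
  by rewrite nnE // mulnA mul2n.
have sum1 : \sum_(1 <= k < K.+1) nn k = (\sum_(1 <= k < K.+1) m k).*2.
  have := double_sum (fun=> 1).
  rewrite (eq_bigr nn) => [->|k _]; last by rewrite muln1.
  by congr (_.*2); apply: eq_bigr => k _; rewrite muln1.
(* [d.+1] is the length of [Arc f Empty] when [(len f).+1 = d]. *)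
have dE : d.+1 = b' + (\sum_(1 <= k < K.+1) m k).*2.
  by move: sumV; rewrite sum1 Ld bE; lia.
have sumE : 1 + \sum_(1 <= k < K.+1) m k * k.-1 = b' + \sum_(1 <= k < K.+1) m k.
  have := double_sum id; rewrite sumL Ld => /double_inj.
  have -> : \sum_(1 <= k < K.+1) m k * k =
      \sum_(1 <= k < K.+1) m k * k.-1 + \sum_(1 <= k < K.+1) m k.
    rewrite -big_split; apply: eq_big_nat => k /andP[k0 _] /=.
    by rewrite addnC -mulnS prednK.
  by move: dE; lia.
have hasdiam t : t \in profile_set d -> diam t.
  move=> tP; case: (boolP (diam t)) => // nd; exfalso.
  have [||f [lf f0 _ _ fE]] := @uncovered_profile 2 t _ _ tP nd; rewrite ?mul2n //.
  by have := fE (2 * fsize f); rewrite nnE ?eqxx; lia.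
have two t : t \in profile_set d -> #|[set x | diametral t x]| = 2.
  move=> tP; have nct : ncinv t by move: tP; rewrite inE => /andP[].
  exact: card_diametral L0 _ nct (hasdiam t tP).
have := @double_count L L0 (profile_set d) (fun t x => diametral t x) 2
  (profile_set_conj d) (diametral_conj L0) two.
(* The words with one tree met below all come from an [Arc]; [1] is only a default value. *)
pose E g := if g is Arc f _ then tau L (Arc f f) else 1%g.
have shape g : letters g \in lukw 1 (content K b' m) -> exists f, [/\ g = Arc f Empty,
    (len f).+1 = d, buds f = b' & forall k, 0 < k -> ((fsize f).+1 == k) + count_mem k (degs f) = m k].
  move=> /(mem_content b' mK)[sg bg dg].
  have lg : (len g) = d.+1 by rewrite len_letters bg (size_degs_sum mK dg) -dE.
  case: g sg bg dg lg => [|r|f r] //= [].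
    by case: r => //= _ _ _ [e]; move: dL; rewrite -e.
  case: r => //= _; rewrite addn0 cats0 => bf df lf; exists f; split=> //.
  by move: lf; lia.
rewrite (@card_forest_set _ [set t in profile_set d | diametral t (Ordinal L0)] E (lukw 1 (content K b' m))); first last.
- move=> f g /shape[f' [-> lf _ _]] /shape[g' [-> lg _ _]] /tau_inj.
  by rewrite !(len_Arc_diag L0 Ld) // => /(_ erefl erefl)[->].
- move=> t /setIdP[tP d0].
  have /and3P[nct tinv pt] : [&& ncinv t, rotinv d t & has_profile t] by rewrite inE in tP.
  have [f lf tE] := diametral_Arc Ld nct tinv d0.
  exists (Arc f Empty) => //; apply/(mem_content b' mK).
  have := pt; rewrite tE => /has_profile_tau; rewrite (len_Arc_diag L0 Ld) // => /(_ erefl)[bE' nnE'].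
  split=> //=; first by move: bE'; rewrite /= addn0 bE addnn => /double_inj.
  by move=> k k0; have := nnE' k k0; rewrite /= count_cat cats0 nnE //; lia.
- move=> g /shape[f [-> lf bf df]].
  rewrite inE (diametral0_Arc L0 Ld) // andbT; apply/profile_setP; exists (Arc f f).
  rewrite (len_Arc_diag L0 Ld) //; split=> //; first exact: (rotinv_Arc L0 Ld).
  rewrite /= bf addnn bE; split=> // k k0.
  rewrite count_cat nnE // -df //. by rewrite doubleD -!addnn !addnA.
- exact: lukw_letters.
- exact: uniq_lukw.
move=> cnt; have := size_lukw_content mK _ sumE; rewrite -sumE => /(_ isT).
move=> e2; apply: (@cancel_orbits 2 _ 1 _ _ _ _ isT _ e2).
by rewrite muln1 mul2n -Ld.
Qed.

End Quotient.
End Typed.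

Lemma mem_pmw_letters f J a :
  letters f \in pmw J a <-> [/\ buds f = 0, size (degs f) = J & fsize f = a].
Proof.
have all0 : all (leq 1) (letters f) = (buds f == 0).
  rewrite -count_letters0 -leqn0 leqNgt -has_count -all_predC; apply: eq_all => x /=.
  by rewrite lt0n.
rewrite mem_pmw all0 size_letters; split=> [/and3P[/eqP sz /eqP b0 lf]|[b0 sz <-]].
  by have [] := unletK lf; rewrite lettersK => -> _; rewrite b0 in sz.
by rewrite b0 sz !eqxx luk_letters.
Qed.

Lemma hockey_stick m k : \sum_(i < k.+1) 'C(m + i, i) = 'C((m + k).+1, k).
Proof.
elim: k => [|k IHk]; first by rewrite big_ord_recl big_ord0 !bin0.
by rewrite big_ord_recr IHk /= addnS binS addnC.
Qed.

Lemma double_bin_mid J : 2 * 'C(J.*2.+1, J) = 'C(J.+1.*2, J.+1).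
Proof.
rewrite doubleS binS mul2n -addnn; congr (_ + _).
by rewrite -bin_sub; [congr 'C(_, _) |]; lia.
Qed.

(** * Invariant noncrossing matchings *)

Section Matchings.
Variables (L j : nat).
Hypothesis L0 : 0 < L.
Hypothesis Lj : L = j.*2.
Notation c := (cyc L).

Definition matchings d := [set t : {perm 'I_L} |
  [&& ncinv t, rotinv d t & [forall x, t x != x]]].

Lemma nofix_tau g : len g = L -> [forall x, tau L g x != x] = (buds g == 0).
Proof.
move=> lg; rewrite -(card_fix_tau lg) cards_eq0; apply/forallP/eqP => [H|H x].
  by apply/setP=> x; rewrite !inE (negbTE (H x)).
by have := in_set0 x; rewrite -H inE => ->.
Qed.

Lemma matchings_conj d t : ((t ^ c)%g \in matchings d) = (t \in matchings d).
Proof.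
rewrite !inE ncinv_conjE // rotinv_conj //; congr [&& _, _ & _].
apply/forallP/forallP => H x; last first.
  by rewrite -[x](permKV c) permJ (inj_eq perm_inj).
by have := H (c x); rewrite permJ (inj_eq perm_inj).
Qed.

Lemma matchings_conjX d t k : ((t ^ (c ^+ k))%g \in matchings d) = (t \in matchings d).
Proof.
elim: k => [|k IHk]; first by rewrite expg0 conjg1.
by rewrite expgSr conjgM matchings_conj.
Qed.

(** One extra arc above the forest makes it a single tree with [j.+1] arcs. *)
Lemma card_matchings1 : #|matchings L| = ballot 1 j.
Proof.
pose E g := if g is Arc f _ then tau L f else 1%g.
have shape g : letters g \in pmw j.+1 1 ->
    exists f, [/\ g = Arc f Empty, len f = L & buds f = 0].
  move=> /mem_pmw_letters[]; case: g => [|r|f r] //= b0.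
  case: r b0 => //= b0; rewrite cats0 => -[dg] _; exists f; split=> //; last by lia.
  by rewrite len_letters dg Lj; lia.
apply: (@card_forest_set _ (matchings L) E (pmw j.+1 1)).
- exact: uniq_pmw.
- by move=> w; rewrite mem_pmw => /and3P[_ _ /unletK[]].
- move=> g /shape[f [-> lf bf]]; rewrite inE ncinv_tau // nofix_tau // bf eqxx.
  by rewrite /rotinv cycXL conjg1 eqxx.
- move=> t; rewrite inE => /and3P[/(ncinv_forest L0)[f lf tE] _].
  rewrite tE nofix_tau // => /eqP bf; exists (Arc f Empty) => //.
  apply/mem_pmw_letters; rewrite /= bf cats0; split=> //.
  by move: lf; rewrite len_letters bf Lj => /double_inj ->.
- move=> f g /shape[f' [-> lf _]] /shape[g' [-> lg _]] /= /tau_inj e.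
  by rewrite e.
Qed.

Section Quotient.
Variable d : nat.

Lemma uncovered_matching p t : 1 < p -> L = p * d -> t \in matchings d -> ~~ diam t ->
  exists f, [/\ len f = d, 0 < fsize f, #|[set x | ~~ cov t x]| = p * fsize f & buds f = 0].
Proof.
move=> p1 Lpd tP nd.
have /and3P[nct _ _] : [&& ncinv t, rotinv d t & [forall x, t x != x]] by rewrite inE in tP.
have [x nx] := uncovered_exists L0 nct nd.
pose t' := (t ^ (c ^+ (L - x)))%g.
have t'P : t' \in matchings d by rewrite matchings_conjX.
have n0 : ~~ cov t' (Ordinal L0) by rewrite -(to0 L0 x) cov_conjX.
have nd' : ~~ diam t'.
  rewrite /t'; elim: (L - x) => [|k IHk]; first by rewrite expg0 conjg1.
  by rewrite expgSr conjgM diam_conj.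
have /and3P[nct' tinv' pt'] : [&& ncinv t', rotinv d t' & [forall x, t' x != x]] by rewrite inE in t'P.
have [f lf t'E] := uncovered_fpow p1 Lpd nct' tinv' nd' n0.
move: pt'; rewrite t'E nofix_tau ?len_fpow ?lf // buds_fpow muln_eq0 => /orP[/eqP p0|/eqP bf].
  by rewrite p0 in p1.
exists f; split=> //.
  by move: L0; rewrite Lpd -lf; case: (f) => //=; lia.
by rewrite -(card_uncovered_conjX L0 t (L - x)) -/t' t'E (card_uncovered_fpow L0 p1 Lpd lf).
Qed.

Lemma diametral_matching t : 0 < d < L -> t \in matchings d -> diam t ->
  L = d.*2 /\ exists f, (len f).+1 = d /\ buds f = 0.
Proof.
move=> dL tP dt.
have /and3P[nct tinv _] : [&& ncinv t, rotinv d t & [forall x, t x != x]] by rewrite inE in tP.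
have Ld := diam_half L0 nct tinv dL dt; split=> //.
have /existsP[x dx] := dt.
pose t' := (t ^ (c ^+ (L - x)))%g.
have t'P : t' \in matchings d by rewrite matchings_conjX.
have d0 : diametral t' (Ordinal L0) by rewrite -(to0 L0 x) diametral_conjX.
have /and3P[nct' tinv' pt'] : [&& ncinv t', rotinv d t' & [forall x, t' x != x]] by rewrite inE in t'P.
have [f lf t'E] := diametral_Arc Ld nct' tinv' d0.
exists f; split=> //; move: pt'; rewrite t'E nofix_tau ?(len_Arc_diag L0 Ld) //=; lia.
Qed.

(** A diameter is compatible with a half-turn only. Without one, a block of [d] points is matched
    within itself, so [d] is even and [p] divides half of [L]. *)
Lemma matchings_order p : 1 < p -> L = p * d -> matchings d != set0 -> (p %| j) || (p == 2).
Proof.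
move=> p1 Lpd /set0Pn[t tP].
have dL : 0 < d < L by move: L0 p1; rewrite Lpd; nia.
have [/(diametral_matching dL tP)[Ld _]|nd] := boolP (diam t).
  by apply/orP; right; apply/eqP; move: Lpd dL; rewrite Ld; nia.
have [f [lf _ _ bf]] := uncovered_matching p1 Lpd tP nd.
move: Lpd; rewrite -lf len_letters bf add0n Lj -doubleMr => /double_inj ->.
by rewrite dvdn_mulr.
Qed.

(** The diameter has [j] positions, and a matching of the [J.*2] points on one side is copied to the
    other. *)
Lemma card_matchings_diametral J : d = J.*2.+1 -> j = d -> #|matchings d| = j * ballot 1 J.
Proof.
move=> dJ jd; have Ld : L = d.*2 by rewrite Lj jd.
have dL : 0 < d < L by lia.
have hasdiam t : t \in matchings d -> diam t.
  move=> tP; case: (boolP (diam t)) => // nd; exfalso.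
  have [||f [lf _ _ bf]] := @uncovered_matching 2 t _ _ tP nd; rewrite ?mul2n //.
  by move: lf; rewrite len_letters bf dJ; lia.
have two t : t \in matchings d -> #|[set x | diametral t x]| = 2.
  move=> tP; have nct : ncinv t by move: tP; rewrite inE => /andP[].
  exact: card_diametral L0 _ nct (hasdiam t tP).
have := @double_count L L0 (matchings d) (fun t x => diametral t x) 2
  (matchings_conj d) (diametral_conj L0) two.
pose E g := if g is Arc f _ then tau L (Arc f f) else 1%g.
have shape g : letters g \in pmw J.+1 1 ->
    exists f, [/\ g = Arc f Empty, (len f).+1 = d & buds f = 0].
  move=> /mem_pmw_letters[]; case: g => [|r|f r] //= b0.
  case: r b0 => //= b0; rewrite cats0 => -[dg] _; exists f; split=> //; last by lia.
  by rewrite len_letters dg dJ; lia.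
rewrite (@card_forest_set _ [set t in matchings d | diametral t (Ordinal L0)] E (pmw J.+1 1)).
- move=> e; apply: double_inj; rewrite -[LHS]muln2 e [X in X * _ = _]Lj doubleMl.
  by [].
- exact: uniq_pmw.
- by move=> w; rewrite mem_pmw => /and3P[_ _ /unletK[]].
- move=> g /shape[f [-> lf bf]].
  have lA := len_Arc_diag L0 Ld lf.
  rewrite inE (diametral0_Arc L0 Ld) // andbT inE ncinv_tau // nofix_tau //=.
  by rewrite bf addn0 eqxx (rotinv_Arc L0 Ld).
- move=> t /setIdP[tP d0].
  have /and3P[nct tinv pt] : [&& ncinv t, rotinv d t & [forall x, t x != x]] by rewrite inE in tP.
  have [f lf tE] := diametral_Arc Ld nct tinv d0.
  exists (Arc f Empty) => //.
  have bf : buds f = 0 by move: pt; rewrite tE nofix_tau ?(len_Arc_diag L0 Ld) //=; lia.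
  apply/mem_pmw_letters; rewrite /= bf cats0; split=> //; congr _.+1.
  by move: lf; rewrite len_letters bf dJ; lia.
- move=> f g /shape[f' [-> lf _]] /shape[g' [-> lg _]] /tau_inj.
  by rewrite !(len_Arc_diag L0 Ld) // => /(_ erefl erefl)[->].
Qed.

(** The number [p * a] of uncovered corners depends on the matching. For fixed [a], marking one of
    them and the ballot formula give twice a binomial coefficient; the sum over [a] is a
    hockey-stick sum. *)
Lemma card_matchings_uncovered p J : 1 < p -> L = p * d -> d = J.*2 ->
  #|matchings d| = 'C(J.*2, J).
Proof.
move=> p1 Lpd dJ.
have dL : 0 < d < L by move: L0 p1; rewrite Lpd; nia.
have J0 : 0 < J by lia.
have nodiam t : t \in matchings d -> ~~ diam t.
  move=> tP; apply/negP=> /(diametral_matching dL tP)[_ [f [lf bf]]].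
  by move: lf; rewrite len_letters bf dJ; lia.
pose U (t : {perm 'I_L}) := #|[set x | ~~ cov t x]|.
pose Y a := [set t in matchings d | U t == p * a].
have YE a : 0 < a <= J -> #|Y a| = 2 * 'C((J.*2 - a).-1, J - a).
  move=> aJ; have pa0 : 0 < p * a by nia.
  have YJ t : ((t ^ c)%g \in Y a) = (t \in Y a).
    rewrite inE [in RHS]inE matchings_conj; congr (_ && (_ == _)).
    by rewrite /U -[in RHS](card_uncovered_conjX L0 t 1) expg1.
  have := @double_count L L0 (Y a) (fun t x => ~~ cov t x) (p * a) YJ.
  rewrite (@card_forest_set _ [set t in Y a | ~~ cov t (Ordinal L0)]
     (fun f => tau L (fpow p f)) (pmw J a)); first last.
  - move=> f g /mem_pmw_letters[bf df _] /mem_pmw_letters[bg dg _].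
    have lf : len f = d by rewrite len_letters bf df dJ.
    have lg : len g = d by rewrite len_letters bg dg dJ.
    move=> /tau_inj e; apply: (@fpow_inj p); first exact: ltnW.
      by rewrite lf lg.
    by apply: e; rewrite len_fpow ?lf ?lg.
  - move=> t /setIdP[/setIdP[tP /eqP Ut] n0].
    have /and3P[nct tinv pt] : [&& ncinv t, rotinv d t & [forall x, t x != x]] by rewrite inE in tP.
    have [f lf tE] := uncovered_fpow p1 Lpd nct tinv (nodiam t tP) n0.
    exists f => //; apply/mem_pmw_letters.
    have bf : buds f = 0.
      move: pt; rewrite tE nofix_tau ?len_fpow ?lf // buds_fpow muln_eq0.
      by case/orP=> /eqP // p0; rewrite p0 in p1.
    split=> //; first by apply: double_inj; rewrite -dJ -lf len_letters bf.
    move: Ut; rewrite /U tE (card_uncovered_fpow L0 p1 Lpd lf) => /eqP.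
    by rewrite eqn_pmul2l 1?ltnW // => /eqP.
  - move=> f /mem_pmw_letters[bf df sf].
    have lf : len f = d by rewrite len_letters bf df dJ.
    rewrite inE (uncovered0_fpow L0 p1 Lpd lf) andbT inE /U.
    rewrite (card_uncovered_fpow L0 p1 Lpd lf) sf eqxx andbT inE.
    have lp : len (fpow p f) = L by rewrite len_fpow lf.
    by rewrite ncinv_tau // nofix_tau // buds_fpow bf muln0 eqxx (rotinv_fpow L0 p1 Lpd lf).
  - by move=> w; rewrite mem_pmw => /and3P[_ _ /unletK[]].
  - exact: uniq_pmw.
  move=> /(_ (fun t x => congr1 negb (cov_conj L0 t x))).
  move=> /(_ (fun t tY => eqP (proj2 (setIdP tY)))).
  have := @ballot_mul a (J - a); rewrite /ballot subnKC; last by lia.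
  move=> /(_ ltac:(lia)) bm cnt.
  have nE : (a + (J - a).*2).-1 = (J.*2 - a).-1 by lia.
  rewrite nE in bm; move: cnt bm; rewrite [X in _ = X * _]Lpd dJ.
  move: #|Y a| (size _) 'C(_, _) => y s b e1 e2.
  have : y * (p * a) = 2 * b * (p * a) by rewrite e1 -mul2n; nia.
  by move/eqP; rewrite eqn_pmul2r // => /eqP.
have -> : #|matchings d| = \sum_(a < J) #|Y a.+1|.
  transitivity (\sum_(t in matchings d) \sum_(a < J) (U t == p * a.+1 : nat)).
    rewrite -sum1_card; apply: eq_bigr => t tP.
    have [f [lf f0 Ut bf]] := uncovered_matching p1 Lpd tP (nodiam t tP).
    have fJ : (fsize f).-1 < J.
      have sJ : size (degs f) = J by apply: double_inj; rewrite -dJ -lf len_letters bf.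
      by have := luk_size (luk_letters f); rewrite size_letters bf sJ; lia.
    rewrite (bigD1 (Ordinal fJ)) //= [U t]Ut prednK // eqxx big1 // => a.
    rewrite -val_eqE /= => af; rewrite eqn_pmul2l 1?ltnW //; case: eqP => // e.
    by move: af; rewrite e eqxx.
  rewrite exchange_big; apply: eq_bigr => a _.
  rewrite -sum1dep_card big_mkcondr /=.
  by apply: eq_bigr => t _; case: (_ == _).
rewrite (eq_bigr (fun a : 'I_J => 2 * 'C((J.*2 - a.+1).-1, J - a.+1))) => [|a _]; last first.
  by rewrite YE //=.
rewrite -big_distrr /= (reindex_inj rev_ord_inj) /=.
case: J J0 {dJ Y YE} => // J' _.
rewrite (eq_bigr (fun a : 'I_J'.+1 => 'C(J' + a, a))) => [|a _]; last first.
  by have := ltn_ord a => aJ; congr 'C(_, _); lia.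
by rewrite hockey_stick addnn double_bin_mid.
Qed.

End Quotient.
End Matchings.

(** Passing from a subset of the circle to ranks keeps the order, hence also crossings. *)
Lemma enum_val_ltn L (C : {set 'I_L}) (i k : 'I_#|C|) :
  (enum_val i < enum_val k) = (i < k).
Proof.
have srt : sorted ltn [seq val x | x <- enum C].
  rewrite {1}/enum_mem -enumT (sorted_map) sorted_filter //.
    by move=> x y z; apply: ltn_trans.
  have := iota_ltn_sorted 0 L; rewrite -val_enum_ord sorted_map.
  by [].
have mono (u v : 'I_#|C|) : u < v -> enum_val u < enum_val v.
  move=> uv; have x0 := enum_val u.
  rewrite !(enum_val_nth x0) -!(nth_map x0 0 val) -?cardE ?ltn_ord //.
  by apply: (sorted_ltn_nth ltn_trans) => //; rewrite inE size_map -cardE.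
apply/idP/idP => [|/mono //]; apply: contraTT; rewrite -!leqNgt leq_eqVlt.
by case/orP=> [/eqP/val_inj -> //|/mono/ltnW].
Qed.

Lemma card_ltn_ord M (i : 'I_M) : #|[set k : 'I_M | k < i]| = i.
Proof.
have inj : injective (widen_ord (ltnW (ltn_ord i))).
  by move=> u v /(congr1 val) /= /val_inj.
rewrite -[RHS]card_ord -(card_imset _ inj).
apply: eq_card => k; rewrite inE; apply/idP/imsetP => [ki|[u _ ->]].
  by exists (Ordinal ki) => //; apply: val_inj.
by rewrite /=.
Qed.

(** * A rotation-invariant subset of the circle as a smaller circle *)

Section Transport.
Variables (L p d b : nat) (C : {set 'I_L}) (x1 : 'I_L).
Hypotheses (L0 : 0 < L) (p0 : 0 < p) (Lpd : L = p * d) (Cpb : #|C| = p * b) (x1C : x1 \in C).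
Notation c := (cyc L).
Hypothesis Crot : forall x, ((c ^+ d)%g x \in C) = (x \in C).
Notation M := #|C|.
Notation rk := (enum_rank_in x1C).

Lemma M0 : 0 < M. Proof. by apply/card_gt0P; exists x1. Qed.

Definition below k := #|[set y in C | y < k]|.

Lemma below_rank x : x \in C -> below x = rk x.
Proof.
move=> xC; rewrite -[RHS]card_ltn_ord -(card_imset _ (@enum_val_inj _ C)).
apply: eq_card => y; rewrite inE; apply/andP/imsetP => [[yC yx]|[i + ->]].
  exists (rk y); last by rewrite enum_rankK_in.
  by rewrite inE -enum_val_ltn !enum_rankK_in.
by rewrite inE -enum_val_ltn enum_rankK_in // => ->; rewrite enum_valP.
Qed.

Lemma belowD k : k + d <= L -> below (k + d) = below d + below k.
Proof.
move=> kdL.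
have val_rot (y : 'I_L) : y < k -> (c ^+ d)%g y = y + d :> nat.
  by move=> yk; rewrite val_cycX modn_small //; lia.
rewrite /below -[X in _ = _ + X](card_imset _ (@perm_inj _ (c ^+ d)%g)) -cardsUI.
rewrite [X in _ = _ + X](_ : _ = 0) ?addn0; last first.
  apply/eqP; rewrite cards_eq0; apply/eqP/setP=> y; rewrite !inE.
  apply/negP=> /andP[/andP[_ yd] /imsetP[z + yE]]; rewrite inE => /andP[_ zk].
  by move: yd; rewrite yE val_rot //; lia.
apply: eq_card => y; rewrite !inE; apply/idP/idP => [/andP[yC ykd]|].
  rewrite yC /=; case: (ltnP y d) => //= dy.
  pose z := ((c ^+ d)^-1)%g y; have yE : y = (c ^+ d)%g z by rewrite permKV.
  have zE : z = y - d :> nat.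
    have zL : y - d < L by have := ltn_ord y; lia.
    suff -> : z = Ordinal zL by [].
    apply: (@perm_inj _ (c ^+ d)%g); rewrite -yE; apply: val_inj.
    by rewrite /= val_cycX /= subnK // modn_small.
  rewrite yE imset_f // inE; apply/andP; split; last by rewrite zE; lia.
  by rewrite -Crot -yE.
case/orP=> [/andP[-> yd]|/imsetP[z + ->]]; first by rewrite /=; lia.
by rewrite inE => /andP[zC zk]; rewrite Crot zC val_rot //=; lia.
Qed.

Lemma belowM k z : z + k * d <= L -> below (z + k * d) = k * below d + below z.
Proof.
elim: k => [|k IHk]; first by rewrite !mul0n addn0.
rewrite mulSn [d + _]addnC addnA => le; rewrite belowD // IHk; last by lia.
by rewrite mulSn addnA.
Qed.

Lemma below_d : below d = b.
Proof.
have bL : below L = M.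
  by rewrite /below; apply: eq_card => y; rewrite inE ltn_ord andbT.
have b0 : below 0 = 0.
  by apply/eqP; rewrite cards_eq0; apply/eqP/setP=> y; rewrite !inE ltn0 andbF.
have := @belowM p 0; rewrite add0n -Lpd leqnn bL b0 addn0 Cpb => /(_ isT)/eqP.
by rewrite eqn_pmul2l // => /eqP.
Qed.

(** By invariance every window of [d] consecutive corners contains [b] points of [C], so a turn by
    [d] shifts ranks by [b]. *)
Lemma rank_rot x : x \in C -> rk ((c ^+ d)%g x) = (cyc M ^+ b)%g (rk x).
Proof.
move=> xC; apply: val_inj; rewrite /= val_cycX -!below_rank ?Crot //.
have bx : below x < M by rewrite below_rank.
have xL := ltn_ord x; rewrite val_cycX.
have [lt|ge] := ltnP (x + d) L.
  have bL : below (x + d) < M.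
    have := lt; rewrite -[x + d](modn_small lt) -val_cycX => _.
    by rewrite below_rank // Crot.
  rewrite modn_small //; rewrite (belowD (ltnW lt)) below_d addnC in bL *.
  by rewrite modn_small.
have zE : (x + d) %% L = x + d - L.
  have dL : d <= L by rewrite Lpd leq_pmull.
  by rewrite -{1}(subnK ge) modnDr modn_small //; lia.
rewrite zE; set z := x + d - L.
have pd : p.-1 * d + d = L by rewrite Lpd -[X in _ + X]mul1n -mulnDl; congr (_ * _); lia.
have xE : nat_of_ord x = z + p.-1 * d by rewrite /z; lia.
have pb : p.-1 * b + b = M by rewrite Cpb -[X in _ + X]mul1n -mulnDl; congr (_ * _); lia.
have bE : below x = p.-1 * b + below z by rewrite {1}xE belowM ?below_d // -xE ltnW.
rewrite bE addnAC pb modnDl modn_small //.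
by apply: leq_ltn_trans bx; rewrite bE leq_addl.
Qed.

Definition lift_fun (s : {perm 'I_M}) x := if x \in C then enum_val (s (rk x)) else x.

Lemma lift_funK s : cancel (lift_fun s) (lift_fun s^-1).
Proof.
move=> x; rewrite /lift_fun; have [xC|/negbTE xC] := boolP (x \in C); last by rewrite xC.
by rewrite enum_valP enum_valK_in permK enum_rankK_in.
Qed.

Definition lift_perm s : {perm 'I_L} := perm (can_inj (lift_funK s)).

Lemma lift_perm_in s x : x \in C -> lift_perm s x = enum_val (s (rk x)).
Proof. by move=> xC; rewrite permE /lift_fun xC. Qed.

Lemma lift_perm_out s x : x \notin C -> lift_perm s x = x.
Proof. by move=> /negbTE xC; rewrite permE /lift_fun xC. Qed.

Lemma lift_perm_val s i : lift_perm s (enum_val i) = enum_val (s i).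
Proof. by rewrite lift_perm_in ?enum_valP // enum_valK_in. Qed.

Lemma lift_perm_inj : injective lift_perm.
Proof.
move=> s s' e; apply/permP=> i; apply: (@enum_val_inj _ C).
by rewrite -!lift_perm_val e.
Qed.

Lemma ncinv_lift s : ncinv (lift_perm s) = ncinv s.
Proof.
apply/ncinvP/ncinvP => -[sK nc]; split.
- by move=> i; apply: (@enum_val_inj _ C); rewrite -!lift_perm_val sK.
- move=> i k h1 h2 h3; apply: (nc (enum_val i) (enum_val k));
  by rewrite ?lift_perm_val enum_val_ltn.
- move=> x; have [xC|xC] := boolP (x \in C); last by rewrite !lift_perm_out.
  by rewrite -(enum_rankK_in x1C xC) !lift_perm_val sK.
- move=> x y; have [xC|xC] := boolP (x \in C); last by rewrite (lift_perm_out s xC); lia.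
  have [yC|yC] := boolP (y \in C); last by rewrite (lift_perm_out s yC); lia.
  rewrite -(enum_rankK_in x1C xC) -(enum_rankK_in x1C yC) !lift_perm_val !enum_val_ltn.
  exact: nc.
Qed.

Lemma rotinv_lift s : rotinv d (lift_perm s) = rotinv b s.
Proof.
apply/rotinvP/rotinvP => H.
- move=> i; apply: (@enum_val_inj _ C).
  have iC := enum_valP i; have iE := enum_valK_in x1C i.
  have rE k : (cyc M ^+ b)%g k = rk ((c ^+ d)%g (enum_val k)).
    by rewrite rank_rot ?enum_valP // enum_valK_in.
  rewrite -lift_perm_val !rE enum_rankK_in ?Crot // enum_rankK_in ?Crot ?enum_valP //.
  by rewrite H lift_perm_val.
- move=> x; have [xC|xC] := boolP (x \in C); last first.
    by rewrite !lift_perm_out // Crot.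
  rewrite !lift_perm_in ?Crot // rank_rot // H.
  rewrite -[s (rk x)](enum_valK_in x1C) -rank_rot ?enum_valP // enum_rankK_in //.
  by rewrite enum_valK_in.
  by rewrite Crot enum_valP.
Qed.

(** [lift_perm] is the bijection: it keeps noncrossing, and it turns invariance by [b] on the small
    circle into invariance by [d] on the large one. *)
Lemma card_moved_rotinv :
  #|[set t : {perm 'I_L} | [&& ncinv t, rotinv d t & moved t == C]]| =
  #|matchings M b|.
Proof.
rewrite -(card_imset (mem (matchings M b)) lift_perm_inj); apply: eq_card => t.
rewrite inE; apply/and3P/imsetP => [[nct tinv /eqP mC]|[s + ->]].
- have mE x : (t x != x) = (x \in C) by rewrite -mC inE.
  have tC x : (t x \in C) = (x \in C) by rewrite -!mE (inj_eq perm_inj).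
  have inj : injective (fun i : 'I_M => rk (t (enum_val i))).
    move=> i k e; apply: (@enum_val_inj _ C); apply: (@perm_inj _ t).
    rewrite -(enum_rankK_in x1C (_ : t (enum_val i) \in C)) ?tC ?enum_valP // e.
    by rewrite enum_rankK_in // tC enum_valP.
  have tE : t = lift_perm (perm inj).
    apply/permP=> x; have [xC|xC] := boolP (x \in C).
      by rewrite lift_perm_in // permE !enum_rankK_in // tC.
    by rewrite lift_perm_out //; apply/eqP; rewrite -[_ == _]negbK mE.
  exists (perm inj) => //; rewrite inE -ncinv_lift -rotinv_lift -tE nct tinv /=.
  apply/forallP=> i; rewrite -(inj_eq (@enum_val_inj _ C)) -lift_perm_val -tE.
  by rewrite mE enum_valP.
- rewrite inE => /and3P[ncs sinv /forallP ns]; rewrite ncinv_lift rotinv_lift; split=> //.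
  apply/eqP/setP=> x; rewrite inE; have [xC|xC] := boolP (x \in C).
    rewrite -{1 2}(enum_rankK_in x1C xC) lift_perm_val (inj_eq (@enum_val_inj _ C)).
    by rewrite ns.
  by rewrite lift_perm_out // eqxx.
Qed.

End Transport.

Import Order.TTheory GRing.Theory Num.Theory.

Local Open Scope ring_scope.

Lemma tperm_swap (T : finType) (a b c d u : T) :
  c != a -> c != b -> d != a -> d != b ->
  tperm a b (tperm c d u) = tperm c d (tperm a b u).
Proof.
move=> ca cb da db; have [ac bc ad bd] : [/\ a != c, b != c, a != d & b != d].
  by rewrite ![_ == c]eq_sym ![_ == d]eq_sym.
case: (tpermP c d u) => [->|->|/eqP uc /eqP ud].
- by rewrite (tpermD ad bd) (tpermD ac bc) tpermL.
- by rewrite (tpermD ad bd) (tpermD ac bc) tpermR.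
- by case: (tpermP a b u) => [_|_|_ _]; rewrite tpermD // eq_sym.
Qed.

(** * Unimodality of q-binomials *)

(* An sl2-action on subsets of {0..n}: the raising operator F moves an element
   from j to j+1, the lowering operator E moves it back with weight
   (j+1)(n-j), and EF - FE is multiplication by a scalar on each level. *)
Section LevelSets.
Variable n : nat.
Notation site := 'I_n.+1.
Implicit Types (S T : {set site}) (i k : 'I_n) (g h : {set site} -> rat).

Definition lo (i : 'I_n) : site := widen_ord (leqnSn n) i.
Definition hi (i : 'I_n) : site := lift ord0 i.

Definition hop i S : {set site} := [set x | tperm (lo i) (hi i) x \in S].
Definition up i S := (lo i \in S) && (hi i \notin S).
Definition dn i S := (lo i \notin S) && (hi i \in S).
Definition wgt i : rat := (i.+1 * (n - i))%:R.

Definition raise g T : rat := \sum_i (dn i T)%:R * g (hop i T).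
Definition lower h S : rat := \sum_i wgt i * (up i S)%:R * h (hop i S).

Lemma mem_hop_lo i S : (lo i \in hop i S) = (hi i \in S).
Proof. by rewrite inE tpermL. Qed.

Lemma mem_hop_hi i S : (hi i \in hop i S) = (lo i \in S).
Proof. by rewrite inE tpermR. Qed.

Lemma mem_hop_other i S x : x != lo i -> x != hi i -> (x \in hop i S) = (x \in S).
Proof. by move=> h1 h2; rewrite inE tpermD // eq_sym. Qed.

Lemma hopK i : involutive (hop i).
Proof. by move=> S; apply/setP=> x; rewrite !inE tpermK. Qed.

Lemma up_hop i S : up i (hop i S) = dn i S.
Proof. by rewrite /up /dn mem_hop_lo mem_hop_hi andbC. Qed.

Lemma dn_hop i S : dn i (hop i S) = up i S.
Proof. by rewrite -up_hop hopK. Qed.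

(** Moves at distant places commute; if the two moves share a site, neither order is possible. *)
Lemma hop_commute i k S : i != k ->
  (up i S && dn k (hop i S) = dn k S && up i (hop k S)) /\
  (up i S && dn k (hop i S) -> hop k (hop i S) = hop i (hop k S)).
Proof.
move=> ik; have ikv : (i : nat) <> k by move=> e; move: ik; rewrite (val_inj e) eqxx.
have [e|ne] := eqVneq (i.+1 : nat) k.
  have E : hi i = lo k by apply: val_inj.
  have d1 : hi k != lo i by rewrite -val_eqE /= /bump /=; apply/eqP; lia.
  have d2 : hi k != hi i by rewrite -val_eqE /= /bump /=; apply/eqP; lia.
  have d3 : lo i != lo k by rewrite -val_eqE /=; apply/eqP; lia.
  have d4 : lo i != hi k by rewrite eq_sym.
  rewrite /up /dn -E mem_hop_hi (mem_hop_other _ d1 d2) E mem_hop_lo.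
  rewrite (mem_hop_other _ d3 d4).
  by case: (lo i \in S); case: (lo k \in S); case: (hi k \in S).
have [e|ne'] := eqVneq (k.+1 : nat) i.
  have E : hi k = lo i by apply: val_inj.
  have d1 : lo k != lo i by rewrite -val_eqE /=; apply/eqP; lia.
  have d2 : lo k != hi i by rewrite -val_eqE /= /bump /=; apply/eqP; lia.
  have d3 : hi i != lo k by rewrite eq_sym.
  have d4 : hi i != hi k by rewrite -val_eqE /= /bump /=; apply/eqP; lia.
  rewrite /up /dn (mem_hop_other _ d1 d2) E mem_hop_lo -E mem_hop_hi.
  rewrite (mem_hop_other _ d3 d4).
  by case: (lo k \in S); case: (hi i \in S); case: (hi k \in S).
have d1 : lo k != lo i by rewrite -val_eqE /=; apply/eqP; lia.
have d2 : lo k != hi i by rewrite -val_eqE /= /bump /=; apply/eqP; lia.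
have d3 : hi k != lo i by rewrite -val_eqE /= /bump /=; apply/eqP; lia.
have d4 : hi k != hi i by rewrite -val_eqE /= /bump /=; apply/eqP; lia.
split.
  rewrite /up /dn !(mem_hop_other _ d1 d2) !(mem_hop_other _ d3 d4).
  by rewrite !mem_hop_other 1?eq_sym // andbC.
move=> _; apply/setP=> x; rewrite !inE; congr (_ \in S).
by rewrite tperm_swap.
Qed.

Definition level_wgt S : rat := \sum_i wgt i * ((up i S)%:R - (dn i S)%:R).

(** Collecting the terms of a site [x] leaves [(x + 1) * (n - x) - x * (n + 1 - x) = n - 2 * x]. *)
Lemma level_wgtE S : level_wgt S = (n * #|S|)%:R - (2 * \sum_(x in S) x)%:R.
Proof.
pose I (x : site) : rat := (x \in S)%:R.
have -> : level_wgt S = \sum_i wgt i * I (lo i) - \sum_i wgt i * I (hi i).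
  rewrite -sumrB; apply: eq_bigr => i _; rewrite -mulrBr /up /dn /I.
  by case: (lo i \in S); case: (hi i \in S); rewrite /= ?subrr ?subr0.
pose u (x : nat) : rat := (x.+1 * (n - x))%:R.
pose v (x : nat) : rat := (x * (n.+1 - x))%:R.
have -> : \sum_i wgt i * I (lo i) = \sum_(x : site) u x * I x.
  rewrite [RHS]big_ord_recr /= /u subnn muln0 mul0r addr0; apply: eq_bigr => i _.
  by congr (_ * I _); apply: val_inj.
have -> : \sum_i wgt i * I (hi i) = \sum_(x : site) v x * I x.
  by rewrite [RHS]big_ord_recl /= /v mul0n mul0r add0r; apply: eq_bigr => i _.
have -> : (n * #|S|)%:R = \sum_(x : site) n%:R * I x.
  rewrite natrM -sum1_card natr_sum mulr_sumr big_mkcond; apply: eq_bigr => x _.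
  by rewrite /I; case: (x \in S); rewrite ?mulr0.
have -> : (2 * \sum_(x in S) x)%:R = \sum_(x : site) 2 * x%:R * I x.
  rewrite natrM natr_sum mulr_sumr big_mkcond; apply: eq_bigr => x _.
  by rewrite /I; case: (x \in S); rewrite ?mulr0 ?mulr1.
rewrite -!sumrB; apply: eq_bigr => x _; rewrite -!mulrBl; congr (_ * _).
have := ltn_ord x; rewrite /u /v ltnS => xn.
move: (nat_of_ord x) xn => y yn.
rewrite -(addn1 y) -(addn1 n) natrM natrD natrB // natrM natrB; last by rewrite addn1 leqW.
by rewrite natrD; ring.
Qed.

(** Off the diagonal the terms cancel by [hop_commute]; on it, the two hops undo each other. *)
Lemma commutator g S : lower (raise g) S - raise (lower g) S = level_wgt S * g S.
Proof.
have -> : lower (raise g) S = \sum_i \sum_k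
    wgt i * (up i S && dn k (hop i S))%:R * g (hop k (hop i S)).
  apply: eq_bigr => i _; rewrite /raise mulr_sumr; apply: eq_bigr => k _.
  by rewrite -mulnb natrM; ring.
have -> : raise (lower g) S = \sum_i \sum_k
    wgt i * (dn k S && up i (hop k S))%:R * g (hop i (hop k S)).
  rewrite exchange_big; apply: eq_bigr => k _ /=; rewrite /lower mulr_sumr.
  by apply: eq_bigr => i _; rewrite -mulnb natrM; ring.
rewrite -sumrB /level_wgt mulr_suml; apply: eq_bigr => i _.
rewrite -sumrB (bigD1 i) //= [X in _ + X]big1; last first.
  move=> k ki; have [|e1 e2] := @hop_commute i k S; first by rewrite eq_sym.
  rewrite -e1; case: (boolP (up i S && dn k (hop i S))) => [H|_].
    by rewrite e2 // subrr.
  by rewrite !mulr0 !mul0r subrr.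
by rewrite hopK dn_hop up_hop !andbb; ring.
Qed.

(** The weights of the inner product for which [lower] is the adjoint of [raise]. *)
Definition om (x : site) : rat := \prod_(k < n | (k < x)%N) wgt k.
Definition omega S : rat := \prod_(x in S) om x.

Lemma wgt_gt0 i : 0 < wgt i.
Proof. by rewrite ltr0n muln_gt0 /= subn_gt0. Qed.

Lemma omega_gt0 S : 0 < omega S.
Proof. by apply: prodr_gt0 => x _; apply: prodr_gt0 => k _; apply: wgt_gt0. Qed.

Lemma om_hi i : om (hi i) = wgt i * om (lo i).
Proof.
rewrite /om (bigD1 i) /=; last by rewrite /bump /= add1n.
congr (_ * _); apply: eq_bigl => k; rewrite /bump /= add1n ltnS -val_eqE /=.
by rewrite ltn_neqAle andbC.
Qed.

Lemma omega_hop i S : up i S -> omega (hop i S) = wgt i * omega S.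
Proof.
case/andP=> lS hS; rewrite /omega.
rewrite (bigD1 (hi i)) ?mem_hop_hi //= om_hi [in RHS](bigD1 (lo i)) //= -mulrA.
congr (_ * (_ * _)); apply: eq_bigl => x.
have [->|xl] := eqVneq x (lo i).
  by rewrite mem_hop_lo (negbTE hS) /= andbF.
have [->|xh] := eqVneq x (hi i); first by rewrite (negbTE hS) andbF.
by rewrite mem_hop_other.
Qed.

Lemma raise_adjoint g h :
  \sum_S omega S * g S * raise h S = \sum_T omega T * h T * lower g T.
Proof.
under eq_bigr do rewrite mulr_sumr; rewrite exchange_big /=.
under [RHS]eq_bigr do rewrite mulr_sumr; rewrite [RHS]exchange_big /=.
apply: eq_bigr => i _; rewrite (reindex_inj (inv_inj (hopK i))) /=.
apply: eq_bigr => S _; rewrite dn_hop hopK; case: (boolP (up i S)) => uS.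
  by rewrite omega_hop //; ring.
by rewrite mul0r !mulr0 mul0r mulr0.
Qed.

(** If F g = 0, the commutator gives F E g = - wt g. Pairing this with g, the squared norm of E g
    plus the wt-weighted squared norm of g is zero; both are nonnegative, and the second is positive
    unless g = 0. *)
Lemma raise_inj g : (forall S, g S != 0 -> 0 < level_wgt S) ->
  (forall T, raise g T = 0) -> forall S, g S = 0.
Proof.
move=> gpos r0.
have l0 S : lower (raise g) S = 0.
  by rewrite /lower big1 // => i _; rewrite r0 mulr0.
have rl S : raise (lower g) S = - (level_wgt S * g S).
  by rewrite -commutator l0 sub0r opprK.
have := raise_adjoint g (lower g).
under eq_bigr do rewrite rl.
move/eqP; rewrite eq_sym -subr_eq0 -sumrB => /eqP sum0 S.
have termE T : omega T * lower g T * lower g T - omega T * g T * - (level_wgt T * g T) =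
    omega T * lower g T ^+ 2 + omega T * (level_wgt T * g T ^+ 2) by ring.
have sq T : 0 <= omega T * lower g T ^+ 2.
  by rewrite mulr_ge0 ?sqr_ge0 // ltW ?omega_gt0.
have pos T : g T != 0 -> 0 < omega T * (level_wgt T * g T ^+ 2).
  move=> gT; rewrite mulr_gt0 ?omega_gt0 // mulr_gt0 ?gpos //.
  by rewrite lt0r sqr_ge0 expf_eq0 /= gT.
have /eqP := sum0; rewrite psumr_eq0 => [|T _]; last first.
  rewrite termE addr_ge0 //; have [->|/pos/ltW //] := eqVneq (g T) 0.
  by rewrite expr0n !mulr0.
move/allP/(_ S); rewrite mem_index_enum => /(_ isT) /= /eqP.
by apply: contra_eq => gS; rewrite termE lt0r_neq0 // ltr_wpDl ?pos.
Qed.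

Definition level (m w : nat) : {set {set site}} :=
  [set S : {set site} | (#|S| == m) && (\sum_(x in S) (x : nat) == w)%N].

Lemma level_hop m w i T : dn i T -> hop i T \in level m w -> T \in level m w.+1.
Proof.
move=> dT; rewrite !inE => /andP[/eqP <- /eqP <-].
have hE : hop i T = tperm (lo i) (hi i) @: T.
  apply/setP=> x; rewrite inE; apply/idP/imsetP => [H|[y yT ->]]; last by rewrite tpermK.
  by exists (tperm (lo i) (hi i) x); rewrite ?tpermK.
rewrite {1}hE card_imset; last exact: perm_inj.
case/andP: dT => lT hT; rewrite eqxx /=.
rewrite (bigD1 (hi i)) //= [in X in _ == X](bigD1 (lo i)) ?mem_hop_lo //=.
rewrite /bump /= add1n addSn; apply/eqP; congr (_ + _).+1; apply: eq_bigl => x.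
have [->|xl] := eqVneq x (lo i); first by rewrite (negbTE lT) andbF.
have [->|xh] := eqVneq x (hi i); first by rewrite mem_hop_hi (negbTE lT) andbF.
by rewrite mem_hop_other.
Qed.

(** Below the middle the weight is positive, so [raise] is injective on functions supported on the
    level and its matrix has full row rank. *)
Lemma card_level_leq m w : (2 * w < m * n)%N -> (#|level m w| <= #|level m w.+1|)%N.
Proof.
move=> wm.
pose delta (S0 S : {set site}) : rat := (S == S0)%:R.
pose A : 'M[rat]_(#|level m w|, #|level m w.+1|) :=
  \matrix_(a, b) raise (delta (enum_val a)) (enum_val b).
suff : row_free A by rewrite /row_free => /eqP <-; apply: rank_leq_col.
apply: inj_row_free => v vA.
pose g S := \sum_a v 0 a * delta (enum_val a) S.
have g0 S : S \notin level m w -> g S = 0.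
  move=> SL; rewrite /g big1 // => a _; rewrite /delta.
  case: eqP => [SE|_]; last by rewrite mulr0.
  by move: SL; rewrite SE enum_valP.
have gv a : g (enum_val a) = v 0 a.
  rewrite /g (bigD1 a) //= /delta eqxx mulr1 big1 ?addr0 // => a' aa'.
  by rewrite (inj_eq enum_val_inj) eq_sym (negbTE aa') mulr0.
apply/rowP=> a; rewrite mxE -gv; apply: raise_inj => [S gS|T].
  have : S \in level m w by apply: contraNT gS => /g0 ->.
  rewrite inE level_wgtE => /andP[/eqP -> /eqP ->].
  by rewrite subr_gt0 ltr_nat mulnC [(n * m)%N]mulnC; move: wm; rewrite mulnC.
have [TL|TL] := boolP (T \in level m w.+1); last first.
  rewrite /raise big1 // => i _; case: (boolP (dn i T)) => dT; last by rewrite mul0r.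
  by rewrite g0 ?mulr0 //; apply: contra TL; apply: level_hop.
have := congr1 (fun M : 'rV_ _ => M 0 (enum_rank_in TL T)) vA.
rewrite !mxE => <-; rewrite /raise.
under eq_bigr do rewrite mulr_sumr; rewrite exchange_big /=.
apply: eq_bigr => b _; rewrite mxE enum_rankK_in // /raise mulr_sumr.
by apply: eq_bigr => i _; rewrite mulrCA.
Qed.

End LevelSets.

(** * Quantum numbers and positivity *)

Definition qn m : {poly int} := \sum_(i < m) 'X^i.
Definition qf m : {poly int} := \prod_(1 <= i < m.+1) qn i.

Lemma qnE m : (1 - 'X) * qn m = 1 - 'X^m.
Proof.
have := subrX1 ('X : {poly int}) m; rewrite /qn => e.
by rewrite -[LHS]opprK -mulNr !opprB -e opprB.
Qed.

Lemma coef_qn m i : (qn m)`_i = (i < m)%:R.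
Proof.
rewrite /qn coef_sum; case: ltnP => [im|mi].
  rewrite (bigD1 (Ordinal im)) //= coefXn eqxx big1 ?addr0 // => k.
  by rewrite -val_eqE /= coefXn eq_sym => /negbTE ->.
by rewrite big1 // => k _; rewrite coefXn; case: eqP => // e; have := ltn_ord k; lia.
Qed.

Lemma sub1X_neq0 : 1 - 'X != 0 :> {poly int}.
Proof. by rewrite -oppr_eq0 opprB -[1]/(1%:P) polyXsubC_eq0. Qed.

Lemma qn_neq0 m : (0 < m)%N -> qn m != 0.
Proof.
move=> m0; apply: contraTneq m0 => e; have := coef_qn m 0.
by rewrite e coef0; case: m {e}.
Qed.

Lemma qn0 : qn 0 = 0. Proof. by rewrite /qn big_ord0. Qed.
Lemma qn1 : qn 1 = 1. Proof. by rewrite /qn big_ord1 expr0. Qed.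

Lemma qnD a b : qn (a + b) = qn a + 'X^a * qn b.
Proof.
rewrite /qn big_split_ord /= mulr_sumr; congr (_ + _).
by apply: eq_bigr => i _; rewrite exprD.
Qed.

Lemma qnM a b : qn (a * b) = qn a * \sum_(i < b) 'X^(i * a).
Proof.
apply: (mulfI sub1X_neq0); rewrite mulrA !qnE exprM.
have := subrX1 ('X^a : {poly int}) b => e.
rewrite -[LHS]opprB e -mulNr opprB; congr (_ * _).
by apply: eq_bigr => i _; rewrite -exprM mulnC.
Qed.

Lemma qf0 : qf 0 = 1. Proof. by rewrite /qf big_geq. Qed.
Lemma qfS m : qf m.+1 = qn m.+1 * qf m.
Proof. by rewrite /qf big_nat_recr //= mulrC. Qed.

Lemma qf_neq0 m : qf m != 0.
Proof. by elim: m => [|m IHm]; rewrite ?qf0 ?oner_eq0 // qfS mulf_neq0 // qn_neq0. Qed.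

Fixpoint qb N m : {poly int} := match N, m with
  | _, 0 => 1
  | 0, _.+1 => 0
  | N'.+1, m'.+1 => qb N' m'.+1 + 'X^(N' - m') * qb N' m' end.

Lemma qbS N m : qb N.+1 m.+1 = qb N m.+1 + 'X^(N - m) * qb N m.
Proof. by []. Qed.

Lemma qb0 N : qb N 0 = 1. Proof. by case: N. Qed.

Lemma qb_small N m : (N < m)%N -> qb N m = 0.
Proof.
elim: N m => [|N IHN] [|m] //=; rewrite ltnS => Nm.
by rewrite !IHN ?mulr0 ?addr0 // ltnW.
Qed.

Lemma qb_fact N m : (m <= N)%N -> qb N m * (qf m * qf (N - m)) = qf N.
Proof.
elim: N m => [|N IHN] [|m] //.
- by rewrite qb0 qf0 !mul1r.
- by rewrite qb0 qf0 subn0 !mul1r.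
rewrite ltnS subSS => mN; rewrite qbS mulrDl.
have -> : 'X^(N - m) * qb N m * (qf m.+1 * qf (N - m)) = 'X^(N - m) * qn m.+1 * qf N.
  by rewrite -(IHN m mN) qfS; ring.
have -> : qb N m.+1 * (qf m.+1 * qf (N - m)) = qn (N - m) * qf N.
  move: mN; rewrite leq_eqVlt => /orP[/eqP ->|mN].
    by rewrite qb_small // subnn qn0 !mul0r.
  by rewrite -(IHN m.+1 mN) -(subnSK mN) [qf (_ - _).+1]qfS; ring.
by rewrite -mulrDl -qnD qfS; congr (qn _ * _); lia.
Qed.

Lemma size_qb N m : (m <= N)%N -> (size (qb N m) <= (m * (N - m)).+1)%N.
Proof.
elim: N m => [|N IHN] [|m] //; try by rewrite ?qb0 size_poly1.
rewrite ltnS subSS => mN; rewrite qbS (leq_trans (size_polyD _ _)) // geq_max.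
apply/andP; split.
  move: mN; rewrite leq_eqVlt => /orP[/eqP ->|mN].
    by rewrite qb_small // size_poly0.
  by apply: leq_trans (IHN m.+1 mN) _; rewrite ltnS leq_mul2l; lia.
rewrite mulrC size_mulXn; last first.
  apply/eqP=> e; have := qb_fact mN; rewrite e mul0r => /eqP.
  by rewrite eq_sym (negbTE (qf_neq0 N)).
by have := IHN m mN; nia.
Qed.

Lemma qbinomial_theorem N m :
  (\prod_(x < N) (1 + ('X^x)%:P * 'X) : {poly {poly int}})`_m = 'X^'C(m, 2) * qb N m.
Proof.
elim: N m => [|N IHN] m.
  by rewrite big_ord0 coef1; case: m => [|m]; rewrite ?mulr0 // bin0n /= expr0 mulr1.
rewrite big_ord_recr /= mulrDr mulr1 coefD IHN mulrA coefMX coefMC.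
case: m => [|m]; first by rewrite !qb0 addr0.
rewrite /= IHN mulrDr; congr (_ + _).
have [mN|Nm] := leqP m N; last by rewrite qb_small // !mulr0 mul0r.
rewrite binS bin1 -mulrA [qb _ _ * _]mulrC !mulrA -!exprD; congr ('X^_ * _); lia.
Qed.

(** The shift ['C(m, 2)] is the smallest sum of [m] distinct sites, 0 + 1 + ... + (m - 1). *)
Lemma coef_qb n m r : (qb n.+1 m)`_r = #|level n m (r + 'C(m, 2))|%:R.
Proof.
have := qbinomial_theorem n.+1 m; rewrite -(big_mkord xpredT (fun x => 1 + ('X^x)%:P * 'X)).
rewrite big_mkord; under eq_bigr do rewrite addrC.
rewrite bigA_distr coef_sum => /(congr1 (fun p : {poly int} => p`_(r + 'C(m, 2)))).
rewrite coefXnM ltnNge leq_addl /= addnK => <-; rewrite coef_sum.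
rewrite -sum1_card natr_sum [RHS]big_mkcond /=; apply: eq_big => [S|S _]; first by rewrite inE.
rewrite -big_mkcond /= big_split /= prodr_const -rmorph_prod /=.
rewrite coefMXn prodrXr inE.
case: ltngtP => [lt|gt|->] /=.
- by rewrite coef0.
- by rewrite coefC; case: eqP => [|_]; [lia | rewrite coef0].
- by rewrite subnn coefC eqxx coefXn eq_sym; case: eqP.
Qed.

Lemma card_level_rev n m w : (w <= m * n)%N -> #|level n m (m * n - w)| = #|level n m w|.
Proof.
move=> wmn; pose rv (S : {set 'I_n.+1}) := @rev_ord n.+1 @: S.
have rvK : involutive rv.
  by move=> S; rewrite /rv -imset_comp -[RHS]imset_id; apply: eq_imset => x; rewrite /= rev_ordK.
have sumR (S : {set 'I_n.+1}) :
    (\sum_(x in rv S) x + \sum_(x in S) x = #|S| * n)%N.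
  rewrite big_imset /=; last by move=> x y _ _; apply: rev_ord_inj.
  rewrite -big_split /= -sum_nat_const; apply: eq_bigr => x _ /=.
  by have := ltn_ord x; lia.
have cR (S : {set 'I_n.+1}) : #|rv S| = #|S| by rewrite card_imset //; apply: rev_ord_inj.
rewrite -[RHS](card_imset _ (inv_inj rvK)); apply: eq_card => S.
rewrite inE; apply/andP/imsetP => [[/eqP cS /eqP wS]|[T + ->]].
  exists (rv S); last by rewrite rvK.
  rewrite inE cR cS eqxx /=; have e := sumR S; rewrite wS cS in e.
  by rewrite -(eqn_add2r (m * n - w)) e subnKC.
rewrite inE => /andP[/eqP cT /eqP wT]; rewrite cR cT eqxx; split=> //.
by have e := sumR T; rewrite wT cT in e; rewrite -e addnK.
Qed.

(** Symmetric unimodal polynomials with centre [D / 2], presented as nonnegative combinations of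
    centred intervals; in this form products reduce to products of two intervals. *)
Inductive symunim D : {poly int} -> Prop :=
| SymUnim0 : symunim D 0
| SymUnimAdd i a c p : (i.*2 + a)%N = D -> 0 <= c -> symunim D p ->
    symunim D (c *: ('X^i * qn a.+1) + p).

Lemma symunimD D p q : symunim D p -> symunim D q -> symunim D (p + q).
Proof.
move=> Sp Sq; elim: Sp => [|i a c p' e c0 _ IH]; first by rewrite add0r.
by rewrite -addrA; constructor.
Qed.

Lemma symunimZ D c p : 0 <= c -> symunim D p -> symunim D (c *: p).
Proof.
move=> c0; elim=> [|i a c' p' e c'0 _ IH]; first by rewrite scaler0; constructor.
by rewrite scalerDr scalerA; constructor=> //; apply: mulr_ge0.
Qed.

Lemma symunim_atom i a : symunim (i.*2 + a) ('X^i * qn a.+1).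
Proof.
rewrite -[X in symunim _ X]addr0 -[X in symunim _ (X + _)]scale1r.
by constructor=> //; constructor.
Qed.

(* One step of the Clebsch-Gordan rule. *)
Lemma qn_mul a b : qn a.+1 * qn b.+1 = qn (a + b).+1 + 'X * (qn a * qn b).
Proof.
apply: (mulfI sub1X_neq0); apply: (mulfI sub1X_neq0).
have -> : (1 - 'X) * ((1 - 'X) * (qn a.+1 * qn b.+1)) =
    ((1 - 'X) * qn a.+1) * ((1 - 'X) * qn b.+1) by ring.
have -> : (1 - 'X) * ((1 - 'X) * (qn (a + b).+1 + 'X * (qn a * qn b))) =
    (1 - 'X) * ((1 - 'X) * qn (a + b).+1) + 'X * ((1 - 'X) * qn a) * ((1 - 'X) * qn b).
  by ring.
by rewrite !qnE !exprS exprD; ring.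
Qed.

Lemma symunim_atomM i a j b :
  symunim (i.*2 + a + (j.*2 + b)) ('X^i * qn a.+1 * ('X^j * qn b.+1)).
Proof.
elim: a i b => [|a IHa] i b.
  rewrite qn1 mulr1 mulrA -exprD addn0 addnA -doubleD; exact: symunim_atom.
case: b => [|b].
  rewrite qn1 mulr1 -mulrA [qn _ * _]mulrC mulrA -exprD addn0.
  rewrite addnAC -doubleD; exact: symunim_atom.
have -> : 'X^i * qn a.+2 * ('X^j * qn b.+2) =
    'X^(i + j) * qn (a.+1 + b.+1).+1 + 'X^(i.+1) * qn a.+1 * ('X^j * qn b.+1).
  rewrite exprD exprS.
  have -> : 'X^i * qn a.+2 * ('X^j * qn b.+2) = 'X^i * 'X^j * (qn a.+2 * qn b.+2) by ring.
  by rewrite qn_mul; ring.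
apply: symunimD; last first.
  have -> : (i.*2 + a.+1 + (j.*2 + b.+1) = i.+1.*2 + a + (j.*2 + b))%N by lia.
  exact: IHa.
have -> : (i.*2 + a.+1 + (j.*2 + b.+1) = (i + j).*2 + (a.+1 + b.+1))%N by lia.
exact: symunim_atom.
Qed.

Lemma symunimM D D' p q : symunim D p -> symunim D' q -> symunim (D + D') (p * q).
Proof.
move=> Sp Sq; elim: Sp => [|i a c p' e c0 _ IH]; first by rewrite mul0r; constructor.
rewrite mulrDl -scalerAl; apply: symunimD IH; apply: symunimZ => //.
elim: Sq => [|j b c' q' e' c'0 _ IH]; first by rewrite mulr0; constructor.
rewrite mulrDr -scalerAr; apply: symunimD IH; apply: symunimZ => //.
by rewrite -e -e'; apply: symunim_atomM.
Qed.

Lemma symunim_coef D (p : {poly int}) : (size p <= D.+1)%N ->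
  (forall i, (i <= D)%N -> p`_i = p`_(D - i)) -> 0 <= p`_0 ->
  (forall i, (i.*2 < D)%N -> p`_i <= p`_i.+1) -> symunim D p.
Proof.
move=> szp symp p0 incp.
(* The polynomial is a stack of centred intervals; the one that starts at [i] has the increment at
   [i] as its height. *)
pose a i : int := if i is k.+1 then p`_i - p`_k else p`_0.
have -> : p = \sum_(i < D./2.+1) a i *: ('X^i * qn (D - i.*2).+1).
  have sum_a k : \sum_(i < k.+1) a i = p`_k.
    elim: k => [|k IHk]; first by rewrite big_ord1.
    by rewrite big_ord_recr IHk /= addrC subrK.
  apply/polyP=> r; rewrite coef_sum.
  have [rD|Dr] := leqP r D; last first.
    rewrite nth_default ?(leq_trans szp) // big1 // => i _.
    rewrite coefZ coefXnM coef_qn; case: ifP => [|_]; first by rewrite mulr0.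
    by have := ltn_ord i => iD; case: ltnP; rewrite ?mulr0 //; lia.
  pose k := minn r (D - r).
  have -> : p`_r = p`_k.
    by rewrite /k minnE; case: (leqP r (D - r)) => h; [congr _`_ _ | rewrite symp //; congr _`_ _]; lia.
  have kD : (k.+1 <= D./2.+1)%N by rewrite /k; lia.
  rewrite -sum_a (big_ord_widen _ a kD) big_mkcond; apply: eq_bigr => i _.
  rewrite coefZ coefXnM coef_qn; have := ltn_ord i => iD; rewrite /k.
  case: ltnP => h1; case: ltnP => h2; try case: ltnP => h3; rewrite ?mulr0 ?mulr1 //; lia.
suff H k : (k <= D./2.+1)%N ->
    symunim D (\sum_(i < k) a i *: ('X^i * qn (D - i.*2).+1)) by apply: H.
elim: k => [|k IHk] kD; first by rewrite big_ord0; constructor.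
rewrite big_ord_recr /= addrC; constructor; [lia | | apply: IHk; exact: ltnW].
by case: k kD {IHk} => [|k] kD //=; rewrite subr_ge0 incp //; lia.
Qed.

Lemma symunim_qb N m : (m <= N)%N -> symunim (m * (N - m)) (qb N m).
Proof.
case: N => [|n] mN.
  by move: mN; rewrite leqn0 => /eqP ->; rewrite /= -qn1 -[qn 1]mul1r -(expr0 'X); apply: (symunim_atom 0 0).
have tri : ('C(m, 2).*2 + m = m * m)%N.
  by elim: (m) => // k IHk; rewrite binS bin1; lia.
have mn : (m * (n.+1 - m) + 'C(m, 2).*2 = m * n)%N.
  have e : (m * (n.+1 - m) + m * m = m * n.+1)%N by rewrite -mulnDr subnK.
  by move: e; rewrite mulnS; lia.
apply: symunim_coef; first exact: size_qb.
- move=> i iD; rewrite !coef_qb -(@card_level_rev n m (i + 'C(m, 2))); last by lia.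
  by congr (#|level n m _|)%:R; lia.
- by rewrite coef_qb.
- by move=> i iD; rewrite !coef_qb ler_nat addSn card_level_leq //; lia.
Qed.

Lemma qb_symunim1 : symunim 0 1.
Proof. by rewrite -qn1 -[qn 1]mul1r -(expr0 'X); apply: (symunim_atom 0 0). Qed.

(** * Nonnegativity of a quotient by a quantum integer *)

Section Positivity.
Variables (D e M : nat) (p Y B : {poly int}).
Hypotheses (Sp : symunim D p) (Y_ge0 : forall i, 0 <= Y`_i)
           (Ye : forall i, (e < i)%N -> Y`_i = 0) (eM : (e < M)%N).
Hypothesis BE : B * qn M = p * Y.
Let U := (1 - 'X) * p * Y.

Lemma coefU_atom i a r :
  ((1 - 'X) * ('X^i * qn a.+1) * Y)`_r =
  (if (r < i)%N then 0 else Y`_(r - i)) -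
  (if (r < i + a.+1)%N then 0 else Y`_(r - (i + a.+1))).
Proof.
have -> : (1 - 'X) * ('X^i * qn a.+1) * Y = 'X^i * Y - 'X^(i + a.+1) * Y.
  by rewrite mulrCA qnE exprD; ring.
by rewrite coefB !coefXnM.
Qed.

Lemma coefU_low r : (r.*2 <= D)%N -> 0 <= U`_r.
Proof.
rewrite /U => rD; elim: Sp => [|i a c p' ED c0 _ IH].
  by rewrite mulr0 mul0r coef0.
rewrite mulrDr mulrDl coefD addr_ge0 // -scalerAr -scalerAl coefZ mulr_ge0 //.
rewrite coefU_atom (_ : (r < i + a.+1)%N) ?subr0; last by lia.
by case: ifP.
Qed.

Lemma coefU_high r : (D + e.*2 < r.*2)%N -> U`_r <= 0.
Proof.
rewrite /U => rD; elim: Sp => [|i a c p' ED c0 _ IH].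
  by rewrite mulr0 mul0r coef0.
rewrite mulrDr mulrDl coefD -[0]addr0 lerD // -scalerAr -scalerAl coefZ mulr_ge0_le0 //.
rewrite coefU_atom ltnNge (_ : (i <= r)%N) /=; last by lia.
rewrite Ye; last by lia.
by rewrite sub0r oppr_le0; case: ifP.
Qed.

(** [B * (1 - 'X^M) = U]. Up to the middle, B_k = U_k + B_(k-M) builds [B] from below; beyond it,
    B_l = B_(l+M) - U_(l+M) builds it from above, where [e < M] puts the index l + M in the range of
    [coefU_high]. *)
Lemma quotient_ge0 i : 0 <= B`_i.
Proof.
have BU : B = U + 'X^M * B.
  have : B * (1 - 'X^M) = U by rewrite -qnE mulrCA BE /U; ring.
  by move=> <-; ring.
have rec k : B`_k = U`_k + (if (k < M)%N then 0 else B`_(k - M)).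
  by rewrite {1}BU coefD coefXnM.
have [iD|Di] := leqP i.*2 D.
  elim: {i}_.+1 {-2}i (ltnSn i) iD => // k IHk i ik iD.
  rewrite rec addr_ge0 ?coefU_low //; case: ltnP => // Mi.
  by apply: IHk; lia.
have [k] : exists k, (size B <= i + k * M)%N.
  by exists (size B); rewrite (leq_trans _ (leq_addl _ _)) // leq_pmulr //; case: (M) eM.
elim: k i Di => [|k IHk] l Dl lB.
  by rewrite mul0n addn0 in lB; rewrite nth_default.
have [lS|] := leqP (size B) l; first by rewrite nth_default.
move=> lS.
have -> : B`_l = B`_(l + M) - U`_(l + M).
  by rewrite (rec (l + M)%N) ltnNge leq_addl /= addnK addrC addKr.
rewrite addr_ge0 //; first by apply: IHk; [lia | move: lB; rewrite mulSn; lia].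
by rewrite oppr_ge0 coefU_high //; lia.
Qed.

End Positivity.

Fixpoint qmult (s : seq nat) : {poly int} :=
  if s is x :: s' then qb (x + sumn s') x * qmult s' else 1.

Lemma qmult_fact s : qmult s * \prod_(x <- s) qf x = qf (sumn s).
Proof.
elim: s => [|x s IHs] /=; first by rewrite big_nil qf0 mulr1.
rewrite big_cons -(@qb_fact (x + sumn s) x) ?leq_addr // addKn -IHs; ring.
Qed.

Lemma symunim_qmult s : exists D, symunim D (qmult s).
Proof.
elim: s => [|x s [D IHs]] /=; first by exists 0%N; apply: qb_symunim1.
by exists (x * (x + sumn s - x) + D)%N; apply: symunimM IHs; apply/symunim_qb/leq_addr.
Qed.

Section Ideal.
Variable I : {poly int} -> Prop.
Hypotheses (ID : forall p q, I p -> I q -> I (p + q)) (IM : forall p q, I q -> I (p * q)).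

(** Euclid's algorithm, with [qn b = qn (b - a) + 'X^(b - a) * qn a] as the subtraction step. *)
Lemma ideal_qn_gcd a b : I (qn a) -> I (qn b) -> I (qn (gcdn a b)).
Proof.
elim: {a b}(a + b)%N.+1 {-2}a {-2}b (ltnSn (a + b)) => // m IHm a b lt.
wlog ab : a b lt / (a <= b)%N.
  move=> H Ia Ib; have [ab|/ltnW ba] := leqP a b; first exact: H.
  by rewrite gcdnC; apply: H => //; rewrite addnC.
case: a ab lt => [|a] ab lt Ia Ib; first by rewrite gcd0n.
have bE : b = (b - a.+1 + a.+1)%N by rewrite subnK.
rewrite bE gcdnDr; apply: IHm => //; first by move: lt; lia.
have -> : qn (b - a.+1) = qn b + - 'X^(b - a.+1) * qn a.+1.
  by rewrite [in qn b]bE qnD; ring.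
by apply: ID => //; apply: IM.
Qed.

Lemma ideal_qn_gcds s : I 0 -> (forall x, x \in s -> I (qn x)) -> I (qn (foldr gcdn 0%N s)).
Proof.
move=> I0; elim: s => [|x s IHs] Is /=; first by rewrite qn0.
apply: ideal_qn_gcd; first by apply: Is; rewrite mem_head.
by apply: IHs => y ys; apply: Is; rewrite inE ys orbT.
Qed.
End Ideal.

Lemma dvdn_gcds s x : x \in s -> (foldr gcdn 0%N s %| x)%N.
Proof.
elim: s => //= y s IHs; rewrite inE => /orP[/eqP ->|/IHs]; first exact: dvdn_gcdl.
by apply: dvdn_trans; apply: dvdn_gcdr.
Qed.

(** Lowering the part [x] by one in the multinomial trades the factor [qn x] for [qn (sumn s)]. *)
Lemma qn_mul_qmult s x : x \in s -> exists q, qn x * qmult s = q * qn (sumn s).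
Proof.
case: x => [|x] xs; first by exists 0; rewrite qn0 !mul0r.
exists (qmult (x :: rem x.+1 s)).
pose F := qf x * \prod_(y <- rem x.+1 s) qf y.
have F0 : F != 0 by rewrite mulf_neq0 ?qf_neq0 // prodf_seq_neq0; apply/allP => y _; rewrite qf_neq0.
have prodE : \prod_(y <- s) qf y = qn x.+1 * F.
  by rewrite (perm_big _ (perm_to_rem xs)) big_cons qfS /F mulrA.
have sumE : sumn s = (x + sumn (rem x.+1 s)).+1.
  by rewrite (perm_sumn (perm_to_rem xs)).
apply: (mulIf F0).
have := qmult_fact s; rewrite prodE sumE qfS => e.
have e' := qmult_fact (x :: rem x.+1 s); rewrite big_cons -/F /= in e'.
have -> : qn x.+1 * qmult s * F = qmult s * (qn x.+1 * F) by ring.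
by rewrite e -e' /=; ring.
Qed.

Lemma coef_mul_ge0 (p q : {poly int}) : (forall i, 0 <= p`_i) -> (forall i, 0 <= q`_i) ->
  forall i, 0 <= (p * q)`_i.
Proof. by move=> p0 q0 i; rewrite coefM; apply: sumr_ge0 => k _; apply: mulr_ge0. Qed.

(** The q-Catalan number as a difference of two q-binomials is visibly a polynomial; its product
    with [qn j.+1] is the central q-binomial, so [quotient_ge0] with [Y = 1] gives the sign. *)
Lemma qcatalan j : exists C : {poly int}, (forall i, 0 <= C`_i) /\
  C * (qf j.+1 * qf j) = qf j.*2.
Proof.
pose C := qb j.*2 j - 'X * qb j.*2 j.+1.
have jj : (j <= j.*2)%N by rewrite -addnn leq_addr.
have b1 := qb_fact jj.
rewrite (_ : (j.*2 - j)%N = j) in b1; last by lia.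
have f0 : qf j * qf j != 0 by rewrite mulf_neq0 ?qf_neq0.
have b2 : qb j.*2 j.+1 * (qf j.+1 * qf j) = qf j.*2 * qn j.
  case: (j) => [|i]; first by rewrite qn0 mulr0 qb_small // mul0r.
  rewrite -(@qb_fact i.+1.*2 i.+2); last by rewrite doubleS; lia.
  rewrite (_ : (i.+1.*2 - i.+2)%N = i); last by lia.
  by rewrite [qf i.+1]qfS; ring.
have CE : C * qn j.+1 = qb j.*2 j * 1.
  apply: (mulIf f0); rewrite mulr1 b1 mulrBl mulrBl.
  have -> : qb j.*2 j * qn j.+1 * (qf j * qf j) = qf j.*2 * qn j.+1 by rewrite -b1; ring.
  have -> : 'X * qb j.*2 j.+1 * qn j.+1 * (qf j * qf j) = qf j.*2 * ('X * qn j).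
    by rewrite [RHS]mulrCA -b2 qfS; ring.
  by rewrite -mulrBr -[j.+1]add1n qnD qn1 expr1 addrK mulr1.
exists C; split.
  have one0 i : 0 <= (1 : {poly int})`_i by rewrite coef1.
  apply: (quotient_ge0 (symunim_qb jj) one0 (e := 0) (M := j.+1) _ isT CE).
  by move=> i; rewrite coef1; case: i.
by rewrite qfS -mulrA mulrA CE mulr1 b1.
Qed.

(** * A positive polynomial for rooted plane trees with buds *)

Section RootedTrees.
Variables (K b : nat) (nn : nat -> nat).
Notation V := (\sum_(1 <= k < K.+1) nn k)%N.
Notation L := (\sum_(1 <= k < K.+1) nn k * k)%N.
Hypothesis planar : (L + 2 = b + V.*2)%N.
Notation Den := (qf b * \prod_(1 <= k < K.+1) qf (nn k)).

(** The share of the trees whose root vertex has degree [k]. The quotient is [qmult s * Y] divided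
    by [qn (sumn s)], where [s] lists the buds and the other vertices by degree, and [Y] stands for
    the choice of a corner at the root. *)
Lemma rooted_at k : (1 <= k < K.+1)%N ->
  exists B : {poly int}, (forall i, 0 <= B`_i) /\ B * Den = qn (nn k * k) * qf (b + V - 2).
Proof.
move=> kK; have [nk|nk] := posnP (nn k).
  by exists 0; split=> [i|]; rewrite ?coef0 // nk mul0n qn0 !mul0r.
pose m := minus_one nn k.
have kI : k \in index_iota 1 K.+1 by rewrite mem_index_iota.
have split_sum F : (F k + \sum_(1 <= l < K.+1) m l * F l = \sum_(1 <= l < K.+1) nn l * F l)%N.
  rewrite !(bigD1_seq k) ?iota_uniq //= addnA; congr (_ + _)%N.
    by rewrite /m /minus_one eqxx -[X in (X + _)%N]mul1n -mulnDl; congr (_ * _)%N; lia.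
  by apply: eq_bigr => l /negbTE lk; rewrite /m /minus_one lk subn0.
have sum1 : (1 + \sum_(1 <= l < K.+1) m l = V)%N.
  have := split_sum (fun=> 1%N).
  rewrite (eq_bigr m) => [->|l _]; last by rewrite muln1.
  by apply: eq_bigr => l _; rewrite muln1.
have sumk := split_sum id.
pose s := b :: [seq m l | l <- index_iota 1 K.+1].
have sE : sumn s = (b + V).-1.
  by rewrite /= sumnE big_map; move: sum1; lia.
pose Y : {poly int} := \sum_(i < k) 'X^(i * nn k).
have YE : qn (nn k * k) = qn (nn k) * Y by rewrite qnM.
(* The multipliers that make [qmult s] divisible by [qn (sumn s)] form an ideal; it contains [qn] of
   every part, hence of their gcd [g]. The aim is to put [Y] in it. *)
pose I (p : {poly int}) := exists q, p * qmult s = q * qn (sumn s).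
have ID p q : I p -> I q -> I (p + q).
  by move=> [u pu] [v qv]; exists (u + v); rewrite mulrDl pu qv mulrDl.
have IM p q : I q -> I (p * q).
  by move=> [v qv]; exists (p * v); rewrite -mulrA qv mulrA.
pose g := foldr gcdn 0%N s.
have Ig : I (qn g).
  by apply: ideal_qn_gcds => // [|x /qn_mul_qmult //]; exists 0; rewrite !mul0r.
have gm l : (1 <= l < K.+1)%N -> (g %| m l)%N.
  by move=> lK; apply: dvdn_gcds; rewrite inE map_f ?orbT // mem_index_iota.
have gb : (g %| b)%N by apply: dvdn_gcds; rewrite mem_head.
(* Euler's relation without the root vertex: [k] plus a multiple of [g] equals a multiple of [g]. *)
have gk : (g %| k)%N.
  have gS F : (g %| \sum_(1 <= l < K.+1) m l * F l)%N.
    by rewrite big_nat; apply: dvdn_sum => l lK; rewrite dvdn_mulr // gm.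
  have e : (k + \sum_(1 <= l < K.+1) m l * l = b + \sum_(1 <= l < K.+1) m l * 2)%N.
    by rewrite -big_distrl /=; move: sumk sum1 planar; lia.
  by have := dvdn_addl k (gS id); rewrite e dvdn_addr // gS => <-.
have cgn : coprime g (nn k).
  have := gm k kK; rewrite /m /minus_one eqxx => gk1.
  rewrite /coprime -dvdn1 -(@dvdn_addr (nn k - 1)); last first.
    exact: dvdn_trans (dvdn_gcdl _ _) gk1.
  by rewrite subnK ?dvdn_gcdr.
(* [g] divides [nn k - 1], so it is coprime to [nn k]; this is Bezout's identity for their quantum
   integers. *)
have [u [v uv]] : exists u v, 1 = u * qn g + v * qn (nn k).
  rewrite -qn1 -(eqP cgn).
  apply: (@ideal_qn_gcd (fun p => exists u v, p = u * qn g + v * qn (nn k))).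
  - move=> p q [u [v ->]] [u' [v' ->]]; exists (u + u'), (v + v'); ring.
  - move=> p q [u [v ->]]; exists (p * u), (p * v); ring.
  - by exists 1, 0; ring.
  - by exists 0, 1; ring.
have IY : I Y.
  have /dvdnP[h hE] : (g %| nn k * k)%N by rewrite dvdn_mull.
  have [W WE] : exists W, qn (nn k * k) = W * qn g.
    by rewrite hE mulnC qnM; eexists; rewrite mulrC.
  have -> : Y = (u * Y + v * W) * qn g.
    by rewrite -[LHS]mul1r uv mulrDl mulrDl -!mulrA -WE YE; ring.
  exact: IM.
have [B BE] := IY; exists B; split.
  have [D SD] := symunim_qmult s.
  apply: (@quotient_ge0 D (k.-1 * nn k) (sumn s) (qmult s) Y B SD).
  - by move=> i; rewrite coef_sum; apply: sumr_ge0 => l _; rewrite coefXn.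
  - move=> i ki; rewrite coef_sum big1 // => l _; rewrite coefXn.
    case: eqP => // iE; move: ki; rewrite iE ltn_mul2r => /andP[_].
    by have := ltn_ord l; lia.
  (* Degree of [Y]: [k.-1 * nn k <= L - V = b + V - 2], which is less than [sumn s = b + V - 1]. *)
  - rewrite sE.
    have le : (k.-1 * nn k <= \sum_(1 <= l < K.+1) l.-1 * nn l)%N.
      by rewrite (bigD1_seq k) ?iota_uniq //= leq_addr.
    have eL : (L = \sum_(1 <= l < K.+1) l.-1 * nn l + V)%N.
      rewrite -big_split; apply: eq_big_nat => l /andP[l0 _] /=.
      by rewrite mulnC -mulSnr prednK.
    by move: le sum1 planar; rewrite eL; lia.
  - by rewrite -BE mulrC.
have prodE : Den = qn (nn k) * \prod_(x <- s) qf x.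
  rewrite big_cons big_map !(bigD1_seq k) ?iota_uniq //=.
  rewrite [in RHS](eq_bigr (fun l => qf (nn l))) => [|l /negbTE lk]; last by rewrite /m /minus_one lk subn0.
  rewrite /m /minus_one eqxx subn1 -[in LHS](prednK nk) qfS (prednK nk); ring.
have M0 : (0 < sumn s)%N by rewrite sE; move: sum1 planar sumk nk; lia.
apply: (mulfI (qn_neq0 M0)).
have -> : qn (sumn s) * (B * Den) = (B * qn (sumn s)) * Den by ring.
rewrite -BE prodE YE.
have -> : Y * qmult s * (qn (nn k) * \prod_(x <- s) qf x) =
  qn (nn k) * Y * (qmult s * \prod_(x <- s) qf x) by ring.
rewrite qmult_fact -{1}(prednK M0) qfS (prednK M0).
by rewrite (_ : (sumn s).-1 = b + V - 2)%N; [ring | rewrite sE; lia].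
Qed.

(** [qn L] is split along the degrees by [qn (x + y) = qn x + 'X^x * qn y], so the shares of the
    root degrees add up with nonnegative shifts. *)
Lemma rooted_trees : exists A : {poly int}, (forall i, 0 <= A`_i) /\
  A * Den = qn L * qf (b + V - 2).
Proof.
suff H r : {subset r <= index_iota 1 K.+1} -> exists A : {poly int},
  (forall i, 0 <= A`_i) /\ A * Den = qn (\sum_(k <- r) nn k * k) * qf (b + V - 2) by apply: H.
elim: r => [|k r IHr] sub.
  by exists 0; split=> [i|]; rewrite ?coef0 // big_nil qn0 !mul0r.
have [|A [A0 AE]] := IHr; first by move=> x xr; apply: sub; rewrite inE xr orbT.
have [|B [B0 BE]] := @rooted_at k; first by rewrite -mem_index_iota sub ?mem_head.
exists (B + 'X^(nn k * k) * A); split.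
  by move=> i; rewrite coefD coefXnM addr_ge0 //; case: ifP.
by rewrite big_cons qnD mulrDl -mulrA AE BE; ring.
Qed.

End RootedTrees.

Lemma sieving_polynomial K j nn :
  (\sum_(1 <= k < K.+1) nn k * k + 2 = j.*2 + (\sum_(1 <= k < K.+1) nn k).*2)%N ->
  exists P : {poly int}, (forall i, 0 <= P`_i) /\
    P * (qf j.+1 * qf j * \prod_(1 <= k < K.+1) qf (nn k)) =
    qn (\sum_(1 <= k < K.+1) nn k * k) * qf (j.*2 + \sum_(1 <= k < K.+1) nn k - 2).
Proof.
move=> /rooted_trees[A [A0 AE]]; have [C [C0 CE]] := qcatalan j.
exists (C * A); split; first exact: coef_mul_ge0.
apply: (mulfI (qf_neq0 j.*2)).
have -> : qf j.*2 * (C * A * (qf j.+1 * qf j * \prod_(1 <= k < K.+1) qf (nn k))) =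
  (C * (qf j.+1 * qf j)) * (A * (qf j.*2 * \prod_(1 <= k < K.+1) qf (nn k))) by ring.
by rewrite CE AE.
Qed.

(** * Evaluation at roots of unity *)

Section Evaluation.
Variables (p : nat) (z : algC).
Hypotheses (p0 : (0 < p)%N) (zp : p.-primitive_root z).

Definition ev (f : {poly int}) : algC := (map_poly intr f).[z].

Lemma evM f g : ev (f * g) = ev f * ev g.
Proof. by rewrite /ev rmorphM hornerM. Qed.

Lemma ev1 : ev 1 = 1. Proof. by rewrite /ev rmorph1 hornerC. Qed.

Lemma evX f k : ev (f ^+ k) = ev f ^+ k.
Proof. by rewrite /ev rmorphXn horner_exp. Qed.

Lemma ev_sumX (I : finType) (F : I -> nat) : ev (\sum_i 'X^(F i)) = \sum_i z ^+ F i.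
Proof.
rewrite /ev rmorph_sum horner_sum; apply: eq_bigr => i _.
by rewrite rmorphXn /= map_polyX hornerXn.
Qed.

Lemma ev_qnE m : (1 - z) * ev (qn m) = 1 - z ^+ m.
Proof.
have := congr1 ev (qnE m); rewrite evM.
by rewrite /ev !rmorphB /= !rmorph1 !rmorphXn /= !map_polyX !hornerD !hornerN !hornerC hornerX hornerXn.
Qed.

(** [qn i] freed from its factor [qn p], so that its value at [z] is not zero for [i > 0]. *)
Definition lq i : {poly int} :=
  if (p %| i)%N then \sum_(l < i %/ p) 'X^(l * p) else qn i.

Lemma qn_lq i : qn i = qn p ^+ (p %| i)%N * lq i.
Proof.
rewrite /lq; case: ifP => [pi|_]; last by rewrite mul1r.
by rewrite -{1}(divnK pi) mulnC qnM.
Qed.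

Definition lqf m : {poly int} := \prod_(1 <= i < m.+1) lq i.

Lemma lqfS m : lqf m.+1 = lqf m * lq m.+1.
Proof. by rewrite /lqf big_nat_recr. Qed.

Lemma qf_lqf m : qf m = qn p ^+ (m %/ p) * lqf m.
Proof.
elim: m => [|m IHm]; first by rewrite qf0 div0n /lqf big_geq // mulr1.
by rewrite qfS lqfS IHm qn_lq divnS // exprD; ring.
Qed.

Lemma zX_mod m : z ^+ m = z ^+ (m %% p). Proof. by rewrite (prim_expr_mod zp). Qed.

Lemma ev_lq i : ev (lq i) = if (p %| i)%N then (i %/ p)%:R else ev (qn (i %% p)).
Proof.
rewrite /lq; case: ifP => [pi|npi].
  rewrite ev_sumX (eq_bigr (fun=> 1)) ?sumr_const ?card_ord // => l _.
  by rewrite mulnC exprM (prim_expr_order zp) expr1n.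
have z1 : 1 - z != 0.
  rewrite subr_eq0 eq_sym; apply/negP=> /eqP z1.
  have := prim_order_dvd zp 1; rewrite expr1 z1 eqxx dvdn1 => /eqP p1.
  by rewrite p1 dvd1n in npi.
by apply: (mulfI z1); rewrite !ev_qnE zX_mod.
Qed.

Notation E := (ev (qf p.-1)).

Lemma ev_lqf m : ev (lqf m) = (m %/ p)`!%:R * E ^+ (m %/ p) * ev (qf (m %% p)).
Proof.
elim: m => [|m IHm].
  by rewrite /lqf big_geq // div0n mod0n qf0 ev1 fact0 expr0 !mulr1.
rewrite lqfS evM IHm ev_lq divnS // modnS; case: ifP => [pm|npm].
  have -> : (m %% p)%N = p.-1.
    have := modnS m p; rewrite pm => _; move: pm; rewrite /dvdn -addn1 -modnDml.
    have := ltn_pmod m p0; set r := (m %% p)%N => rp; rewrite leq_eqVlt in rp.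
    case/orP: rp => [/eqP e _|rp]; first by rewrite -e.
    by rewrite addn1 modn_small // => /eqP.
  by rewrite pm /= !add1n factS exprS qf0 ev1 natrM; ring.
by rewrite npm /= add0n qfS evM; ring.
Qed.

Lemma ev_qf_neq0 v : (v < p)%N -> ev (qf v) != 0.
Proof.
elim: v => [|v IHv] vp; first by rewrite qf0 ev1 oner_eq0.
rewrite qfS evM mulf_neq0 ?IHv 1?ltnW //; apply/negP=> /eqP e.
have := ev_qnE v.+1; rewrite e mulr0 => /eqP; rewrite eq_sym subr_eq0 eq_sym => /eqP.
by move/eqP; rewrite -(prim_order_dvd zp) => /dvdn_leq; lia.
Qed.

Lemma ev_lqf_neq0 m : ev (lqf m) != 0.
Proof.
rewrite ev_lqf !mulf_neq0 ?expf_neq0 ?ev_qf_neq0 ?ltn_pmod ?prednK //.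
by rewrite pnatr_eq0 -lt0n fact_gt0.
Qed.

Section Ratio.
Variables (P : {poly int}) (s : seq nat) (d m : nat).
Hypothesis PE : P * \prod_(x <- s) qf x = qn (p * d) * qf m.
Let W : {poly int} := \sum_(l < d) 'X^(l * p).

Lemma ratio_lqf : qn p ^+ (\sum_(x <- s) x %/ p)%N * (P * \prod_(x <- s) lqf x) =
  qn p ^+ (m %/ p).+1 * (W * lqf m).
Proof.
have e : \prod_(x <- s) qf x = qn p ^+ (\sum_(x <- s) x %/ p)%N * \prod_(x <- s) lqf x.
  by rewrite -prodrXr -big_split; apply: eq_bigr => x _; apply: qf_lqf.
by rewrite mulrCA -e PE qf_lqf qnM -/W exprS; ring.
Qed.

Lemma ev_W : ev W = d%:R.
Proof.
rewrite ev_sumX (eq_bigr (fun=> 1)) ?sumr_const ?card_ord // => l _.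
by rewrite mulnC exprM (prim_expr_order zp) expr1n.
Qed.

Lemma ev_prod_lqf : ev (\prod_(x <- s) lqf x) = \prod_(x <- s) ev (lqf x).
Proof. by rewrite /ev rmorph_prod horner_prod. Qed.

(** After cancelling powers of [qn p], one is left in the numerator, and it vanishes at [z]. *)
Lemma ev_ratio_eq0 : (1 < p)%N -> (\sum_(x <- s) x %/ p < (m %/ p).+1)%N -> ev P = 0.
Proof.
move=> p1 lt; have := ratio_lqf; rewrite -(subnK (ltnW lt)) addnC exprD -mulrA.
move/(mulfI (expf_neq0 _ (qn_neq0 p0)))/(congr1 ev); rewrite !evM evX.
have -> : ev (qn p) = 0.
  have z1 : 1 - z != 0.
    rewrite subr_eq0 eq_sym; apply/negP=> /eqP z1.
    have := prim_order_dvd zp 1; rewrite expr1 z1 eqxx dvdn1 => /eqP e.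
    by rewrite e in p1.
  by apply: (mulfI z1); rewrite ev_qnE (prim_expr_order zp) subrr mulr0.
rewrite expr0n subn_eq0 leqNgt lt mul0r => /eqP.
rewrite mulf_eq0 ev_prod_lqf => /orP[/eqP //|].
by rewrite prodf_seq_eq0 => /hasP[x _] /=; rewrite (negbTE (ev_lqf_neq0 x)).
Qed.

(** The powers of [qn p] cancel. Residues at most 1 contribute 1; the numerator's residue [p.-1]
    contributes the one [E] that balances the powers of [E], and for [p = 2] all these values are
    1. *)
Lemma ev_ratio : (\sum_(x <- s) x %/ p = (m %/ p).+1)%N ->
  {in s, forall x, (x %% p <= 1)%N} -> (m %% p)%N = p.-1 \/ p = 2%N ->
  ev P * (\prod_(x <- s) (x %/ p)`!)%N%:R = (d * (m %/ p)`!)%N%:R.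
Proof.
move=> sumE s1 mp; have := ratio_lqf; rewrite sumE.
move/(mulfI (expf_neq0 _ (qn_neq0 p0)))/(congr1 ev); rewrite !evM ev_W ev_prod_lqf ev_lqf.
have qf1 v : (v <= 1)%N -> ev (qf v) = 1.
  by case: v => [|[|v]] // _; rewrite ?qfS qf0 ?qn1 ?mulr1 ev1.
rewrite (eq_big_seq (fun x => (x %/ p)`!%:R * E ^+ (x %/ p))); last first.
  by move=> x xs; rewrite ev_lqf [ev (qf (x %% p))]qf1 ?mulr1 // s1.
rewrite big_split /= prodrXr sumE -natr_prod.
have E0 : E != 0 by apply: ev_qf_neq0; rewrite prednK.
have -> : ev (qf (m %% p)) = E.
  case: mp => [-> //|p2]; rewrite p2 [RHS]qf1 // qf1 //.
  by rewrite -ltnS; apply: ltn_pmod.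
move=> e; apply: (mulIf (expf_neq0 (m %/ p).+1 E0)).
by rewrite -mulrA e natrM exprS; ring.
Qed.

End Ratio.
End Evaluation.

Lemma ev_ratio1 (P : {poly int}) (s : seq nat) (l m : nat) :
  P * \prod_(x <- s) qf x = qn l * qf m ->
  ev 1 P * (\prod_(x <- s) x`!)%N%:R = (l * m`!)%N%:R.
Proof.
move=> /(congr1 (ev 1)); rewrite !evM.
have evq k : ev 1 (qn k) = k%:R.
  by rewrite ev_sumX (eq_bigr (fun=> 1)) ?sumr_const ?card_ord // => i _; rewrite expr1n.
have evf k : ev 1 (qf k) = k`!%:R.
  by elim: k => [|k IHk]; rewrite ?qf0 ?ev1 // qfS evM evq IHk -natrM factS.
have -> : ev 1 (\prod_(x <- s) qf x) = (\prod_(x <- s) x`!)%N%:R.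
  by rewrite /ev rmorph_prod horner_prod natr_prod; apply: eq_bigr => x _; apply: evf.
by rewrite evq evf natrM.
Qed.

Local Close Scope ring_scope.

(** * Counting invariant pairs *)

Section Pairs.
Variables (L K j : nat) (nn : nat -> nat).
Hypothesis L0 : 0 < L.
Hypothesis nnK : forall k, K < k -> nn k = 0.
Hypothesis sumL : \sum_(1 <= k < K.+1) nn k * k = L.
Hypothesis sumV : L + 2 = j.*2 + (\sum_(1 <= k < K.+1) nn k).*2.
Notation c := (cyc L).
Notation V := (\sum_(1 <= k < K.+1) nn k).
Notation trees := (profile_set L j.*2 nn).

Definition chords d (t : {perm 'I_L}) := [set s : {perm 'I_L} |
  [&& ncinv s, rotinv d s & moved s == [set x | t x == x]]].

Section Chords.
Variables (d p b' : nat) (t : {perm 'I_L}).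
Hypotheses (tP : t \in trees d) (p0 : 0 < p) (Lpd : L = p * d) (jpb : j.*2 = p * b').
Notation C := [set x | t x == x].

Lemma card_C : #|C| = j.*2.
Proof. by have := tP; rewrite inE => /and3P[_ _ /asboolP[]]. Qed.

Lemma C_rot x : ((c ^+ d)%g x \in C) = (x \in C).
Proof.
have := tP; rewrite inE => /and3P[_ /rotinvP tinv _].
by rewrite !inE tinv (inj_eq perm_inj).
Qed.

Lemma chords0 : j = 0 -> #|chords d t| = 1.
Proof.
move=> j0; have C0 : C = set0 by apply/eqP; rewrite -cards_eq0 card_C j0.
apply/eqP/cards1P; exists 1%g; apply/setP=> s; rewrite !inE C0.
apply/and3P/eqP => [[_ _ /eqP m0]|->].
  apply/permP=> x; rewrite perm1; apply/eqP; rewrite -[_ == _]negbK.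
  by have := in_set0 x; rewrite -m0 inE => ->.
split; last by apply/eqP/setP=> x; rewrite !inE perm1 eqxx.
  apply/ncinvP; split=> [x|x y]; rewrite !perm1 //; lia.
by apply/rotinvP=> x; rewrite !perm1.
Qed.

(** The corners fixed by [t] form a circle of their own, on which a turn by [d] acts as a turn by
    [b']. *)
Lemma chordsE : 0 < j -> #|chords d t| = #|matchings #|C| b'|.
Proof.
move=> j0; have /card_gt0P[x1 x1C] : 0 < #|C| by rewrite card_C; lia.
by rewrite -(card_moved_rotinv L0 p0 Lpd _ x1C C_rot) // card_C.
Qed.

Lemma C_gt0 : 0 < j -> 0 < #|C|. Proof. by rewrite card_C; lia. Qed.

Lemma card_chords1 : p = 1 -> j.+1 * #|chords d t| = 'C(j.*2, j).
Proof.
move=> p1; have [j0|j0] := posnP j; first by rewrite chords0 // j0.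
rewrite chordsE // -[b']mul1n -[X in X * b']p1 -jpb -[X in matchings _ X]card_C.
rewrite (card_matchings1 (C_gt0 j0) card_C).
by have := @ballot_mul 1 j; rewrite !add1n mul1n => ->.
Qed.

Lemma card_chords_dvd : 1 < p -> p %| j ->
  #|chords d t| * ((j.+1 %/ p)`! * (j %/ p)`!) = b'`!.
Proof.
move=> p1 /dvdnP[J jE].
have bE : b' = J.*2.
  by move: jpb; rewrite jE doubleMl mulnC => /eqP; rewrite eqn_pmul2l // eq_sym => /eqP.
have -> : j.+1 %/ p = J by rewrite jE -addn1 divnMDl // divn_small // addn0.
have -> : j %/ p = J by rewrite jE mulnK.
have [j0|j0] := posnP j.
  rewrite chords0 // bE; move: jE; rewrite j0 => /esym/eqP; rewrite muln_eq0.
  by case/orP=> /eqP; [move=> -> | move=> pE; by have := p0; rewrite pE].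
rewrite chordsE // (card_matchings_uncovered (C_gt0 j0) card_C p1 _ bE); last by rewrite card_C.
have JJ : J <= J.*2 by rewrite -addnn leq_addr.
by have := bin_fact JJ; rewrite (_ : J.*2 - J = J) ?bE; lia.
Qed.

Lemma card_chords_odd : p = 2 -> odd j ->
  #|chords d t| * ((j.+1 %/ p)`! * (j %/ p)`!) = b'`!.
Proof.
move=> p2 oj; have bE : b' = j by move: jpb; rewrite p2 mul2n => /double_inj.
have jE : j = j./2.*2.+1 by rewrite -{1}(odd_double_half j) oj.
have j0 : 0 < j by rewrite jE.
have -> : j.+1 %/ p = j./2.+1 by rewrite p2; lia.
have -> : j %/ p = j./2 by rewrite p2; lia.
rewrite chordsE // (card_matchings_diametral (C_gt0 j0) card_C (J := j./2)) ?bE //.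
move: (j./2) jE => J jE.
have JJ : J <= J.*2 by rewrite -addnn leq_addr.
have bf := bin_fact JJ; rewrite (_ : J.*2 - J = J) in bf; last by lia.
have := @ballot_mul 1 J; rewrite !add1n mul1n => /(_ isT) /= e.
by rewrite jE [RHS]factS -bf -e factS; ring.
Qed.

Lemma chords_order : 1 < p -> 0 < #|chords d t| -> (p %| j) || (p == 2).
Proof.
move=> p1; have [->|j0] := posnP j; first by rewrite dvdn0.
rewrite chordsE // card_gt0 => /matchings_order; apply=> //; first exact: C_gt0.
  exact: card_C.
by rewrite card_C.
Qed.

End Chords.

Definition pairs d := \sum_(t in trees d) #|chords d t|.

(** The two possible centres: a vertex, whose degree [p * a] is the only one with a count not
    divisible by [p], or the middle of an edge. [m] counts groups of [p] rotated vertices. *)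
Definition balanced p (m : nat -> nat) :=
  (exists a b', [/\ 0 < a, j.*2 = p * b' & forall k, 0 < k -> nn k = (p * a == k) + p * m k]) \/
  (p = 2 /\ forall k, 0 < k -> nn k = (m k).*2).

(** The numerical condition on which both sides agree: its first half concerns the matching, its
    second half the tree. *)
Definition good p := ((p %| j) || (p == 2)) /\ balanced p (fun k => nn k %/ p).

Lemma sum_ord_mod p F : 0 < p ->
  \sum_(1 <= k < K.+1) nn k * F k =
  \sum_(1 <= k < K.+1) nn k %% p * F k + p * \sum_(1 <= k < K.+1) nn k %/ p * F k.
Proof.
move=> p0; rewrite big_distrr /= -big_split; apply: eq_bigr => k _.
by rewrite /= {1}(divn_eq (nn k) p) mulnA [p * _]mulnC -mulnDl addnC.
Qed.

Lemma pairs_good p d : 1 < p -> L = p * d -> 0 < pairs d -> good p.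
Proof.
move=> p1 Lpd; rewrite lt0n sum_nat_eq0 negb_forall => /existsP[t].
rewrite negb_imply -lt0n => /andP[tP ct].
have dL : 0 < d < L by move: L0 p1; rewrite Lpd; nia.
have bal : balanced p (fun k => nn k %/ p).
  case: (boolP (diam t)) => [dt|nd].
    have [Ld [f [_ _ fE]]] := diametral_profile L0 sumL sumV dL tP dt.
    have p2 : p = 2 by move: Lpd dL; rewrite Ld; nia.
    by right; split=> // k k0; rewrite p2 {1}fE // [in RHS]fE //; lia.
  have [f [_ f0 _ bE fE]] := uncovered_profile L0 sumL sumV p1 Lpd tP nd.
  left; exists (fsize f), (buds f); split=> // k k0.
  rewrite {1}fE //; congr (_ + p * _); rewrite fE // addnC [p * count_mem _ _]mulnC divnMDl ?(ltnW p1) //.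
  by rewrite divn_small ?addn0 //; case: (_ == _) => //; lia.
split=> //.
case: bal => [[a [b' [_ jpb _]]]|[-> _]]; last by rewrite orbT.
exact: (chords_order tP (ltnW p1) Lpd jpb p1 ct).
Qed.

Notation rest := (j.*2 + V - 2).
Notation divsum p := (\sum_(x <- [:: j.+1, j & [seq nn k | k <- iota 1 K]]) x %/ p).

Lemma V_gt0 : 0 < V.
Proof.
rewrite lt0n; apply/eqP=> V0; have : L = 0; last by move: L0; lia.
rewrite -sumL big_nat; apply: big1 => k kK.
have : nn k <= V by rewrite (bigD1_seq k) ?iota_uniq ?mem_index_iota //= leq_addr.
by rewrite V0 leqn0 => /eqP ->.
Qed.

Lemma divsumE p : divsum p = j.+1 %/ p + (j %/ p + \sum_(1 <= k < K.+1) nn k %/ p).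
Proof. by rewrite !big_cons big_map /index_iota subSS subn0. Qed.

Lemma small_sum1 (F : nat -> nat) : \sum_(1 <= k < K.+1) F k = 1 ->
  exists2 k0, 1 <= k0 < K.+1 & forall k, 1 <= k < K.+1 -> F k = (k0 == k).
Proof.
move=> S1; have : exists2 k0, k0 \in index_iota 1 K.+1 & 0 < F k0.
  apply/hasP; apply/negPn/negP => /hasPn F0.
  move: S1; rewrite big1_seq // => k /= /F0; lia.
case=> k0 k0I F0; exists k0; first by rewrite mem_index_iota in k0I.
move: S1; rewrite (bigD1_seq k0) ?iota_uniq //= => S1 k kK.
have [<-|ne] := eqVneq k0 k; first by lia.
have : \sum_(i <- index_iota 1 K.+1 | i != k0) F i == 0 by lia.
rewrite sum_nat_seq_eq0 => /allP/(_ k); rewrite mem_index_iota kK /= [k == k0]eq_sym ne.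
by move=> /(_ isT)/eqP.
Qed.

(** If the denominator has at least as many factors [qn p] as the numerator, the residues modulo [p]
    leave almost no freedom, and the degree relations do the rest. *)
Lemma divsum_good p d : 1 < p -> L = p * d -> rest %/ p < divsum p -> good p.
Proof.
move=> p1 Lpd; rewrite divsumE => lt.
have p0 : 0 < p by lia.
have sumVp := sum_ord_mod (fun=> 1) p0; have sumLp := sum_ord_mod id p0.
have V1 F : \sum_(1 <= k < K.+1) F k * 1 = \sum_(1 <= k < K.+1) F k.
  by apply: eq_bigr => k _; rewrite muln1.
rewrite !V1 in sumVp; rewrite sumL Lpd in sumLp.
set S0 := \sum_(1 <= k < K.+1) nn k %% p in sumVp *.
set S1 := \sum_(1 <= k < K.+1) nn k %% p * k in sumLp *.
set Q0 := \sum_(1 <= k < K.+1) nn k %/ p in lt sumVp *.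
set Q1 := \sum_(1 <= k < K.+1) nn k %/ p * k in sumLp *.
have V0 := V_gt0.
have LV : L + 2 = j.*2 + V.*2 := sumV.
have ej := divn_eq j p; have ej1 := divn_eq j.+1 p; have er := divn_eq rest p.
have rj := ltn_pmod j p0; have rj1 := ltn_pmod j.+1 p0; have rr := ltn_pmod rest p0.
(* [j], [j.+1] and the [nn k] add up to [rest + 3], while the quotients alone already exceed [rest]
   when multiplied by [p]; residues of total at most 2 remain. *)
have rho : j %% p + j.+1 %% p + S0 <= 2.
  have le : (rest %/ p).+1 * p <= (j.+1 %/ p + (j %/ p + Q0)) * p by rewrite leq_mul2r lt orbT.
  have r3 : j + j.+1 + V = rest + 3.
    have : 2 <= j.*2 + V by move: LV L0 V0; lia.
    by lia.
  have sumVp' : V = S0 + Q0 * p by rewrite mulnC.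
  rewrite mulSn !mulnDl in le; move: le r3 ej ej1 er rr sumVp'; clear.
  move: (rest %/ p * p) (rest %% p) (j.+1 %/ p * p) (j.+1 %% p) (j %/ p * p) (j %% p) (Q0 * p).
  by move: V => v q1 q2 q3 q4 q5 q6 q7; lia.
have mod1 : j.+1 %% p = if p %| j.+1 then 0 else (j %% p).+1 by rewrite modnS.
have dj : p %| j = (j %% p == 0) by [].
(* The residues of [j] and [j.+1] are consecutive unless [p] divides [j.+1]; in that case [j] has
   residue [p.-1], which forces [p <= 3]. *)
have S01 : S0 <= 1 /\ ((p %| j) || (p == 2)) \/ [/\ S0 = 0, p = 3 & j %% 3 = 2].
  move: rho mod1; rewrite dj; case: ifP => [pj1|_]; last by move=> rho m1; left; lia.
  have : j %% p = p.-1.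
    have := pj1; rewrite /dvdn -addn1 -modnDml addn1 => /eqP m0.
    move: rj; rewrite leq_eqVlt => /orP[/eqP e|lt']; first by rewrite -[in RHS]e.
    by rewrite modn_small in m0.
  move=> jp; rewrite jp => rho m1.
  have [p2|p3] : p = 2 \/ p = 3 by lia.
    by left; rewrite p2 eqxx orbT; lia.
  by right; rewrite -p3 jp; split=> //; lia.
have e2 : p * d + 2 = j.*2 + (S0 + p * Q0).*2 by rewrite -Lpd LV sumVp.
have even0 : S0 = 0 -> forall k, 0 < k -> nn k = p * (nn k %/ p).
  move=> S00 k k0; rewrite mulnC {1}(divn_eq (nn k) p).
  have [kK|/nnK ->] := leqP k K; last by rewrite div0n mod0n.
  suff -> : nn k %% p = 0 by rewrite addn0.
  have : nn k %% p <= S0 by rewrite /S0 (bigD1_seq k) ?iota_uniq ?mem_index_iota ?k0 //= leq_addr.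
  by rewrite S00 leqn0 => /eqP.
case: S01 => [[S01 gd]|[S00 p3 j3]]; last first.
  (* Modulo 3, [e2] would read 2 = 1. *)
  exfalso; have := divn_eq j 3; rewrite j3 => jE; move: e2; rewrite S00 p3 jE; lia.
(* If [p] divides every [nn k], then [e2] and [p %| j] give [p %| 2]: the centre is an edge. *)
split=> //; have [S00|S00] := posnP S0.
  right; have p2 : p = 2.
    case/orP: gd => [/dvdnP[J jE]|/eqP //].
    have : p %| 2.
      rewrite -(@dvdn_addr (p * d)) ?dvdn_mulr // e2 S00 add0n jE -!muln2.
      by apply: dvdn_add; apply: dvdn_mulr; [apply: dvdn_mull | apply: dvdn_mulr].
    by move/dvdn_leq => /(_ isT); lia.
  by split=> // k k0; rewrite p2 -mul2n -p2 even0 // p2; congr (_ * _); lia.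
have {S00}S00 : S0 = 1 by lia.
have [k0 k0K k0E] := small_sum1 S00.
have S1E : S1 = k0.
  rewrite /S1 (bigD1_seq k0) ?iota_uniq ?mem_index_iota //= k0E // eqxx mul1n.
  rewrite big1_seq ?addn0 // => k /andP[kk]; rewrite mem_index_iota => /k0E ->.
  by rewrite eq_sym (negbTE kk).
(* The number of corners is a multiple of [p], and [k0] is its residual part: this is the degree of
   a central vertex. *)
have pk0 : p %| k0.
  have : p %| S1 + p * Q1 by rewrite -sumLp dvdn_mulr.
  by rewrite dvdn_addl ?dvdn_mulr // S1E.
have [a aE] := dvdnP pk0; rewrite mulnC in aE.
have pj : p %| j.*2.
  case/orP: gd => [pj|/eqP ->]; last by rewrite dvdn2 odd_double.
  by rewrite -mul2n dvdn_mull.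
have [b' bE] := dvdnP pj; rewrite mulnC in bE.
left; exists a, b'; split=> //.
  by move: k0K; rewrite aE => /andP[+ _]; rewrite muln_gt0 => /andP[].
move=> k kpos; rewrite -aE {1}(divn_eq (nn k) p) addnC [_ * p]mulnC; congr (_ + _).
have [kK|kK] := leqP k K; first by rewrite k0E // kpos.
by rewrite nnK // mod0n; case: eqP => // e; move: k0K => /andP[_]; rewrite e ltnS leqNgt kK.
Qed.

Lemma balanced_mod p : 1 < p -> good p -> exists b',
  [/\ j.*2 = p * b', forall k, 0 < k -> nn k %% p <= 1,
      \sum_(1 <= k < K.+1) nn k %% p = 1 \/
      p = 2 /\ \sum_(1 <= k < K.+1) nn k %% p = 0
    & forall d, L = p * d ->
      #|trees d| * (b'`! * \prod_(1 <= k < K.+1) (nn k %/ p)`!) =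
      d * (b' + \sum_(1 <= k < K.+1) nn k %/ p).-1`!].
Proof.
move=> p1 [_ bal]; have p0 := ltnW p1.
have mK k : K < k -> nn k %/ p = 0 by move=> /nnK ->; rewrite div0n.
case: bal => [[a [b' [a0 jpb nnE]]]|[p2 nnE]].
- exists b'.
  have md k : 0 < k -> nn k %% p = (p * a == k).
    move=> k0; rewrite {1}nnE // addnC [p * _]mulnC modnMDl modn_small //.
    by case: (_ == _); lia.
  have pa0 : 0 < p * a by rewrite muln_gt0 p0.
  have paK : p * a <= K.
    by rewrite leqNgt; apply/negP=> /nnK e; have := nnE _ pa0; rewrite e eqxx.
  split=> // [k k0||d Lpd]; first by rewrite md //; case: (_ == _).
    left; rewrite (bigD1_seq (p * a)) ?iota_uniq ?mem_index_iota ?pa0 //= md // eqxx.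
    rewrite big1_seq ?addn0 // => k /andP[kk]; rewrite mem_index_iota => /andP[k0 _].
    by rewrite md // eq_sym (negbTE kk).
  exact: (card_profile_uncovered L0 nnK sumL sumV p1 Lpd a0 mK jpb nnE).
- exists j; rewrite p2.
  have md k : 0 < k -> nn k %% 2 = 0 by move=> k0; rewrite nnE // modn2 odd_double.
  split=> [|k k0||d Ld]; rewrite ?mul2n ?md //.
    right; split=> //; rewrite big_nat; apply: big1 => k /andP[k0 _]; exact: md.
  apply: (card_profile_diametral L0 sumL sumV) => //; first by rewrite Ld mul2n.
    by rewrite -p2.
  by rewrite -p2.
Qed.

(** Provides the hypotheses of [ev_ratio]. With [S] the sum of the residues of the [nn k] and [Q]
    that of their quotients, [rest = p * (b' + Q) + S - 2], where [S = 1] for a central vertex, and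
    [S = 0], [p = 2] for a central edge. *)
Lemma good_ratio p b' : 1 < p -> good p -> j.*2 = p * b' ->
  (\sum_(1 <= k < K.+1) nn k %% p = 1 \/ p = 2 /\ \sum_(1 <= k < K.+1) nn k %% p = 0) ->
  [/\ j.+1 %/ p + j %/ p = b', j %% p <= 1, j.+1 %% p <= 1,
      rest %/ p = (b' + \sum_(1 <= k < K.+1) nn k %/ p).-1 &
      0 < b' + \sum_(1 <= k < K.+1) nn k %/ p /\ (rest %% p = p.-1 \/ p = 2)].
Proof.
move=> p1 [gd _] jpb S0; have p0 := ltnW p1.
have sumVp := sum_ord_mod (fun=> 1) p0.
have V1 F : \sum_(1 <= k < K.+1) F k * 1 = \sum_(1 <= k < K.+1) F k.
  by apply: eq_bigr => k _; rewrite muln1.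
rewrite !V1 in sumVp; have V0 := V_gt0; have LV : L + 2 = j.*2 + V.*2 := sumV.
move: (\sum_(1 <= k < K.+1) nn k %% p) (\sum_(1 <= k < K.+1) nn k %/ p) S0 sumVp => S Q S0 VE.
have [h1 h2 h3] : [/\ j.+1 %/ p + j %/ p = b', j %% p <= 1 & j.+1 %% p <= 1].
  have [p2|p2] := eqVneq p 2; first by move: jpb; rewrite p2; split; lia.
  have /dvdnP[J jE] : p %| j by move: gd; rewrite (negbTE p2) orbF.
  have bE : b' = J + J.
    by move: jpb; rewrite jE doubleMl mulnC addnn => /eqP; rewrite eqn_pmul2l // eq_sym => /eqP.
  rewrite jE -addn1 divnMDl // divn_small // addn0 mulnK // modnMl modnMDl modn_small //.
have restE : rest = p * (b' + Q) + S - 2 by rewrite VE jpb mulnDr; lia.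
have bQ0 : 0 < b' + Q.
  rewrite lt0n; apply/eqP=> e; have : b' = 0 /\ Q = 0 by lia.
  by move=> [b0 Q0]; move: LV L0; rewrite VE jpb b0 Q0 !muln0; lia.
have pbQ : p * (b' + Q) = (b' + Q).-1 * p + p by rewrite -mulSnr prednK // mulnC.
split=> //.
  case: S0 => [S1|[p2 S1]]; rewrite restE S1.
    rewrite (_ : _ - 2 = (b' + Q).-1 * p + p.-1); last by rewrite pbQ; lia.
    by rewrite divnMDl // divn_small ?addn0 // prednK.
  by rewrite (_ : _ - 2 = (b' + Q).-1 * p) ?mulnK //; rewrite pbQ p2; lia.
split=> //; case: S0 => [S1|[-> _]]; [left | by right].
rewrite restE S1 (_ : _ - 2 = (b' + Q).-1 * p + p.-1); last by rewrite pbQ; lia.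
by rewrite modnMDl modn_small // prednK.
Qed.

(** The number of [chords] does not depend on the tree, so the sum over the trees is a product. *)
Lemma card_pairs_good p d : 1 < p -> L = p * d -> good p ->
  pairs d * (\prod_(x <- [:: j.+1, j & [seq nn k | k <- iota 1 K]]) (x %/ p)`!) =
  d * (rest %/ p)`!.
Proof.
move=> p1 Lpd gd; have p0 := ltnW p1.
have [b' [jpb _ S0 treesE]] := balanced_mod p1 gd.
have [_ _ _ -> _] := good_ratio p1 gd jpb S0.
rewrite -(treesE d Lpd) !big_cons big_map.
rewrite {1}(_ : iota 1 K = index_iota 1 K.+1); last by rewrite /index_iota subSS subn0.
rewrite /pairs big_distrl /= -sum_nat_const; apply: eq_bigr => t tP.
have : #|chords d t| * ((j.+1 %/ p)`! * (j %/ p)`!) = b'`!.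
  have [pj|pj] := boolP (p %| j); first exact: (card_chords_dvd tP p0 Lpd jpb p1 pj).
  have p2 : p = 2 by case: gd; rewrite (negbTE pj) => /eqP.
  by apply: (card_chords_odd tP p0 Lpd jpb p2); move: pj; rewrite p2 dvdn2 negbK.
by move=> <-; rewrite !mulnA.
Qed.

Lemma card_pairs1 :
  pairs L * (\prod_(x <- [:: j.+1, j & [seq nn k | k <- iota 1 K]]) x`!) = L * rest`!.
Proof.
rewrite -(card_profile_set1 L0 nnK sumL sumV) !big_cons big_map.
rewrite {1}(_ : iota 1 K = index_iota 1 K.+1); last by rewrite /index_iota subSS subn0.
rewrite /pairs big_distrl /= -sum_nat_const; apply: eq_bigr => t tP.
have cE := card_chords1 (p := 1) tP isT (esym (mul1n L)) (esym (mul1n j.*2)) erefl.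
have jj : j <= j.*2 by rewrite -addnn leq_addr.
have := bin_fact jj; rewrite (_ : j.*2 - j = j); last by lia.
by rewrite -cE factS => <-; ring.
Qed.

(** For [p = 1] and for a good [p] both sides satisfy the same equation with nonzero factorials;
    otherwise both vanish. *)
Lemma pairs_eval (P : {poly int}) p d (z : algC) : L = p * d -> (p.-primitive_root z)%R ->
  (P * (qf j.+1 * qf j * \prod_(1 <= k < K.+1) qf (nn k)) = qn L * qf rest)%R ->
  ((pairs d)%:R = ev z P :> algC)%R.
Proof.
move=> Lpd zp PE; have p0 := prim_order_gt0 zp.
pose s := [:: j.+1, j & [seq nn k | k <- iota 1 K]].
have {}PE : (P * \prod_(x <- s) qf x = qn L * qf rest)%R.
  by rewrite -PE !big_cons big_map !mulrA /index_iota subSS subn0.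
have prod0 (F : nat -> nat) : (forall x, 0 < F x) -> ((\prod_(x <- s) F x)%N%:R != 0 :> algC)%R.
  by move=> F0; rewrite pnatr_eq0 -lt0n prodn_cond_gt0.
have [p1|p1] := leqP p 1.
  have pE : p = 1 by lia.
  have zE : z = 1%R by have := prim_expr_order zp; rewrite pE expr1.
  have dE : d = L by rewrite Lpd pE mul1n.
  apply: (mulIf (prod0 (fun x => x`!) (fun x => fact_gt0 _))); rewrite zE (ev_ratio1 PE) dE -natrM.
  by rewrite card_pairs1.
rewrite Lpd in PE.
have [gd|ngd] := pselect (good p).
  have [b' [jpb m1 S0 _]] := balanced_mod p1 gd.
  have [bE j1 jj1 rE [bQ mE]] := good_ratio p1 gd jpb S0.
  apply: (mulIf (prod0 (fun x => (x %/ p)`!) (fun x => fact_gt0 _))).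
  rewrite (ev_ratio p0 zp PE) //.
  - by rewrite -natrM card_pairs_good.
  - by rewrite divsumE rE prednK // -bE addnA.
  - move=> x; rewrite !inE => /or3P[/eqP -> //|/eqP -> //|/mapP[k]].
    by rewrite mem_iota => /andP[k0 _] ->; apply: m1.
have -> : pairs d = 0.
  by apply/eqP; rewrite -leqn0 leqNgt; apply/negP=> /(pairs_good p1 Lpd).
rewrite (ev_ratio_eq0 p0 zp PE) //.
by rewrite ltnS leqNgt; apply/negP=> /(divsum_good p1 Lpd).
Qed.

End Pairs.

(** * Tree-rooted maps in canonical form *)

Lemma card_porbits_invol (D : finType) (a : {perm D}) :
  (forall x, a x != x) -> (forall x, a (a x) = x) -> #|porbits a|.*2 = #|D|.
Proof.
move=> a_neq aK; rewrite -[in RHS]cardsT -[in RHS]sum1_card.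
rewrite (partition_big (porbit a) (mem (porbits a))) /=; last by move=> x _; apply: imset_f.
rewrite -muln2 -sum_nat_const; apply: eq_bigr => _ /imsetP[x _ ->].
rewrite sum1_card (_ : 2 = #|[set x; a x]|); last by rewrite cards2 eq_sym a_neq.
apply: eq_card => y; rewrite !inE unfold_in /= inE eq_porbit_mem.
by rewrite (mem_porbit_invol _ _ aK).
Qed.

Section Maps.
Variable D : finType.
Implicit Types (m : trmap D) (p : {perm D}).

(** Given [2 * V = #|T| + 2] for the tree, Euler's formula amounts to the same count for the faces
    and the complement of the tree, which treats the tree and its dual alike. *)
Lemma tree_rootedP m : is_tree_rooted m <->
  [/\ forall h, eperm m h != h, forall h, eperm m (eperm m h) = h,
      edge_closed m (tree m), connected m (tree m)
    & (#|vertices m|.*2 = #|tree m| + 2)%N /\ (#|faces m|.*2 = #|~: tree m| + 2)%N].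
Proof.
have euler : (forall h, eperm m h != h) -> (forall h, eperm m (eperm m h) = h) ->
    #|edges m|.*2 = #|tree m| + #|~: tree m|.
  by move=> a_neq aK; rewrite card_porbits_invol // cardsC.
split=> [[[a_neq aK conn eul] span]|[a_neq aK cT conn [cV cF]]].
  have [cT connT _] := span.
  have {}euler := euler a_neq aK.
  case: (pickP D) => [x0 _|D0].
    have [cV _] := spanning_tree_contour a_neq aK x0 span.
    split=> //; split=> //; move: eul euler cV; clear.
    by move: #|vertices m| #|faces m| #|edges m| #|tree m| #|~: tree m|; lia.
  (* Without half-edges all counts are 0, which contradicts Euler's formula. *)
  have D00 : #|D| = 0 by apply: eq_card0 => x; have := D0 x.
  have P0 (s : {perm D}) : #|porbits s| = 0.
    by apply/eqP; rewrite -leqn0 -D00 leq_imset_card.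
  by move: eul; rewrite /vertices /faces /edges !P0.
split; last by split=> // c; apply: connected_acyclic.
split=> //.
  move=> x y; have := conn x y; apply: connect_sub => u v /orP[/eqP ->|/andP[uT /eqP ->]];
    by apply: connect1; rewrite /step /= ?inE ?eqxx ?orbT.
have := euler a_neq aK; move: cV cF; clear.
by move: #|vertices m| #|faces m| #|edges m| #|tree m| #|~: tree m|; lia.
Qed.

Lemma card_porbits_conjT (s p : {perm D}) : #|porbits (s ^ p)%g| = #|porbits s|.
Proof.
have := card_porbits_conj s p predT; have e (A : {set {set D}}) : [set v in A | predT #|v|] = A.
  by apply/setP=> v; rewrite inE andbT.
by rewrite !e.
Qed.

Lemma faces_relabel p m : faces (relabel p m) = porbits ((eperm m * vperm m) ^ p)%g.
Proof. by rewrite /faces /= conjMg. Qed.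

Lemma relabel_tree_rooted p m : is_tree_rooted m -> is_tree_rooted (relabel p m).
Proof.
move/tree_rootedP=> [a_neq aK cT conn [cV cF]].
have mT x : (p x \in p @: tree m) = (x \in tree m) by rewrite (mem_imset _ _ perm_inj).
apply/tree_rootedP; split.
- by move=> h; rewrite -[h](permKV p) /= permJ (inj_eq perm_inj).
- by move=> h; rewrite -[h](permKV p) /= !permJ aK.
- by move=> _ /= /imsetP[h hT ->]; rewrite permJ mT cT.
- move=> x y; rewrite -[x](permKV p) -[y](permKV p); move: (_ x) (_ y) => {}x {}y.
  case/connectP: (conn x y) => q; elim: q x => [|z q IHq] x /=.
    by move=> _ ->; apply: connect0.
  case/andP=> xz pq yE; apply: connect_trans (IHq _ pq yE); apply: connect1.
  by case/orP: xz => [/eqP ->|/andP[xT /eqP ->]]; rewrite /step /= !permJ eqxx ?mT ?xT ?orbT.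
- rewrite /vertices faces_relabel !card_porbits_conjT /= [#|~: _|]cardsCs setCK card_imset; last exact: perm_inj.
  by split=> //; rewrite cF [in LHS]cardsCs setCK.
Qed.

Lemma relabel_has_type j nn p m : has_type j nn m -> has_type j nn (relabel p m).
Proof.
case=> cF cV; split; first by rewrite faces_relabel card_porbits_conjT.
by move=> k k0; rewrite -cV // (card_porbits_conj _ _ (pred1 k)).
Qed.

Lemma next_corner_relabel p m h :
  next_corner (relabel p m) (p h) = p (next_corner m h).
Proof.
by rewrite /next_corner /= !permJ (mem_imset _ _ perm_inj); case: ifP.
Qed.

Lemma rotate_root_relabel p m : rotate_root (relabel p m) = relabel p (rotate_root m).
Proof. by rewrite /rotate_root /relabel /= -next_corner_relabel. Qed.

Lemma relabelM p q m : relabel q (relabel p m) = relabel (p * q)%g m.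
Proof.
rewrite /relabel /= !conjgM permM -imset_comp; congr TRMap.
by apply: eq_imset => x; rewrite /= permM.
Qed.

Lemma relabel1 m : relabel 1%g m = m.
Proof.
case: m => s a T r; rewrite /relabel /= !conjg1 perm1; congr TRMap.
by rewrite -[RHS]imset_id; apply: eq_imset => x; rewrite perm1.
Qed.

Lemma iso_class_id m : m \in iso_class m.
Proof. by apply/imsetP; exists 1%g; rewrite ?relabel1. Qed.

Lemma iso_class_relabel p m : iso_class (relabel p m) = iso_class m.
Proof.
apply/setP=> m'; apply/imsetP/imsetP=> [] [q _ ->].
  by exists (p * q)%g; rewrite ?relabelM.
by exists (p^-1 * q)%g; rewrite ?relabelM ?mulKVg.
Qed.

Lemma rotation_iso_class m : rotation (iso_class m) = iso_class (rotate_root m).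
Proof.
rewrite /rotation /iso_class -imset_comp; apply: eq_imset => p.
exact: rotate_root_relabel.
Qed.

Lemma iter_rotation_iso_class e m :
  iter e (@rotation D) (iso_class m) = iso_class (iter e (@rotate_root D) m).
Proof. by elim: e => //= e ->; rewrite rotation_iso_class. Qed.

End Maps.

(** Read off the forest: its arcs give the moved points in pairs, and its vertices are the arcs plus
    the root. *)
Lemma ncinv_genus0 L (L0 : 0 < L) (t : {perm 'I_L}) : ncinv t ->
  #|porbits (t * cyc L)%g|.*2 = #|moved t| + 2.
Proof.
case/ncinv_forest => // f lf ->.
have fx := card_fix_tau lf; have := cardsC [set x | tau L f x == x].
have -> : ~: [set x | tau L f x == x] = moved (tau L f) by apply/setP=> x; rewrite !inE.
rewrite card_ord fx (card_porbits_tau L0 lf) -[in RHS]lf len_letters.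
by move: #|moved _| => M; lia.
Qed.

(** * Labelling the corners by the contour walk *)

Section Canonical.
Variables (L j : nat) (nn : nat -> nat).
Hypothesis L0 : 0 < L.
Notation c := (cyc L).
Notation x0 := (Ordinal L0).
Implicit Types (t b p : {perm 'I_L}) (r : 'I_L) (m : trmap 'I_L).

(** The contour walk takes a tree half-edge [h] to [vperm (t h)]; for it to be [c], [vperm] has to
    be [t * c]. The root [r] is a parameter since rotation moves nothing else. *)
Definition unrooted_map t b r : trmap 'I_L := TRMap (t * c)%g (t * b)%g (moved t) r.

Definition canonical (tb : {perm 'I_L} * {perm 'I_L}) :=
  (tb.1 \in profile_set L j.*2 nn L) && (tb.2 \in chords L tb.1).

Definition valid m := is_tree_rooted m /\ has_type j nn m.

Lemma rotinvL t : rotinv L t.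
Proof. by rewrite /rotinv cycXL // conjg1. Qed.

Section FromPair.
Variables (t b : {perm 'I_L}).
Hypotheses (nt : ncinv t) (nb : ncinv b) (bt : moved b = [set x | t x == x]).
Notation m := (unrooted_map t b).

Let tK : forall x, t (t x) = x. Proof. by case/ncinvP: nt. Qed.
Let bK : forall x, b (b x) = x. Proof. by case/ncinvP: nb. Qed.

Lemma pair_epermE x : (t * b)%g x = if x \in moved t then t x else b x.
Proof.
rewrite permM; case: ifPn; rewrite inE; last by rewrite negbK => /eqP ->.
move=> tx; apply/eqP; rewrite -[_ == _]negbK; apply/negP => bx.
have : t x \in moved b by rewrite inE.
by rewrite bt inE tK eq_sym (negbTE tx).
Qed.

Lemma pair_moved x : (x \in moved b) = (x \notin moved t).
Proof. by rewrite bt !inE negbK. Qed.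

Lemma pair_eperm_neq x : (t * b)%g x != x.
Proof.
rewrite pair_epermE; case: ifPn; first by rewrite inE.
by rewrite -pair_moved inE.
Qed.

Lemma moved_invol (s : {perm 'I_L}) x : (forall y, s (s y) = y) -> (s x \in moved s) = (x \in moved s).
Proof. by move=> sK; rewrite !inE sK eq_sym. Qed.

Lemma pair_epermK x : (t * b)%g ((t * b)%g x) = x.
Proof.
rewrite (pair_epermE x); case: ifPn => xT; rewrite pair_epermE.
  by rewrite (moved_invol _ tK) xT tK.
rewrite -pair_moved in xT; have := pair_moved (b x); rewrite (moved_invol _ bK) xT.
by case: (b x \in moved t) => // _; rewrite bK.
Qed.

Lemma pair_next_corner r h : next_corner (m r) h = c h.
Proof.
rewrite /next_corner /= pair_epermE; case: ifPn => hT; rewrite permM ?hT ?tK //.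
by move: hT; rewrite inE negbK => /eqP ->.
Qed.

(** [t] and [b] have disjoint supports, so they commute and the two factors [t] cancel. *)
Lemma pair_faces : (t * b * (t * c) = b * c)%g.
Proof.
apply/permP=> x; rewrite -mulgA !permM; congr (c _).
have := pair_epermE x; rewrite permM => e; rewrite e.
case: ifPn => xT; last first.
  move: xT; rewrite -pair_moved -(moved_invol _ bK) pair_moved inE negbK; exact/eqP.
rewrite tK; apply/esym/eqP; rewrite -[_ == _]negbK; apply/negP => bx.
have : x \in moved b by rewrite inE.
by rewrite pair_moved xT.
Qed.

Lemma pair_tree_rooted r : is_tree_rooted (m r).
Proof.
apply/tree_rootedP; split.
- exact: pair_eperm_neq.
- exact: pair_epermK.
- by move=> h hT; rewrite /= pair_epermE hT (moved_invol _ tK).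
(* The walk [c] reaches every corner, and each of its steps turns around a vertex, possibly after
   following a tree edge. *)
- move=> x y; case/porbitP: (porbit_cyc y x) => i ->.
  elim: i => [|i IHi]; first by rewrite expg0 perm1 connect0.
  apply: connect_trans IHi _; rewrite expgSr permM; set z := (_ x).
  rewrite -(pair_next_corner x0 z) /next_corner /=; case: ifP => zT; last first.
    by apply: connect1; rewrite /step /= eqxx.
  apply: (@connect_trans _ _ ((t * b)%g z)); apply: connect1; rewrite /step /= ?eqxx //.
  by rewrite zT orbT.
- split; first exact: ncinv_genus0.
  rewrite /faces /= pair_faces ncinv_genus0 //; congr (_ + 2).
  by apply: eq_card => x; rewrite in_setC; apply: pair_moved.
Qed.

Lemma pair_valid r : has_profile j.*2 nn t -> valid (m r).
Proof.
case/asboolP=> fx prof; split; first exact: pair_tree_rooted.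
split=> //; apply: double_inj; rewrite /faces /= pair_faces ncinv_genus0 // bt fx; lia.
Qed.

End FromPair.

Lemma canonical_valid tb r : canonical tb -> valid (unrooted_map tb.1 tb.2 r).
Proof.
rewrite /canonical !inE => /andP[/and3P[nt _ pt] /and3P[nb _ /eqP bt]].
exact: pair_valid.
Qed.

(** Once the walk is [c], the vertex and face permutations are forced to be [t * c] and [b * c]; the
    two counts of [tree_rootedP] then say that [t] and [b] attain the genus bound. *)
Lemma valid_canonical m : valid m -> next_corner m =1 c ->
  exists2 tb, canonical tb & m = unrooted_map tb.1 tb.2 (root_corner m).
Proof.
case=> mt [cF prof] mc; have [_ span] := mt.
have /tree_rootedP[a_neq aK cT conn [cV cF2]] := mt.
set a := eperm m in a_neq aK cT; set T := tree m.
pose t := eperm_on aK T; pose b := eperm_on aK (~: T).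
have aT h : (a h \in T) = (h \in T) by exact: mem_edge_closed.
have cT' : edge_closed m (~: T) by move=> h; rewrite !inE aT.
have tE h : t h = if h \in T then a h else h by exact: eperm_onE.
have bE h : b h = if h \in T then h else a h.
  by rewrite [LHS]eperm_onE // inE; case: (h \in T).
have tK h : t (t h) = h.
  by rewrite (tE h); case: ifP => hT; rewrite tE ?hT // aT // hT aK.
have bK h : b (b h) = h.
  by rewrite (bE h); case: ifP => hT; rewrite bE ?hT // aT // hT aK.
have mt_ : moved t = T.
  by apply/setP=> h; rewrite inE tE; case: ifP => // _; rewrite ?a_neq ?eqxx.
have mb : moved b = ~: T.
  by apply/setP=> h; rewrite !inE bE; case: ifP => // _; rewrite ?a_neq ?eqxx.
have fixt : [set x | t x == x] = ~: T by rewrite -mt_; apply/setP=> h; rewrite !inE negbK.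
have aE : (t * b)%g = a.
  by apply/permP=> h; rewrite permM tE; case: ifP => hT; rewrite bE ?aT hT.
have sE : (t * c)%g = vperm m.
  apply/permP=> h; rewrite permM -mc (next_cornerE aK cT) //.
  by rewrite permM -/t tK.
have fE : (a * vperm m)%g = (b * c)%g.
  rewrite -sE -aE; apply/permP=> h; rewrite -mulgA !permM; congr (c _).
  have [hT|/negbTE hT] := boolP (h \in T).
    by rewrite (tE h) (bE h) hT bE aT hT tE aT hT aK.
  by rewrite (tE h) hT (bE h) hT tE aT hT.
have nt : ncinv t.
  by apply: (genus0_ncinv L0 tK); rewrite sE mt_.
have nb : ncinv b.
  by apply: (genus0_ncinv L0 bK); rewrite -fE mb; exact: cF2.
exists (t, b); last by rewrite /unrooted_map /= sE aE mt_ /a /T; case: (m).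
rewrite /canonical /profile_set /chords !inE nt nb !rotinvL mb fixt eqxx /= !andbT.
apply/asboolP; rewrite fixt sE; split=> //.
by move: cF2; rewrite cF -/T; move: #|~: T|; lia.
Qed.

Lemma canonical_form m : valid m -> exists2 tb, canonical tb &
  exists p, relabel p m = unrooted_map tb.1 tb.2 x0.
Proof.
move=> mv; have [mt _] := mv; have [_ span] := mt.
have /tree_rootedP[a_neq aK cT conn _] := mt.
set nu := (eperm_on aK (tree m) * vperm m)%g.
set r := root_corner m.
have [_ one] := spanning_tree_contour a_neq aK r span.
have nuE : next_corner m =1 nu by exact: next_cornerE.
have oL : #|porbit nu r| = L.
  by rewrite (_ : porbit nu r = setT) ?cardsT ?card_ord //; apply/setP=> x; rewrite one inE.
(* The corner visited at time [x] receives the label [x]; the walk being a single cycle of length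
   [L], no corner is visited twice. *)
have qinj : injective (fun x : 'I_L => iter x nu r).
  move=> x y e; have := uniq_traject_porbit nu r; rewrite oL => u.
  have nthE (z : 'I_L) : nth r (traject nu r L) z = iter z nu r by rewrite nth_traject.
  have lt (z : 'I_L) : z < size (traject nu r L) by rewrite size_traject.
  by apply/val_inj/eqP; rewrite -(nth_uniq r (lt x) (lt y) u) !nthE e.
pose q := perm qinj.
have qE x : q x = iter x nu r by rewrite permE.
have q0 : q x0 = r by rewrite qE.
have qc x : q (c x) = nu (q x).
  rewrite !qE val_cyc // -iterS; have [->|lt] := eqVneq x.+1 L.
    by rewrite modnn /= -{1}(iter_porbit nu r) oL.
  by rewrite modn_small // ltn_neqAle lt ltn_ord.
have mv' : valid (relabel q^-1 m).
  by case: mv => ? ?; split; [apply: relabel_tree_rooted | apply: relabel_has_type].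
have [h|tb tbc e] := valid_canonical mv'.
  have := next_corner_relabel q^-1 m (q h); rewrite permK => ->.
  by rewrite nuE -qc permK.
exists tb => //; by exists q^-1%g; rewrite e /= -/r -[r]q0 permK.
Qed.

Lemma conj_cycX k : (c ^ (c ^+ k) = c)%g.
Proof. by rewrite /conjg -expgS expgSr mulKg. Qed.

Lemma relabel_cycX k t b r :
  relabel (c ^+ k) (unrooted_map t b r) =
  unrooted_map (t ^ (c ^+ k)) (b ^ (c ^+ k)) ((c ^+ k)%g r).
Proof.
rewrite /relabel /unrooted_map /= !conjMg conj_cycX; congr TRMap.
apply/setP=> x; rewrite -[x](permKV (c ^+ k)%g) (mem_imset _ _ perm_inj) !inE.
by rewrite permJ (inj_eq perm_inj).
Qed.

Lemma unrooted_map_inj r t b t' b' :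
  unrooted_map t b r = unrooted_map t' b' r -> t = t' /\ b = b'.
Proof. by case=> /mulIg -> /mulgI ->. Qed.

Lemma canonicalP tb : canonical tb ->
  [/\ ncinv tb.1, ncinv tb.2 & moved tb.2 = [set x | tb.1 x == x]].
Proof.
by rewrite /canonical !inE => /andP[/and3P[? _ _] /and3P[? _ /eqP]].
Qed.

(** A relabelling carries one contour walk to the other; both are [c], so [p] commutes with [c] and
    is determined by the image of the root. *)
Lemma relabel_canonical p tb tb' k : canonical tb -> canonical tb' ->
  relabel p (unrooted_map tb.1 tb.2 x0) = unrooted_map tb'.1 tb'.2 ((c ^+ k)%g x0) ->
  p = (c ^+ k)%g.
Proof.
move=> /canonicalP[nt nb bt] /canonicalP[nt' nb' bt'] e.
have px0 : p x0 = (c ^+ k)%g x0 := congr1 (@root_corner _) e.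
have pc h : p (c h) = c (p h).
  by rewrite -(pair_next_corner nt bt x0) -next_corner_relabel e pair_next_corner.
apply/permP=> h; rewrite [h](ord_cycX L0); move: (val h) => i.
have -> : (c ^+ k)%g ((c ^+ i)%g x0) = (c ^+ i)%g (p x0).
  by rewrite px0 -!permM -!expgD addnC.
elim: i => [|i IHi]; first by rewrite !expg0 !perm1.
by rewrite !expgSr !permM pc IHi.
Qed.

Lemma iter_rotate_root e tb r : canonical tb ->
  iter e (@rotate_root _) (unrooted_map tb.1 tb.2 r) =
  unrooted_map tb.1 tb.2 ((c ^+ e)%g r).
Proof.
move=> /canonicalP[nt nb bt]; elim: e => [|e IHe] /=; first by rewrite perm1.
by rewrite IHe /rotate_root /= (pair_next_corner nt bt) expgSr permM.
Qed.

Definition canon_class tb := iso_class (unrooted_map tb.1 tb.2 x0).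

(** [R] to the power [e] only moves the root to [(c ^+ e) x0]. The one relabelling that can undo
    this move is the rotation itself, which has to preserve [t] and [b]. *)
Lemma rotation_fixed e tb : canonical tb ->
  iter e (@rotation _) (canon_class tb) = canon_class tb <->
  rotinv e tb.1 /\ rotinv e tb.2.
Proof.
move=> tbc; rewrite iter_rotation_iso_class iter_rotate_root //; split; last first.
  case=> /eqP te /eqP be; rewrite -[RHS](iso_class_relabel (c ^+ e)%g).
  by rewrite relabel_cycX te be.
move=> ce; have := iso_class_id (unrooted_map tb.1 tb.2 ((c ^+ e)%g x0)).
rewrite ce => /imsetP[p _ /esym e']; have pE := relabel_canonical tbc tbc e'.
move: e'; rewrite pE relabel_cycX => /unrooted_map_inj[te be].
by split; apply/eqP.
Qed.

Lemma canon_class_inj tb tb' : canonical tb -> canonical tb' ->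
  canon_class tb = canon_class tb' -> tb = tb'.
Proof.
move=> tbc tbc' e; have := iso_class_id (unrooted_map tb'.1 tb'.2 x0).
rewrite -/(canon_class tb') -e => /imsetP[p _ /esym e'].
have pE := @relabel_canonical p tb tb' 0 tbc tbc'; rewrite expg0 perm1 in pE.
have p1 := pE e'; move: e'; rewrite p1 relabel1 => /unrooted_map_inj[].
by case: (tb) (tb') => [? ?] [? ?] /= -> ->.
Qed.

Lemma iso_class_valid m : valid m <-> exists2 tb, canonical tb & iso_class m = canon_class tb.
Proof.
split=> [/canonical_form[tb tbc [p e]]|[tb tbc e]].
  by exists tb => //; rewrite /canon_class -e iso_class_relabel.
have := iso_class_id m; rewrite e => /imsetP[p _ ->].
have [] := canonical_valid x0 tbc; split; [exact: relabel_tree_rooted | exact: relabel_has_type].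
Qed.

(** By Bezout, the gcd plus a multiple of [e] is a multiple of [L], and a turn by a multiple of [L]
    is trivial. *)
Lemma rotinv_gcd e (t : {perm 'I_L}) : rotinv (gcdn e L) t = rotinv e t.
Proof.
apply/idP/idP => [H|H]; first by rewrite /rotinv -(divnK (dvdn_gcdl e L)) mulnC rotinvX.
have [a _ /dvdnP[q qE]] := Bezoutr e L0.
have /eqP E : (t ^ (c ^+ (gcdn e L + a * e)))%g == t.
  by rewrite qE mulnC expgM cycXL // expg1n conjg1.
have F : (t ^ (c ^+ (a * e)))%g = t by rewrite mulnC rotinvX.
by apply/eqP; apply: (conjg_inj (c ^+ (a * e))%g); rewrite -conjgM -expgD E F.
Qed.

Lemma card_fixed_classes (S : {set {set trmap 'I_L}}) e :
  (forall C, C \in S <-> exists2 m, valid m & C = iso_class m) ->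
  #|[set C in S | iter e (@rotation _) C == C]| = pairs L j nn (gcdn e L).
Proof.
move=> SP.
pose X := [set tb : {perm 'I_L} * {perm 'I_L} |
  (tb.1 \in profile_set L j.*2 nn (gcdn e L)) && (tb.2 \in chords (gcdn e L) tb.1)].
have XP tb : tb \in X = [&& canonical tb, rotinv e tb.1 & rotinv e tb.2].
  rewrite !inE /canonical /profile_set /chords !inE !rotinvL !rotinv_gcd /=.
  by case: (ncinv tb.1); case: (ncinv tb.2); case: (has_profile _ _ _);
     case: (rotinv e tb.1); case: (rotinv e tb.2); rewrite ?andbF ?andbT.
have -> : [set C in S | iter e (@rotation _) C == C] = canon_class @: X.
  apply/setP=> C; rewrite inE; apply/andP/imsetP => [[/SP[m mv ->] fx]|[tb + ->]].
    have [tb tbc mE] := (iso_class_valid m).1 mv; rewrite mE in fx *.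
    by exists tb => //; rewrite XP tbc; have [-> ->] := (rotation_fixed e tbc).1 (eqP fx).
  rewrite XP => /and3P[tbc r1 r2]; split; last exact/eqP/(rotation_fixed e tbc).2.
  by apply/SP; exists (unrooted_map tb.1 tb.2 x0) => //; apply: canonical_valid.
rewrite card_in_imset; last first.
  move=> tb tb'; rewrite !XP => /andP[tbc _] /andP[tbc' _]; exact: canon_class_inj.
rewrite /pairs -sum1_card (eq_bigl (fun tb => (tb.1 \in profile_set L j.*2 nn (gcdn e L)) &&
  (tb.2 \in chords (gcdn e L) tb.1))); last by move=> tb; rewrite inE.
rewrite -(pair_big_dep (mem (profile_set L j.*2 nn (gcdn e L)))
  (fun t b => b \in chords (gcdn e L) t) (fun _ _ => 1)) /=.
by apply: eq_bigr => t _; rewrite sum1_card.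
Qed.

End Canonical.

(** * The sieving theorem *)

Section CyclicAction.
Variables (T : finType) (S : {set T}) (f : T -> T) (L : nat).
Hypothesis L0 : 0 < L.
Hypothesis fS : forall x, x \in S -> f x \in S.
Hypothesis fL : forall x, x \in S -> iter L f x = x.

(** The identity outside [S] makes [f] a permutation of the whole type, as an action on that type
    requires. *)
Definition on_set x := if x \in S then f x else x.

Lemma iter_on_set k x : iter k on_set x = if x \in S then iter k f x else x.
Proof.
elim: k => [|k IHk]; first by case: ifP.
rewrite !iterS IHk; case: ifPn => xS; last by rewrite /on_set (negbTE xS).
suff itS : iter k f x \in S by rewrite /on_set itS.
by elim: k {IHk} => //= k; apply: fS.
Qed.

Lemma on_set_inj : injective on_set.
Proof.
apply: (can_inj (g := iter L.-1 on_set)) => x.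
rewrite -iterSr prednK // iter_on_set; case: ifP => // xS; exact: fL.
Qed.

Definition perm_on_set : {perm T} := perm on_set_inj.

Lemma perm_on_setX k x : (perm_on_set ^+ k)%g x = if x \in S then iter k f x else x.
Proof.
by rewrite permX -iter_on_set; apply: eq_iter => y; rewrite permE.
Qed.

Lemma perm_on_set_order : (#[perm_on_set] %| L)%g.
Proof.
rewrite order_dvdn; apply/eqP/permP=> x; rewrite perm_on_setX perm1.
by case: ifP => // /fL.
Qed.

Lemma cyclic_action (gT : finGroupType) (g : gT) : #[g]%g = L ->
  exists to : action <[g]>%g T,
    forall x k, to x (g ^+ k)%g = if x \in S then iter k f x else x.
Proof.
move=> gL; have dv : (#[perm_on_set] %| #[g])%g by rewrite gL perm_on_set_order.
exists (morph_action (eltm_morphism dv)) => x k.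
by rewrite mactE /= eltmE perm_on_setX.
Qed.

End CyclicAction.

Lemma expgz_modn (gT : finGroupType) (g : gT) (w : algC) (e : int) :
    (#[g]%g.-primitive_root w)%R ->
  exists2 k : nat, expgz g e = (g ^+ k)%g & (w ^ e)%R = (w ^+ k)%R.
Proof.
move=> wp; case: e => k; first by exists k.
exists (#[g]%g.-1 * k.+1)%N => /=.
  by apply/eqP; rewrite eq_invg_mul -expgD -mulSn prednK ?order_gt0 // expgM expg_order expg1n.
rewrite exprM -[(w ^ _)%R]/(w ^- k.+1)%R -exprVn; congr (_ ^+ _)%R.
have w0 : (w != 0)%R by rewrite (prim_root_eq0 wp) -lt0n order_gt0.
by apply: (mulIf w0); rewrite mulVf // -exprSr prednK ?order_gt0 // prim_expr_order.
Qed.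

Section QFractions.
Local Open Scope ring_scope.

Lemma tofrac_qn m : tofrac (qn m) = qnum m.
Proof.
have nz : tofrac (1 - 'X : {poly int}) != 0 by rewrite tofrac_eq0 sub1X_neq0.
apply: (mulfI nz); rewrite -tofracM qnE /qnum /qvar mulrCA !tofracB !tofrac1 tofracXn in nz *.
by rewrite mulfV // mulr1.
Qed.

Lemma tofrac_qf m : tofrac (qf m) = qfact m.
Proof.
by rewrite /qf /qfact rmorph_prod; apply: eq_bigr => i _; apply: tofrac_qn.
Qed.

Lemma qnum_neq0 m : (0 < m)%N -> qnum m != 0.
Proof. by move=> m0; rewrite -tofrac_qn tofrac_eq0 qn_neq0. Qed.

Lemma qfact_neq0 m : qfact m != 0.
Proof. by rewrite -tofrac_qf tofrac_eq0 qf_neq0. Qed.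

Lemma qfactS m : qfact m.+1 = qnum m.+1 * qfact m.
Proof. by rewrite -!tofrac_qf qfS tofracM tofrac_qn. Qed.

Lemma div_rearrange (F : fieldType) (a b c d u v q : F) :
  b != 0 -> c != 0 -> d != 0 -> u != 0 -> q != 0 ->
  a * v = a / (b * c * d) * (c * (d * v) / (u * (u * q))) * (b * u * u * q).
Proof. by move=> b0 c0 d0 u0 q0; field; rewrite b0 c0 d0 u0 q0. Qed.

(** [qfact (n + j + 1)] divided by the two largest quantum integers is [qfact (n + j - 1)], and
    [qnum (j + 1)] completes one of the two factorials of [j]. *)
Lemma tofrac_sieving (P : {poly int}) j n K nn : (0 < n)%N ->
  P * (qf j.+1 * qf j * \prod_(1 <= k < K.+1) qf (nn k)) = qn (2 * n) * qf (n + j - 1) ->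
  tofrac P = qnum (2 * n) / (qnum (j + 1) * qnum (n + j + 1) * qnum (n + j)) *
    qmultinomial (n + j + 1) [:: j, j & [seq nn k | k <- iota 1 K]].
Proof.
move=> n0 /(congr1 (@tofrac _)); rewrite !tofracM !tofrac_qf tofrac_qn => e.
have [q qE] : exists q : {fraction {poly int}}, q = \prod_(k <- iota 1 K) qfact (nn k) by eexists.
have q0 : q != 0 by rewrite qE prodf_seq_neq0; apply/allP=> k _; rewrite qfact_neq0.
rewrite /qmultinomial !big_cons big_map -qE.
have eN : (n + j - 1).+1 = (n + j)%N by lia.
rewrite !addn1 qfactS -[in qfact (n + j)]eN qfactS eN.
have {}e : tofrac P * (qnum j.+1 * qfact j * qfact j * q) = qnum (2 * n) * qfact (n + j - 1).
  rewrite -e qfactS qE /index_iota subSS subn0 rmorph_prod; congr (_ * (_ * _)).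
  by apply: eq_bigr => k _; rewrite -tofrac_qf.
have h1 : qnum j.+1 != 0 by rewrite qnum_neq0.
have h2 : qnum (n + j).+1 != 0 by rewrite qnum_neq0.
have h3 : qnum (n + j) != 0 by rewrite qnum_neq0 // addn_gt0 n0.
have h4 := qfact_neq0 j.
apply: (mulIf (mulf_neq0 (mulf_neq0 (mulf_neq0 h1 h4) h4) q0)); rewrite e.
move: (qnum _) (qnum j.+1) (qnum (n + j).+1) (qnum (n + j)) (qfact j) (qfact (n + j - 1)) h1 h2 h3 h4.
move=> a b c d u v b0 c0 d0 u0.
exact: (div_rearrange a v b0 c0 d0 u0 q0).
Qed.

End QFractions.

Local Open Scope ring_scope.

Lemma type_equations (j K n : nat) (nn : nat -> nat) :
  - (2 * j%:Z) + \sum_(1 <= k < K.+1) (k%:Z - 2) * (nn k)%:Z = - 2 :> int ->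
  n%:Z = j%:Z - 1 + \sum_(1 <= k < K.+1) (nn k)%:Z :> int ->
  (n.+1 = j + \sum_(1 <= k < K.+1) nn k)%N /\
  (\sum_(1 <= k < K.+1) nn k * k = 2 * n)%N.
Proof.
have sumZ F : \sum_(1 <= k < K.+1) (F k)%:Z = (\sum_(1 <= k < K.+1) F k)%N%:Z.
  by rewrite (big_morph Posz PoszD erefl).
rewrite sumZ.
have -> : \sum_(1 <= k < K.+1) (k%:Z - 2) * (nn k)%:Z =
    (\sum_(1 <= k < K.+1) nn k * k)%N%:Z - 2 * (\sum_(1 <= k < K.+1) nn k)%N%:Z.
  rewrite -!sumZ mulr_sumr -sumrB; apply: eq_bigr => k _.
  by rewrite PoszM; ring.
by move: (\sum_(1 <= k < K.+1) nn k)%N (\sum_(1 <= k < K.+1) nn k * k)%N => V S; lia.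
Qed.

Theorem theorem34 (j K n : nat) (nn : nat -> nat)
    (nn_finite : forall k : nat, (K < k)%N -> nn k = 0%N)
    (nn_nonzero : exists k : nat, (1 <= k)%N /\ nn k <> 0%N)
    (nn_planar : - (2 * j%:Z) + \sum_(1 <= k < K.+1) (k%:Z - 2) * (nn k)%:Z
                 = - 2 :> int)
    (n_def : n%:Z = j%:Z - 1 + \sum_(1 <= k < K.+1) (nn k)%:Z :> int)
    (gT : finGroupType) (g : gT) (order_g : #[g]%g = (2 * n)%N) :
  exists to : action <[g]>%g {set trmap 'I_(2 * n)},
    (forall C, C \in TM n j nn -> to C g = rotation C) /\
    exists P : {poly int},
      tofrac P = qnum (2 * n) / (qnum (j + 1) * qnum (n + j + 1) * qnum (n + j))
                 * qmultinomial (n + j + 1)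
                     [:: j, j & [seq nn k | k <- iota 1 K]]
      /\ cyclic_sieving to (TM n j nn) P.
Proof.
have [nV sumL] := type_equations nn_planar n_def.
have n0 : (0 < n)%N.
  have [k [k0 /eqP nk]] := nn_nonzero.
  have kK : (k <= K)%N by rewrite leqNgt; apply: contra nk => /nn_finite ->.
  move: sumL; rewrite (bigD1_seq k) ?iota_uniq ?mem_index_iota ?k0 //= => e.
  rewrite -(ltn_pmul2l (m := 2)) // muln0 -e addn_gt0 muln_gt0 k0 lt0n nk //.
have L0 : (0 < 2 * n)%N by rewrite muln_gt0.
have TMP C : C \in TM n j nn <-> exists2 m, valid j nn m & C = iso_class m.
  split=> [/imsetP[m]|[m mv ->]]; first by rewrite inE => /asboolP; exists m.
  by apply: imset_f; rewrite inE; apply/asboolP.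
have rotTM C : C \in TM n j nn -> rotation C \in TM n j nn.
  move=> /TMP[m /(iso_class_valid j nn L0)[tb tbc ->] ->]; apply/TMP.
  rewrite rotation_iso_class; exists (rotate_root (unrooted_map tb.1 tb.2 (Ordinal L0))) => //.
  by apply: (canonical_valid L0 _ tbc).
have rotL C : C \in TM n j nn -> iter (2 * n) (@rotation _) C = C.
  move=> /TMP[m /(iso_class_valid j nn L0)[tb tbc ->] ->].
  by apply: (rotation_fixed L0 _ tbc).2; rewrite !rotinvL.
have [to toE] := cyclic_action L0 rotTM rotL order_g.
exists to; split; first by move=> C CS; rewrite -[g in to C g]expg1 toE CS.
have planar : (2 * n + 2 = j.*2 + (\sum_(1 <= k < K.+1) nn k).*2)%N.
  by move: nV; move: (\sum_(1 <= k < K.+1) nn k)%N => V; lia.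
have [P [P0 PE]] : exists P : {poly int}, (forall i, 0 <= P`_i) /\
    P * (qf j.+1 * qf j * \prod_(1 <= k < K.+1) qf (nn k)) = qn (2 * n) *
    qf (j.*2 + \sum_(1 <= k < K.+1) nn k - 2).
  by rewrite -sumL; apply: sieving_polynomial; rewrite sumL.
exists P; split.
  apply: tofrac_sieving => //; rewrite PE; congr (_ * qf _).
  by move: nV n0; move: (\sum_(1 <= k < K.+1) nn k)%N => V; lia.
split=> //.
  apply/subsetP=> _ /cycleP[k ->]; rewrite !inE mem_cycle /=.
  apply/subsetP=> C CS; rewrite inE toE CS.
  by elim: k => //= k; apply: rotTM.
move=> w e; rewrite order_g => wp.
have wp' : (#[g]%g).-primitive_root w by rewrite order_g.
have [k -> ->] := expgz_modn e wp'.
(* [w ^+ k] has order [p = 2 * n %/ gcdn k (2 * n)], and the [k]-th rotation fixes what the turn by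
   [d = gcdn k (2 * n)] fixes; [pairs_eval] compares the two sides for this [p] and [d]. *)
have Lpd : (2 * n = (2 * n %/ gcdn k (2 * n)) * gcdn k (2 * n))%N.
  by rewrite divnK // dvdn_gcdr.
rewrite -[RHS](pairs_eval L0 nn_finite sumL planar Lpd (exp_prim_root wp k) PE).
rewrite -(card_fixed_classes L0 (S := TM n j nn) k TMP); congr (_%:R).
apply: eq_card => C; rewrite !inE; apply: andb_id2l => CS.
by rewrite sub1set inE toE CS.
Qed.
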